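(* Let $(V,\omega)$ be a finite dimensional complex symplectic vector space and $\tau>0$. Let $\gamma:[0,\tau]\to\operatorname{Sp}(V)$ be a continuous path with $\gamma(0)=I_V$ and $\gamma(\tau)=M$. Let $P\in\operatorname{Sp}(V)$ be a symplectic linear map. (a) The function $f(k,M,P):=i(k,\gamma;P)-k\,i(1,\gamma;P)$ is well-defined (it depends only on $k$, $M$ and $P$, not on the path $\gamma$ from $I_V$ to $M$), and $$f(k,M,P)=f(k,P^{-1}M,I_V)-f(k,P^{-1},I_V).$$ (b) Let $X$ and $Y$ be two Lagrangian subspaces of $V$ with $V=X\oplus Y$ and $\dim V=2n$. Assume that $\omega$ is the symplectic structure of $V$ associated to some nondegenerate sesquilinear form $\Omega:X\times Y\to\mathbb C$. Let $k$ be a positive integer. Suppose that $P$ and $P^k$ have the block forms $$P=\begin{pmatrix}A&B\\ C&D\end{pmatrix},\qquad P^k=\begin{pmatrix}A(k)&B(k)\\ C(k)&D(k)\end{pmatrix}.$$ (i) If $C=0$, define the symmetric form $g(k)$ by $g(k)(y_1,y_2)=\overline{\Omega(B(k)y_2,D^ky_1)}$ for $y_1,y_2\in\ker(D^k-I_Y)$. Then $$P^k=\begin{pmatrix}A^k&\sum_{j=1}^{k-1}\binom{k-1}{j}A^jBD^{k-j}\\ 0&D^k\end{pmatrix}\quad\text{for }k>1,$$ $$f(k,P,I_V)=(1-k)n+k\dim\ker(A-I_X)-\dim\ker(A^k-I_X)+m^-(g(k))-k\,m^-(g(1)).$$ (ii) If $B=0$, define the symmetric form $h(k)$ by $h(k)(x_1,x_2)=\overline{\Omega(A^kx_1,C(k)x_2)}$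 for $x_1,x_2\in\ker(A^k-I_X)$. Then $$P^k=\begin{pmatrix}A^k&0\\ \sum_{j=1}^{k-1}\binom{k-1}{j}D^jCA^{k-j}&D^k\end{pmatrix}\quad\text{for }k>1,$$ $$f(k,P,I_V)=(1-k)n+k\dim\ker(A-I_X)-\dim\ker(D^k-I_Y)+m^+(h(k))-k\,m^+(h(1)).$$
   Context: A symplectic form $\omega$ on a complex vector space is a non-degenerate sesquilinear form (linear in the first, conjugate-linear in the second variable) with $\omega(y,x)=-\overline{\omega(x,y)}$. A subspace is Lagrangian if it equals its $\omega$-annihilator. $\operatorname{Sp}(V)$ is the group of linear automorphisms preserving $\omega$. The symplectic structure on $V=X\oplus Y$ associated to $\Omega$ is $\omega(x_1+y_1,x_2+y_2)=\Omega(x_1,y_2)-\overline{\Omega(x_2,y_1)}$. ''Symmetric form'' means Hermitian-symmetric form (values may be conjugated without effect on the indices); $m^{\pm}$ are its positive/negative Morse indices. $\operatorname{Gr}$ denotes the graph; graphs of symplectic maps are Lagrangian in $(V\times V,(-\omega)\oplus\omega)$. For a continuous path $\gamma$ in $\operatorname{Sp}(V)$ and $P\in\operatorname{Sp}(V)$, the Maslov-type index is $i_P(\gamma):=\operatorname{Mas}\{\operatorname{Gr}(\gamma(t)),\operatorname{Gr}(P)\}$, computed in $(V\times V,(-\omega)\oplus\omega)$. For $\gamma:[0,\tau]\to\operatorname{Sp}(V)$ continuous with $\gamma(0)=I_V$ and $P\in\operatorname{Sp}(V)$, the iteration path $\tilde\gamma(P):[0,\infty)\to\operatorname{Sp}(V)$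 is $\tilde\gamma(P)(t)=P^j\gamma(t-j\tau)(P^{-1}\gamma(\tau))^j$ for $t\in[j\tau,(j+1)\tau]$, $j=0,1,2,\dots$; the $k$-th iteration path is $\gamma(k,P):=\tilde\gamma(P)|_{[0,k\tau]}$, and $i(k,\gamma;P):=i_{P^k}(\gamma(k,P))$. Maslov index: let $\alpha(s),\beta(s)$, $s\in[a,b]$, be continuous paths of Lagrangian subspaces of a finite dimensional symplectic space $(E,\sigma)$. Choose $a=t_0<\dots<t_N=b$ and on each $[t_{k-1},t_k]$ a continuous family of Lagrangian subspaces $L_k(s)$ with $L_k(s)\cap\alpha(s)=L_k(s)\cap\beta(s)=\{0\}$. Write $\alpha(s)=\{y+A_k(s)y:y\in\beta(s)\}$ with $A_k(s):\beta(s)\to L_k(s)$ and put $q_k(s)(x,y)=\sigma(x,A_k(s)y)$, a Hermitian form on $\beta(s)$. Then $\operatorname{Mas}\{\alpha,\beta\}=\sum_k[m^+(q_k(t_k))-m^+(q_k(t_{k-1}))]$, independently of the choices.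
   Formalization: The printed off-diagonal blocks of P^k are false (k=2, P=(1 1;0 1): true block 2, printed 1); they are replaced by B(k)=sum_{j=0}^{k-1} A^j B D^{k-1-j} and C(k)=sum_{j=0}^{k-1} D^j C A^{k-1-j}. *)

(* Defs.v *)
From HB Require Import structures.
From mathcomp Require Import all_boot all_order all_algebra.
From mathcomp Require Import complex.
From mathcomp Require Import all_classical all_reals all_analysis.

Set Implicit Arguments.
Unset Strict Implicit.
Unset Printing Implicit Defensive.

Import Order.TTheory GRing.Theory Num.Theory.
Import numFieldNormedType.Exports.

Local Open Scope classical_set_scope.
Local Open Scope ring_scope.

(* 'End(V) is a ring in the library only for falgType's, with the product
   written in the opposite order of composition. *)
Definition lfun_exp (K : fieldType) (V : vectType K) (f : 'End(V)) (k : nat) :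
  'End(V) := iter k (comp_lfun f) \1%VF.

Definition graph (K : fieldType) (V : vectType K) (f : 'End(V)) :
  {vspace V * V} := limg (linfun (fun v : V => (v, f v))).

Lemma memv_graph (K : fieldType) (V : vectType K) (f : 'End(V)) (u : V * V) :
  (u \in graph f) = (u.2 == f u.1).
Proof.
pose h : V -> V * V := fun v => (v, f v).
have hlin : linear h.
  move=> a x y; rewrite /h linearP.
  by apply/eqP; rewrite -[_ == _]/((_ == _) && (_ == _)) /= !eqxx.
pose hM := GRing.isSemilinear.Build K V (V * V)%type _ h
  (GRing.semilinear_linear hlin).
pose hL : {linear V -> (V * V)%type} := HB.pack h hM.
apply/memv_imgP/eqP => [[v _ ->]|u2E].
  by rewrite -[fun v => _]/(hL : V -> V * V) lfunE.
exists u.1; first exact: memvf.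
by rewrite -[fun v => _]/(hL : V -> V * V) lfunE /= /h -u2E; case: u {u2E}.
Qed.

(* sigma y x = - conj (sigma x y), linear in the first variable. *)
Notation skewhermitian R E := ({hermitian E for true & (@Num.conj R[i])}).

Section Symplectic.
Variable R : realType.
Local Notation C := R[i].

(* The topology of a finite dimensional complex vector space, in coordinates. *)
Definition cont_on (U : vectType C) (a b : R) (f : R -> U) : Prop :=
  forall i : 'I_(\dim {:U}),
    {within `[a, b], continuous
       (fun s => coord (vbasis {:U}) i (f s) : (C : numFieldType))}.

(* Over a compact interval, continuity into the Grassmannian is the existence
   of a continuous frame. *)
Definition cont_vspace (E : vectType C) (a b : R) (L : R -> {vspace E}) :
    Prop :=
  exists d (e : 'I_d -> R -> E),
    (forall i, cont_on a b (e i)) /\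
    (forall s, a <= s <= b -> basis_of (L s) [seq e i s | i : 'I_d]).

Definition lagrangian (E : vectType C) (sigma : skewhermitian R E)
  (L : {vspace E}) : Prop := orthov sigma L = L.

Definition Sp (V : vectType C) (omega : skewhermitian R V) (f : 'End(V)) :
    Prop :=
  lker f = 0%VS /\ forall x y, omega (f x) (f y) = omega x y.

(* Morse indices of the restriction to W of a Hermitian form q;
   0 < q u u in R[i] says that q u u is a positive real number. *)
Definition morse_pos (U : vectType C) (q : U -> U -> C) (W : {vspace U}) : nat :=
  \max_(d < (\dim W).+1 | `[< exists S : {vspace U},
      [/\ (S <= W)%VS, \dim S = d &
          forall u, u \in S -> u != 0 -> 0 < q u u] >]) d.

Definition morse_neg (U : vectType C) (q : U -> U -> C) (W : {vspace U}) : nat :=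
  morse_pos (fun x y => - q x y) W.

Section MaslovIndex.
Variables (E : vectType C) (sigma : skewhermitian R E) (a b : R).
Variables alpha beta : R -> {vspace E}.

(* A k s is only meaningful on beta s, where alpha s is its graph. *)
Definition is_maslov (m : int) : Prop :=
  exists (N : nat) (t : nat -> R)
         (L : nat -> R -> {vspace E}) (A : nat -> R -> 'End(E)),
  let q k s : E -> E -> C := fun x y => sigma x (A k s y) in
  [/\ t 0 = a, t N = b, (forall k, (k < N)%N -> t k < t k.+1),
      (forall k, (k < N)%N ->
        cont_vspace (t k) (t k.+1) (L k) /\
        forall s, t k <= s <= t k.+1 ->
          [/\ lagrangian sigma (L k s),
              (L k s :&: alpha s)%VS = 0%VS, (L k s :&: beta s)%VS = 0%VS,
              (A k s @: beta s <= L k s)%VS &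
              alpha s = ((\1 + A k s)%VF @: beta s)%VS]) &
      m = \sum_(k < N) ((morse_pos (q k (t k.+1)) (beta (t k.+1)))%:Z
                        - (morse_pos (q k (t k)) (beta (t k)))%:Z)].

(* For continuous paths of Lagrangian subspaces there is exactly one m with
   is_maslov m. *)
Definition maslov : int := xget 0 [set m | is_maslov m].

End MaslovIndex.

Section Iteration.
Variables (V : vectType C) (omega : skewhermitian R V).

Definition double_form (u v : V * V) : C := - omega u.1 v.1 + omega u.2 v.2.

Lemma double_form_bilinear :
  bilinear_for *%R ((@Num.conj C) \; *%R) double_form.
Proof.
split=> [w a u v|w a u v]; rewrite /double_form /=.
  by rewrite !linearPl /=; rewrite mulrDr mulrN opprD addrACA.
by rewrite !linearPr /=; rewrite mulrDr mulrN opprD addrACA.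
Qed.

HB.instance Definition _ :=
  bilinear_isBilinear.Build C (V * V)%type (V * V)%type C _ _ double_form
    double_form_bilinear.

Lemma double_form_hermitian (u v : V * V) :
  double_form u v = (-1) ^+ true * Num.conj (double_form v u).
Proof.
rewrite /double_form rmorphD rmorphN mulrDr mulrN.
by congr (- _ + _); apply: hermC.
Qed.

HB.instance Definition _ :=
  isHermitianSesquilinear.Build C (V * V)%type true (@Num.conj C) double_form
    double_form_hermitian.

Definition maslov_type (a b : R) (P : 'End(V)) (gamma : R -> 'End(V)) : int :=
  maslov double_form a b (fun t => graph (gamma t)) (fun _ => graph P).

Definition symp_path (tau : R) (gamma : R -> 'End(V)) : Prop :=
  cont_on 0 tau gamma /\ forall t, 0 <= t <= tau -> Sp omega (gamma t).

(* At t = j.+1 * tau the formulas of the pieces j and j.+1 agree when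
   gamma 0 = \1 and P is invertible. *)
Definition iter_path (tau : R) (gamma : R -> 'End(V)) (P : 'End(V)) (t : R) :
    'End(V) :=
  let j := Num.truncn (t / tau) in
  (lfun_exp P j \o gamma (t - j%:R * tau)
    \o lfun_exp (P^-1 \o gamma tau) j)%VF.

Definition iter_index (k : nat) (tau : R) (gamma : R -> 'End(V))
    (P : 'End(V)) : int :=
  maslov_type 0 (k%:R * tau) (lfun_exp P k) (iter_path tau gamma P).

Definition iter_defect (k : nat) (tau : R) (gamma : R -> 'End(V))
    (P : 'End(V)) : int :=
  iter_index k tau gamma P - k%:Z * iter_index 1 tau gamma P.

(* f(k, M, P): the value of iter_defect on any path from \1 to M. *)
Definition fdefect (k : nat) (M P : 'End(V)) : int :=
  xget 0 [set z | exists (tau : R) (gamma : R -> 'End(V)),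
    [/\ 0 < tau, symp_path tau gamma, gamma 0 = \1%VF, gamma tau = M &
        z = iter_defect k tau gamma P]].

End Iteration.

Section Blocks.
Variables (V : vectType C) (X Y : {vspace V}).
Local Notation SX := (subvs_of X).
Local Notation SY := (subvs_of Y).

Definition block_form (P : 'End(V)) (A : 'End(SX)) (B : 'Hom(SY, SX))
    (C0 : 'Hom(SX, SY)) (D : 'End(SY)) : Prop :=
  forall (x : SX) (y : SY),
    P (vsval x + vsval y) = vsval (A x + B y) + vsval (C0 x + D y).

Variable Omega : {bilinear SX -> SY -> C | *%R & ((@Num.conj C) \; *%R)}.

Definition nondeg_pairing : Prop :=
  (forall x, (forall y, Omega x y = 0) -> x = 0) /\
  (forall y, (forall x, Omega x y = 0) -> y = 0).

Definition associated_form (omega : V -> V -> C) : Prop :=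
  forall (x1 x2 : SX) (y1 y2 : SY),
    omega (vsval x1 + vsval y1) (vsval x2 + vsval y2)
      = Omega x1 y2 - Num.conj (Omega x2 y1).

(* Bk and Ck stand for the off-diagonal blocks of the k-th power, A and D for
   the diagonal blocks of the map itself. *)
Definition gform (k : nat) (Bk : 'Hom(SY, SX)) (D : 'End(SY)) : SY -> SY -> C :=
  fun y1 y2 => Num.conj (Omega (Bk y2) (lfun_exp D k y1)).

Definition hform (k : nat) (Ck : 'Hom(SX, SY)) (A : 'End(SX)) : SX -> SX -> C :=
  fun x1 x2 => Num.conj (Omega (lfun_exp A k x1) (Ck x2)).

End Blocks.

End Symplectic.

(* Main.v *)
(* To three Lagrangians x, y, z attach the signature of Wall's Hermitian form.
   In a chart transverse to all three it is the sum of the signatures attached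
   to the pairs (x, y), (y, z), (z, x); hence it is antisymmetric and satisfies
   a cocycle identity. For a fixed path alpha and constant references b1, b2,
   twice the difference of the two Maslov indices is the variation along alpha
   of -(tsgn alpha b1 b2 + dim (alpha :&: b1) - dim (alpha :&: b2)): in a local
   chart the two change by the same amount. So it depends on endpoints only.

   (a) With N = P^-1 M, the map diag(N^-j, P^j) carries Gr(gamma) to the j-th
   piece of the iteration path, whence i(k, gamma; P) is the sum over j < k of
   Mas(Gr(gamma), Gr(P^(k-j) N^-j)), and each term minus Mas(Gr(gamma), Gr(P))
   depends on M and P only. By the cocycle identity the sum telescopes to an
   expression in ker(N - 1), ker(N^k - 1), ker(P - 1), ker(P^k - 1) and
   F(N) + F(P), where F(S) is the sum of the signatures of the graphs of S^j,
   S^(j+1), 1. As F is odd under inversion, the reduction formula follows.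
   That fdefect is a value of iter_defect at all uses that Sp(V) is connected,
   being generated by transvections.

   (b) If P preserves a Lagrangian X, the cocycle identity applied with X x X
   turns F(P) into psi(P^k) - k psi(P), where psi(S) is the signature of
   omega((S - 1) v, v') on {v | (S - 1) v \in X}. The rank of this form is
   known, and its negative index is m^-(g); the choice of Y instead of X gives
   m^+(h) when B = 0. *)
Require Import Defs.
From HB Require Import structures.
From mathcomp Require Import all_boot all_order all_algebra.
From mathcomp Require Import complex.
From mathcomp Require Import all_classical all_reals all_analysis.
From mathcomp Require Import zify ring lra.

Set Implicit Arguments.
Unset Strict Implicit.
Unset Printing Implicit Defensive.

Import Order.TTheory GRing.Theory Num.Theory.
Import numFieldNormedType.Exports.

Local Open Scope ring_scope.

(** * Morse indices and signatures of Hermitian forms *)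

(** In (a) the space V may contain no Lagrangian at all, for instance when ['i * omega] is definite,
    so the argument has to live in V x V. There graphs are Lagrangian, and any finite family of
    Lagrangians has a common transverse one ([rich_dbl]). This one fact stands in for the topology
    of the Lagrangian Grassmannian: it puts finitely many Lagrangians into one chart, where
    differences of Lagrangians are Hermitian forms that add up.

    The Maslov index counts m^+, whereas the cocycle identity is about signatures. The bridge is 2
    m^- + dim(radical) = dim - signature; this is the origin of the factor 2 in front of every
    index, cancelled only at the end of each computation.

    [maslov] and [fdefect] pick an element of a set, so both existence and uniqueness of the value
    have to be proved. Uniqueness of the Maslov index is the comparison of two references in the
    case where they are equal; existence is an induction along the interval. *)

Lemma linfun_linE (K : fieldType) (U U' : vectType K) (f : U -> U') :
  linear f -> linfun f =1 f.
Proof.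
move=> flin.
pose hM := GRing.isSemilinear.Build K U U' _ f (GRing.semilinear_linear flin).
pose hL : {linear U -> U'} := HB.pack f hM.
exact: (lfunE hL).
Qed.

Section ProdSpace.
Variables (K : fieldType) (U1 U2 : vectType K).

Definition prodv (P1 : {vspace U1}) (P2 : {vspace U2}) : {vspace U1 * U2} :=
  (linfun (fun x : U1 => (x, 0 : U2)) @: P1
   + linfun (fun y : U2 => (0 : U1, y)) @: P2)%VS.

Lemma inl_linear : linear (fun x : U1 => (x, 0 : U2)).
Proof. by move=> a x y; apply/eqP; rewrite xpair_eqE /= scaler0 addr0 !eqxx. Qed.

Lemma inr_linear : linear (fun y : U2 => (0 : U1, y)).
Proof. by move=> a x y; apply/eqP; rewrite xpair_eqE /= scaler0 addr0 !eqxx. Qed.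

Lemma memv_prodv P1 P2 (u : U1 * U2) :
  (u \in prodv P1 P2) = (u.1 \in P1) && (u.2 \in P2).
Proof.
apply/idP/andP => [/memv_addP[_ /memv_imgP[x xP ->] [_ /memv_imgP[y yP ->] ->]]|].
  rewrite (linfun_linE inl_linear) (linfun_linE inr_linear) /=.
  by rewrite addr0 add0r.
case: u => x y /= [xP yP].
have -> : (x, y) = linfun (fun x : U1 => (x, 0 : U2)) x
                   + linfun (fun y : U2 => (0 : U1, y)) y.
  rewrite (linfun_linE inl_linear) (linfun_linE inr_linear).
  by congr pair; rewrite ?addr0 ?add0r.
by rewrite memv_add ?memv_img.
Qed.

Lemma dim_prodv P1 P2 : \dim (prodv P1 P2) = (\dim P1 + \dim P2)%N.
Proof.
rewrite dimv_disjoint_sum; last first.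
  apply/eqP; rewrite -subv0; apply/subvP => u.
  rewrite memv_cap => /andP[/memv_imgP[x _ ->] /memv_imgP[y _]].
  rewrite (linfun_linE inl_linear) (linfun_linE inr_linear) => -[-> _].
  by rewrite memv0.
congr addn; apply: limg_dim_eq; apply/eqP; rewrite -subv0; apply/subvP => x;
  rewrite memv_cap memv_ker ?(linfun_linE inl_linear) ?(linfun_linE inr_linear);
  by move=> /andP[_ /eqP[->]]; rewrite memv0.
Qed.

End ProdSpace.

Section Signature.
Variable R : realType.
Local Notation C := R[i].
Local Notation conj := (@Num.conj C).

Section OneSpace.
Variable U : vectType C.
Implicit Types (q : U -> U -> C) (W S P N Z : {vspace U}).

Definition pos_on q S := forall u, u \in S -> u != 0 -> 0 < q u u.

(** Linearity is asked everywhere but symmetry only on W, since a form such as [inv_form] is shown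
    to be Hermitian only on its own [inv_space]. *)
Record herm_on q W : Prop := HermOn {
  herm_linl : forall a u v w, q (a *: u + v) w = a * q u w + q v w;
  herm_conj : {in W &, forall u v, q v u = conj (q u v)} }.

Lemma herm_onS q W S : (S <= W)%VS -> herm_on q W -> herm_on q S.
Proof.
by move=> /subvP sSW [ql qc]; split=> // u v /sSW uW /sSW vW; exact: qc.
Qed.

Section Herm.
Variables (q : U -> U -> C) (W : {vspace U}).
Hypothesis hq : herm_on q W.

Lemma hermDl u v w : q (u + v) w = q u w + q v w.
Proof. by have := herm_linl hq 1 u v w; rewrite scale1r mul1r. Qed.

Lemma herm0l w : q 0 w = 0.
Proof. by apply: (@addrI _ (q 0 w)); rewrite -hermDl !addr0. Qed.

Lemma hermZl a u w : q (a *: u) w = a * q u w.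
Proof. by have := herm_linl hq a u 0 w; rewrite addr0 herm0l addr0. Qed.

Lemma hermNl u w : q (- u) w = - q u w.
Proof. by rewrite -scaleN1r hermZl mulN1r. Qed.

Lemma herm_suml I (r : seq I) (Pr : pred I) (F : I -> U) w :
  q (\sum_(i <- r | Pr i) F i) w = \sum_(i <- r | Pr i) q (F i) w.
Proof.
by apply: (big_morph (fun u => q u w)) => [u v|]; rewrite ?hermDl ?herm0l.
Qed.

Lemma hermDr u v w : u \in W -> v \in W -> w \in W ->
  q u (v + w) = q u v + q u w.
Proof.
move=> uW vW wW; rewrite (herm_conj hq) ?memvD // hermDl rmorphD /=.
by rewrite -!(herm_conj hq).
Qed.

Lemma hermZr a u v : u \in W -> v \in W -> q u (a *: v) = conj a * q u v.
Proof.
move=> uW vW; rewrite (herm_conj hq) ?memvZ // hermZl rmorphM /=.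
by rewrite -!(herm_conj hq).
Qed.

Lemma herm_real u : u \in W -> q u u \is Num.real.
Proof. by move=> uW; apply/CrealP; rewrite -(herm_conj hq). Qed.

Lemma herm_on_eq0C u v : u \in W -> v \in W -> q u v = 0 -> q v u = 0.
Proof. by move=> uW vW q0; rewrite (herm_conj hq) // q0 rmorph0. Qed.

(** Complex polarization: a q(u,v) + conj(a) q(v,u) vanishes for every a, and a = 1 and a = 'i give
    the sum and the difference of the two values. *)
Lemma herm_polar : (forall u, u \in W -> q u u = 0) ->
  {in W &, forall u v, q u v = 0}.
Proof.
move=> q0 u v uW vW.
have h a : a * q u v + conj a * q v u = 0.
  have := q0 (a *: u + v); rewrite memvD ?memvZ // => /(_ isT).
  rewrite (herm_linl hq) !hermDr ?memvZ ?memvD // !hermZr // !q0 //.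
  by rewrite !mulr0 add0r addr0.
have := h 1; have := h 'i; rewrite conjCi rmorph1 !mul1r mulNr => /subr0_eq.
move=> /(mulfI (neq0Ci _)) ->; rewrite -mulr2n => /eqP.
by rewrite mulrn_eq0 => /eqP.
Qed.

End Herm.

Lemma herm_onN q W : herm_on q W -> herm_on (fun u v => - q u v) W.
Proof.
move=> hq; split=> [a u v w|u v uW vW].
  by rewrite (herm_linl hq) opprD mulrN.
by rewrite (herm_conj hq) // rmorphN.
Qed.

Lemma morse_pos_ge q W S :
  (S <= W)%VS -> pos_on q S -> (\dim S <= morse_pos q W)%N.
Proof.
move=> SW Sp; have Sd : (\dim S < (\dim W).+1)%N by rewrite ltnS dimvS.
rewrite /morse_pos.
by apply: (leq_bigmax_cond (Ordinal Sd)); apply/asboolP; exists S.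
Qed.

Lemma morse_pos_ex q W :
  exists S, [/\ (S <= W)%VS, \dim S = morse_pos q W & pos_on q S].
Proof.
rewrite /morse_pos.
apply: (@big_ind _ (fun d => exists S : {vspace U},
   [/\ (S <= W)%VS, \dim S = d & pos_on q S])).
- exists 0%VS; split; rewrite ?sub0v ?dimv0 // => u.
  by rewrite memv0 => /eqP->; rewrite eqxx.
- by move=> d1 d2 h1 h2; rewrite /maxn; case: ifP.
- by move=> d /asboolP.
Qed.

Lemma eq_morse_pos q q' W : (forall u, u \in W -> q u u = q' u u) ->
  morse_pos q W = morse_pos q' W.
Proof.
move=> qq'; apply/eqP; rewrite eqn_leq; apply/andP; split.
  have [S [SW <- Sp]] := morse_pos_ex q W; apply: morse_pos_ge => // u uS u0.
  by rewrite -qq' ?Sp // (subvP SW).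
have [S [SW <- Sp]] := morse_pos_ex q' W; apply: morse_pos_ge => // u uS u0.
by rewrite qq' ?Sp // (subvP SW).
Qed.

Lemma pos_on_disjoint q S N : pos_on q S ->
  (forall u, u \in N -> q u u <= 0) -> (S :&: N = 0)%VS.
Proof.
move=> Sp Nn; apply/eqP; rewrite -subv0; apply/subvP => u.
rewrite memv_cap memv0 => /andP[uS uN]; apply/negPn/negP => /(Sp _ uS).
by move=> /lt_geF; rewrite Nn.
Qed.

Definition neg_on q S := pos_on (fun u v => - q u v) S.
Definition null_on q W Z := forall z w, z \in Z -> w \in W -> q z w = 0.

Lemma neg_on_le0 q W S Z : herm_on q W -> (S <= W)%VS -> (Z <= W)%VS ->
  neg_on q S -> null_on q W Z -> forall u, u \in (S + Z)%VS -> q u u <= 0.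
Proof.
move=> hq SW ZW Sn Z0 _ /memv_addP[s sS [z zZ ->]].
have sW := subvP SW _ sS; have zW := subvP ZW _ zZ.
rewrite (hermDl hq) !(hermDr hq) // (Z0 z s) // (Z0 z z) //.
rewrite (herm_on_eq0C hq _ _ (Z0 z s _ _)) // !addr0.
have [->|s0] := eqVneq s 0; first by rewrite (herm0l hq).
by apply: ltW; rewrite -oppr_gt0; apply: Sn.
Qed.

(** The form is nonpositive on N + Z, so a positive subspace meets N + Z trivially and has dimension
    at most dim W - dim N - dim Z = dim P. *)
Lemma morse_pos_witness q W P N Z : herm_on q W ->
  (P <= W)%VS -> (N <= W)%VS -> (Z <= W)%VS ->
  pos_on q P -> neg_on q N -> null_on q W Z ->
  (\dim P + \dim N + \dim Z = \dim W)%N -> morse_pos q W = \dim P.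
Proof.
move=> hq PW NW ZW Pp Nn Z0 dW.
apply/eqP; rewrite eqn_leq morse_pos_ge // andbT.
have [S [SW <- Sp]] := morse_pos_ex q W.
have := neg_on_le0 hq NW ZW Nn Z0 => NZ.
have NZ0 : (N :&: Z = 0)%VS.
  apply: (pos_on_disjoint Nn) => z zZ.
  by rewrite Z0 ?oppr0 // (subvP ZW).
have := dimv_disjoint_sum (pos_on_disjoint Sp NZ).
rewrite (dimv_disjoint_sum NZ0).
have : (\dim (S + (N + Z)) <= \dim W)%N.
  by rewrite dimvS // !subv_add SW NW ZW.
lia.
Qed.

Lemma morse_neg_witness q W P N Z : herm_on q W ->
  (P <= W)%VS -> (N <= W)%VS -> (Z <= W)%VS ->
  pos_on q P -> neg_on q N -> null_on q W Z ->
  (\dim P + \dim N + \dim Z = \dim W)%N -> morse_neg q W = \dim N.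
Proof.
move=> hq PW NW ZW Pp Nn Z0 dW.
apply: (@morse_pos_witness _ _ N P Z (herm_onN hq)) => //.
- by move=> u uP u0; rewrite opprK; apply: Pp.
- by move=> z w zZ wW; rewrite Z0 ?oppr0.
- by rewrite (addnC (\dim N)).
Qed.

(** The tested vector sits in the first slot, where q is linear; the second slot would give a
    conjugate-linear map. *)
Definition conds_mx q n (s : 'I_n -> U) : 'Hom(U, 'rV[C]_n) :=
  linfun (fun w => \row_i q w (s i)).

Lemma conds_mxE q W n (s : 'I_n -> U) w : herm_on q W ->
  conds_mx q s w = \row_i q w (s i).
Proof.
move=> hq; rewrite /conds_mx linfun_linE // => a u v.
by apply/rowP => i; rewrite !mxE (herm_linl hq).
Qed.

Definition conds q W n (s : 'I_n -> U) := (W :&: lker (conds_mx q s))%VS.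

Lemma mem_conds q W n (s : 'I_n -> U) w : herm_on q W ->
  reflect (w \in W /\ forall i, q w (s i) = 0) (w \in conds q W s).
Proof.
move=> hq; rewrite memv_cap memv_ker (conds_mxE _ _ hq).
apply: (iffP andP) => -[wW].
  by move=> /eqP/rowP h; split=> // i; have := h i; rewrite !mxE.
by move=> h; split=> //; apply/eqP/rowP => i; rewrite !mxE h.
Qed.

Lemma dim_conds q W n (s : 'I_n -> U) : (\dim W <= \dim (conds q W s) + n)%N.
Proof.
rewrite -(limg_ker_dim (conds_mx q s) W) leq_add2l.
apply: leq_trans (dimvS (subvf _)) _.
by rewrite dimvf /dim /= mul1n.
Qed.

Definition orthW q W S := conds q W (fun i : 'I_(\dim S) => (vbasis S)`_i).

Lemma mem_orthW q W S w : herm_on q W -> (S <= W)%VS ->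
  reflect (w \in W /\ forall s, s \in S -> q w s = 0) (w \in orthW q W S).
Proof.
move=> hq SW; apply: (iffP (mem_conds _ _ hq)) => -[wW h]; split=> //.
  move=> s sS; apply: (herm_on_eq0C hq) => //; first exact: subvP SW _ sS.
  rewrite (coord_vbasis sS) (herm_suml hq) big1 // => i _.
  rewrite (hermZl hq) (herm_on_eq0C hq _ _ (h i)) ?mulr0 //.
  by apply: (subvP SW); rewrite vbasis_mem // mem_nth ?size_tuple.
by move=> i; rewrite h // vbasis_mem // mem_nth ?size_tuple.
Qed.

Lemma dim_orthW q W S : (\dim W <= \dim (orthW q W S) + \dim S)%N.
Proof. exact: dim_conds. Qed.

Lemma pos_on_add_line q W u S : herm_on q W -> u \in W -> (S <= W)%VS ->
  0 < q u u -> pos_on q S -> (forall s, s \in S -> q s u = 0) ->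
  pos_on q (<[u]> + S)%VS /\ \dim (<[u]> + S) = (\dim S).+1.
Proof.
move=> hq uW SW quu Sp Su; split; last first.
  have u0 : u != 0 by apply: contraTneq quu => ->; rewrite (herm0l hq) ltxx.
  rewrite dimv_disjoint_sum ?dim_vline ?u0 //.
  apply/eqP; rewrite -subv0; apply/subvP => _ /memv_capP[/vlineP[a ->] /Su].
  rewrite (hermZl hq) => /eqP; rewrite mulf_eq0 (gt_eqF quu) orbF => /eqP->.
  by rewrite scale0r mem0v.
move=> _ /memv_addP[_ /vlineP[a ->] [s sS ->]] nz.
have sW := subvP SW _ sS.
rewrite (herm_linl hq) !(hermDr hq) ?memvZ // !(hermZr hq) // (Su s) //.
rewrite (herm_on_eq0C hq _ _ (Su _ sS)) // addr0 mulr0 add0r mulrA -normCK.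
have [s0|s0] := eqVneq s 0.
  rewrite s0 (herm0l hq) addr0 mulr_gt0 // exprn_gt0 // normr_gt0.
  by apply: contraNneq nz => ->; rewrite s0 scale0r addr0.
by rewrite ltr_wpDl ?Sp // mulr_ge0 ?exprn_ge0 ?(ltW quu).
Qed.

(** Diagonalization: a vector u with q(u,u) nonzero splits off together with its orthogonal and
    joins P or N according to the sign. When no such u is left, the form vanishes by polarization
    and all of W goes into Z. *)
Lemma morse_decomp q W : herm_on q W ->
  exists P N Z, [/\ (P <= W)%VS, (N <= W)%VS & (Z <= W)%VS] /\
    [/\ pos_on q P, neg_on q N, null_on q W Z,
       {in P & N, forall x y, q x y = 0} &
      (\dim P + \dim N + \dim Z = \dim W)%N].
Proof.
have pos0 q' : pos_on q' 0%VS.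
  by move=> u; rewrite memv0 => /eqP->; rewrite eqxx.
have [n] := ubnP (\dim W); elim: n W => // n IH W dW hq.
have [q0|] := pselect (forall u, u \in W -> q u u = 0).
  exists 0%VS, 0%VS, W; split; first by rewrite !sub0v subvv.
  split; rewrite ?dimv0 //; first exact: pos0.
    by move=> z w zW wW; apply: (herm_polar hq).
  by move=> x y; rewrite !memv0 => /eqP-> _; rewrite (herm0l hq).
move=> /existsNP[u /not_implyP[uW /eqP quu]].
have [mu]: exists W', [/\ (W' <= W)%VS, forall w, w \in W' -> q w u = 0,
   (\dim W <= (\dim W').+1)%N & W = (<[u]> + W')%VS].
  have uWs : (<[u]> <= W)%VS by apply/subvP => _ /vlineP[a ->]; exact: memvZ.
  exists (orthW q W <[u]>%VS); split.
  - exact: capvSl.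
  - by move=> w /(mem_orthW _ hq uWs)[_]; apply; rewrite memv_line.
  - by have := dim_orthW q W <[u]>%VS; rewrite dim_vline; lia.
  - apply/eqP; rewrite eqEsubv subv_add uWs capvSl !andbT.
    apply/subvP => w wW; apply/memv_addP.
    exists (q w u / q u u *: u); first by rewrite memvZ ?memv_line.
    exists (w - q w u / q u u *: u); last by rewrite subrKC.
    apply/(mem_orthW _ hq uWs); split; first by rewrite memvB // memvZ.
    move=> _ /vlineP[b ->]; rewrite (hermZr hq) ?memvB ?memvZ //.
    by rewrite (hermDl hq) (hermNl hq) (hermZl hq) mulfVK // subrr mulr0.
set W' := mu => -[W'W W'u dW' WE].
have ltW' : (\dim W' < \dim W)%N.
  rewrite ltn_neqAle dimvS // andbT; apply/negP => /eqP dE.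
  have /eqP W'E : W' == W by rewrite -(dimv_leqif_eq W'W) dE.
  have : u \in W' by rewrite W'E.
  by move=> /W'u /eqP; rewrite (negPf quu).
have hq' := herm_onS W'W hq.
have [|P [N [Z [[PW NW ZW] [Pp Nn Z0 PN dE]]]]] := IH W' _ hq'.
  by move: ltW' dW => {}ltW'; rewrite ltnS => /(leq_trans ltW').
have Z0' : null_on q W Z.
  move=> z w zZ; rewrite WE => /memv_addP[_ /vlineP[a ->] [w' w'W ->]].
  have zW : z \in W by rewrite (subvP W'W) // (subvP ZW).
  have w'W' : w' \in W by rewrite (subvP W'W).
  rewrite (hermDr hq) ?memvZ // (hermZr hq) // W'u ?(subvP ZW) // mulr0 add0r.
  exact: Z0.
have PWW := subv_trans PW W'W; have NWW := subv_trans NW W'W.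
have ZWW := subv_trans ZW W'W.
have Pu s : s \in P -> q s u = 0 by move=> /(subvP PW); exact: W'u.
have Nu s : s \in N -> q s u = 0 by move=> /(subvP NW); exact: W'u.
have uWs : (<[u]> <= W)%VS by apply/subvP => _ /vlineP[a ->]; exact: memvZ.
have dWE : \dim W = (\dim W').+1 by apply/eqP; rewrite eqn_leq dW' ltW'.
have := herm_real hq uW; rewrite realE le_eqVlt eq_sym (negPf quu) /=.
rewrite le_eqVlt (negPf quu) /= => /orP[qu|qu].
  have [Pp' dP] := pos_on_add_line hq uW PWW qu Pp Pu.
  exists (<[u]> + P)%VS, N, Z; split; first by rewrite subv_add uWs.
  split=> //; last by rewrite dP dWE -dE !addSn.
  move=> _ y /memv_addP[_ /vlineP[a ->] [s sP ->]] yN.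
  have yW := subvP NWW _ yN.
  rewrite (herm_linl hq) (PN s) // (herm_on_eq0C hq _ _ (Nu _ yN)) //.
  by rewrite mulr0 addr0.
have qu' : 0 < - q u u by rewrite oppr_gt0.
have [|Nn' dN] := pos_on_add_line (herm_onN hq) uW NWW qu' Nn.
  by move=> s sN; rewrite Nu ?oppr0.
exists P, (<[u]> + N)%VS, Z; split; first by rewrite subv_add uWs.
split=> //; last by rewrite dN dWE -dE addnS addSn.
move=> x _ xP /memv_addP[_ /vlineP[a ->] [s sN ->]].
have xW := subvP PWW _ xP; have sW := subvP NWW _ sN.
by rewrite (hermDr hq) ?memvZ // (hermZr hq) // Pu // PN // mulr0 addr0.
Qed.

(** The null part Z' of a diagonalization lies in the radical Z, and P meets N + Z trivially; the
    dimension count then forces dim Z' = dim Z. *)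
Lemma morse_rank q W Z : herm_on q W ->
  (forall w, w \in Z <-> w \in W /\ forall v, v \in W -> q w v = 0) ->
  (morse_pos q W + morse_neg q W + \dim Z = \dim W)%N.
Proof.
move=> hq ZP; have [P [N [Z' [[PW NW Z'W] [Pp Nn Z'0 PN dE]]]]] := morse_decomp hq.
rewrite (morse_pos_witness hq PW NW Z'W) // (morse_neg_witness hq PW NW Z'W) //.
have ZW : (Z <= W)%VS by apply/subvP => w /ZP[].
have Z0 : null_on q W Z by move=> z w /ZP[_]; apply.
have Z'Z : (Z' <= Z)%VS.
  apply/subvP => z zZ'; apply/ZP; split; first exact: (subvP Z'W).
  by move=> v; apply: Z'0.
have NZ0 : (N :&: Z = 0)%VS.
  apply: (pos_on_disjoint Nn) => z zZ.
  by rewrite Z0 ?oppr0 // (subvP ZW).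
have := dimv_disjoint_sum (pos_on_disjoint Pp (neg_on_le0 hq NW ZW Nn Z0)).
rewrite (dimv_disjoint_sum NZ0).
have : (\dim (P + (N + Z)) <= \dim W)%N.
  by rewrite dimvS // !subv_add PW NW ZW.
have := dimvS Z'Z; lia.
Qed.

Definition msgn q W : int := (morse_pos q W)%:Z - (morse_neg q W)%:Z.

Lemma msgnN q W : msgn (fun u v => - q u v) W = - msgn q W.
Proof.
rewrite /msgn /morse_neg opprB; congr (_ - _%:Z).
by apply: eq_morse_pos => u _; rewrite opprK.
Qed.

Lemma eq_msgn q q' W : (forall u, u \in W -> q u u = q' u u) ->
  msgn q W = msgn q' W.
Proof.
move=> qq'; congr (_%:Z - _%:Z); first exact: eq_morse_pos.
by apply: eq_morse_pos => u uW; rewrite qq'.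
Qed.

(* Both indices drop by at most the codimension of I^⊥, and counting ranks
   shows that each drops by exactly that amount. *)
Lemma msgn_isotropic q W I : herm_on q W -> (I <= W)%VS ->
  {in I &, forall u v, q u v = 0} -> msgn q W = msgn q (orthW q W I).
Proof.
move=> hq IW I0; set J := orthW q W I.
have JW : (J <= W)%VS by exact: capvSl.
have hJ := herm_onS JW hq.
have JP := mem_orthW _ hq IW.
pose Zw := orthW q W W; have ZwP := mem_orthW _ hq (subvv W).
have Zw' w : w \in Zw <-> w \in W /\ forall v, v \in W -> q w v = 0.
  by split => [/ZwP|/ZwP].
pose Zj := orthW q J J; have ZjP := mem_orthW _ hJ (subvv J).
have Zj' w : w \in Zj <-> w \in J /\ forall v, v \in J -> q w v = 0.
  by split => [/ZjP|/ZjP].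
have rW := morse_rank hq Zw'; have rJ := morse_rank hJ Zj'.
have drop q' : (morse_pos q' W + \dim J <= morse_pos q' J + \dim W)%N.
  have [S [SW <- Sp]] := morse_pos_ex q' W.
  have : (\dim (S :&: J) <= morse_pos q' J)%N.
    by apply: morse_pos_ge; rewrite ?capvSr // => u /memv_capP[uS _]; exact: Sp.
  have := dimv_sum_cap S J.
  have : (\dim (S + J) <= \dim W)%N by rewrite dimvS // subv_add SW.
  lia.
have d1 := drop q; have d2 := drop (fun u v => - q u v).
rewrite -/(morse_neg q W) -/(morse_neg q J) in d2.
have IZ : (I + Zw <= Zj)%VS.
  rewrite subv_add; apply/andP; split; apply/subvP => u uI; apply/ZjP.
    have uW := subvP IW _ uI; split.
      by apply/JP; split=> // s sI; apply: I0.
    by move=> v /JP[vW]; move=> /(_ _ uI) h; apply: (herm_on_eq0C hq).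
  have [uW u0] := ZwP _ uI; split.
    by apply/JP; split=> // s sI; apply/u0/(subvP IW).
  by move=> v vJ; apply/u0/(subvP JW).
(* Vectors of I lying in the radical [Zw] impose no condition, so a complement of their span in I
   already cuts out a subspace of J. *)
have dJ : (\dim W <= \dim J + \dim (I :\: Zw))%N.
  apply: leq_trans (dim_orthW q W (I :\: Zw)%VS) _; rewrite leq_add2r.
  have IZW : (I :\: Zw <= W)%VS by apply: subv_trans (diffvSl _ _) IW.
  apply: dimvS; apply/subvP => w /(mem_orthW _ hq IZW)[wW w0].
  apply/JP; split=> // s; rewrite -(addv_diff_cap I Zw).
  move=> /memv_addP[a aI [b /memv_capP[_ /ZwP[bW b0]] ->]].
  rewrite (hermDr hq) // ?(w0 a) ?add0r //; last exact: (subvP IZW).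
  by apply: (herm_on_eq0C hq) => //; apply: b0.
have := dimvS IZ; have := dimv_sum_cap I Zw; have := dimv_cap_compl I Zw.
rewrite /msgn; lia.
Qed.

End OneSpace.

(** The map f may have a kernel: q vanishes on the diagonal there, so a positive subspace embeds
    into the image. Conversely a positive subspace of the image lifts to a complement of the kernel
    in its preimage. *)
Lemma morse_pull (U U' : vectType C) (f : 'Hom(U, U')) (q : U -> U -> C)
    (q' : U' -> U' -> C) (W : {vspace U}) :
  q' 0 0 = 0 -> (forall u, u \in W -> q u u = q' (f u) (f u)) ->
  morse_pos q W = morse_pos q' (f @: W).
Proof.
move=> q'0 qq'; apply/eqP; rewrite eqn_leq; apply/andP; split.
  have [S [SW <- Sp]] := morse_pos_ex q W.
  have SK : (S :&: lker f = 0)%VS.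
    apply/eqP; rewrite -subv0; apply/subvP => u /memv_capP[uS].
    rewrite memv_ker memv0 => /eqP fu; apply/negPn/negP => /(Sp _ uS).
    by rewrite qq' ?fu ?q'0 ?ltxx // (subvP SW).
  rewrite -(limg_dim_eq SK); apply: morse_pos_ge; first exact: limgS.
  move=> _ /memv_imgP[u uS ->] nz; rewrite -qq' ?(subvP SW) // Sp //.
  by apply: contraNneq nz => ->; rewrite linear0.
have [S [SW <- Sp]] := morse_pos_ex q' (f @: W)%VS.
pose S1 := (W :&: f @^-1: S)%VS.
have fS1 : (f @: S1 = S)%VS.
  apply/eqP; rewrite eqEsubv; apply/andP; split.
    by apply/subvP => _ /memv_imgP[u /memv_capP[_ +] ->]; rewrite -memv_preim.
  apply/subvP => s sS; have /memv_imgP[w wW sE] := subvP SW _ sS.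
  by rewrite sE memv_img // memv_cap wW -memv_preim -sE.
rewrite -fS1 -limg_ker_compl; set S2 := (S1 :\: lker f)%VS.
have S2S1 : (S2 <= S1)%VS by exact: diffvSl.
rewrite limg_dim_eq ?capv_diff //; apply: morse_pos_ge.
  by apply: subv_trans S2S1 (capvSl _ _).
move=> u uS2 nz; have /memv_capP[uW fuS] := subvP S2S1 _ uS2.
rewrite qq' // Sp ?memv_preim //; apply: contraNneq nz => fu0.
have : u \in (S2 :&: lker f)%VS by rewrite memv_cap uS2 memv_ker fu0 eqxx.
by rewrite capv_diff memv0.
Qed.

Lemma msgn_pull (U U' : vectType C) (f : 'Hom(U, U')) (q : U -> U -> C)
    (q' : U' -> U' -> C) (W : {vspace U}) :
  q' 0 0 = 0 -> (forall u, u \in W -> q u u = q' (f u) (f u)) ->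
  msgn q W = msgn q' (f @: W).
Proof.
move=> q'0 qq'; congr (_%:Z - _%:Z); first exact: morse_pull.
by apply: morse_pull => [|u uW]; rewrite ?q'0 ?oppr0 ?qq'.
Qed.

Section DirectSum.
Variables (U1 U2 : vectType C) (q1 : U1 -> U1 -> C) (q2 : U2 -> U2 -> C).

Definition sum_form (u v : U1 * U2) : C := q1 u.1 v.1 + q2 u.2 v.2.

Hypotheses (h1 : herm_on q1 fullv) (h2 : herm_on q2 fullv).

Lemma herm_sum_form : herm_on sum_form fullv.
Proof.
split=> [a u v w|u v _ _]; rewrite /sum_form.
  by rewrite /= (herm_linl h1) (herm_linl h2) mulrDr addrACA.
by rewrite rmorphD (herm_conj h1 (memvf u.1)) ?memvf //
  (herm_conj h2 (memvf u.2)) ?memvf.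
Qed.

Lemma msgn_sum_form :
  msgn sum_form fullv = msgn q1 fullv + msgn q2 fullv.
Proof.
have pos_prod (p1 : U1 -> U1 -> C) (p2 : U2 -> U2 -> C) S1 S2 :
    p1 0 0 = 0 -> p2 0 0 = 0 -> pos_on p1 S1 -> pos_on p2 S2 ->
    pos_on (fun u v : U1 * U2 => p1 u.1 v.1 + p2 u.2 v.2) (prodv S1 S2).
  move=> p10 p20 S1p S2p [x y]; rewrite memv_prodv /= => /andP[xS yS] nz.
  have [x0|x0] := eqVneq x 0.
    rewrite x0 p10 add0r S2p //; apply: contraNneq nz => ->.
    by rewrite x0.
  rewrite ltr_pwDl ?S1p //; have [->|y0] := eqVneq y 0; first by rewrite p20.
  by rewrite ltW ?S2p.
have [P1 [N1 [Z1 [[P1W N1W Z1W] [P1p N1n Z10 _ d1]]]]] := morse_decomp h1.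
have [P2 [N2 [Z2 [[P2W N2W Z2W] [P2p N2n Z20 _ d2]]]]] := morse_decomp h2.
have d : \dim {: (U1 * U2)%type} = (\dim {: U1} + \dim {: U2})%N.
  rewrite -dim_prodv; congr (\dim _); apply/esym/vspaceP => u.
  by rewrite memv_prodv !memvf.
have Pp : pos_on sum_form (prodv P1 P2).
  by apply: pos_prod; rewrite ?(herm0l h1) ?(herm0l h2).
have Nn : neg_on sum_form (prodv N1 N2).
  move=> u uN nz; rewrite /sum_form opprD.
  by apply: (pos_prod _ _ N1 N2 _ _ N1n N2n); rewrite // ?(herm0l h1) ?(herm0l h2) oppr0.
have Z0 : null_on sum_form fullv (prodv Z1 Z2).
  move=> z w; rewrite memv_prodv => /andP[z1 z2] _.
  by rewrite /sum_form Z10 ?Z20 ?memvf // addr0.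
rewrite /msgn.
rewrite (@morse_pos_witness _ sum_form fullv (prodv P1 P2) (prodv N1 N2) (prodv Z1 Z2)
  herm_sum_form) ?subvf ?dim_prodv //; last by (rewrite d -d1 -d2; lia).
rewrite (@morse_neg_witness _ sum_form fullv (prodv P1 P2) (prodv N1 N2) (prodv Z1 Z2)
  herm_sum_form) ?subvf ?dim_prodv //; last by (rewrite d -d1 -d2; lia).
rewrite (morse_pos_witness h1 P1W N1W Z1W) // (morse_neg_witness h1 P1W N1W Z1W) //.
rewrite (morse_pos_witness h2 P2W N2W Z2W) // (morse_neg_witness h2 P2W N2W Z2W) //.
lia.
Qed.

End DirectSum.

End Signature.

(** * The signature of a triple of Lagrangian subspaces *)

Section SkewForms.
Variable R : realType.
Local Notation C := R[i].
Local Notation conj := (@Num.conj C).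

Section Basics.
Variable E : vectType C.
Implicit Types (s : E -> E -> C) (L : {vspace E}).

(** Stated for bare functions, so that the doubled form and its opposite qualify without a packed
    structure. *)
Record skew_form s : Prop := SkewForm {
  skew_linl : forall a u v w, s (a *: u + v) w = a * s u w + s v w;
  skewC : forall u v, s v u = - conj (s u v) }.

Definition lagr s L : Prop :=
  forall u, u \in L <-> (forall v, v \in L -> s u v = 0).

Definition nondeg s : Prop := forall u, (forall v, s u v = 0) -> u = 0.

Section Theory.
Variable s : E -> E -> C.
Hypothesis hs : skew_form s.

(** Multiplication by 'i turns skew-Hermitian into Hermitian, which makes [orthW] and [herm_polar]
    available for symplectic forms. *)
Lemma skew_ext_herm : herm_on (fun u v => 'i * s u v) fullv.
Proof.
split=> [a u v w|u v _ _]; first by rewrite (skew_linl hs) mulrDr mulrCA.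
by rewrite rmorphM /= conjCi (skewC hs u) mulNr mulrN.
Qed.

Lemma skewDl u v w : s (u + v) w = s u w + s v w.
Proof. by have := skew_linl hs 1 u v w; rewrite scale1r mul1r. Qed.

Lemma skew0l w : s 0 w = 0.
Proof. by apply: (@addrI _ (s 0 w)); rewrite -skewDl !addr0. Qed.

Lemma skewZl a u w : s (a *: u) w = a * s u w.
Proof. by have := skew_linl hs a u 0 w; rewrite addr0 skew0l addr0. Qed.

Lemma skewNl u w : s (- u) w = - s u w.
Proof. by rewrite -scaleN1r skewZl mulN1r. Qed.

Lemma skewBl u v w : s (u - v) w = s u w - s v w.
Proof. by rewrite skewDl skewNl. Qed.

Lemma skewDr u v w : s w (u + v) = s w u + s w v.
Proof. by rewrite 3!(skewC hs _ w) skewDl rmorphD opprD. Qed.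

Lemma skewZr a u w : s w (a *: u) = conj a * s w u.
Proof. by rewrite 2!(skewC hs _ w) skewZl rmorphM mulrN. Qed.

Lemma skewNr u w : s w (- u) = - s w u.
Proof. by rewrite 2!(skewC hs _ w) skewNl rmorphN. Qed.

Lemma skew0r w : s w 0 = 0.
Proof. by rewrite (skewC hs) skew0l rmorph0 oppr0. Qed.

Lemma skewBr u v w : s w (u - v) = s w u - s w v.
Proof. by rewrite skewDr skewNr. Qed.

Lemma skew_eq0C u v : s u v = 0 -> s v u = 0.
Proof. by move=> s0; rewrite (skewC hs) s0 rmorph0 oppr0. Qed.

Lemma skew_suml I (r : seq I) (Pr : pred I) (F : I -> E) w :
  s (\sum_(i <- r | Pr i) F i) w = \sum_(i <- r | Pr i) s (F i) w.
Proof.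
by apply: (big_morph (fun u => s u w)) => [u v|]; rewrite ?skewDl ?skew0l.
Qed.

Lemma lagr0 L u v : lagr s L -> u \in L -> v \in L -> s u v = 0.
Proof. by move=> hL /hL; apply. Qed.

Hypothesis hnd : nondeg s.

Let hE := skew_ext_herm.

Let mi (a : C) : 'i * a = 0 -> a = 0.
Proof. by move=> /eqP; rewrite mulf_eq0 (negPf (neq0Ci _)) => /eqP. Qed.

Definition perp (W : {vspace E}) : {vspace E} :=
  orthW (fun u v => 'i * s u v) fullv W.

Lemma mem_perp W u : u \in perp W <-> (forall v, v \in W -> s u v = 0).
Proof.
split=> [/(mem_orthW _ hE (subvf W))[_ u0] v vW|u0]; first exact/mi/u0.
apply/(mem_orthW _ hE (subvf W)); split=> [|v vW]; first exact: memvf.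
by rewrite u0 ?mulr0.
Qed.

(** For the inequality not given by counting conditions: a vector of W orthogonal to a complement of
    [perp W] is orthogonal to everything, hence 0. So dim W is at most the codimension of
    [perp W]. *)
Lemma dim_perp (W : {vspace E}) : (\dim (perp W) + \dim W = \dim {:E})%N.
Proof.
apply/eqP; rewrite eqn_leq dim_orthW andbT.
set O := perp W; have hW := herm_onS (subvf W) hE.
pose c := \dim (O^C)%VS.
have := dim_conds (fun u v => 'i * s u v) W
  (fun i : 'I_c => (vbasis (O^C)%VS)`_i).
have -> : conds (fun u v => 'i * s u v) W
   (fun i : 'I_c => (vbasis (O^C)%VS)`_i) = 0%VS.
  apply/eqP; rewrite -subv0; apply/subvP => w /(mem_conds _ _ hW)[wW w0].
  rewrite memv0; apply/eqP/hnd => v.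
  have : v \in (O + O^C)%VS by rewrite addv_complf memvf.
  move=> /memv_addP[a /mem_perp aO [b bO ->]]; rewrite skewDr.
  rewrite (skew_eq0C (aO _ wW)) add0r.
  apply: skew_eq0C; rewrite (coord_vbasis bO) skew_suml big1 // => i _.
  by rewrite skewZl (skew_eq0C (mi (w0 i))) mulr0.
rewrite dimv0 add0n /c dimv_compl => dW.
by rewrite -leq_subRL ?dimvS ?subvf.
Qed.

Lemma perp_lagr L : lagr s L <-> perp L = L.
Proof.
split=> [hL|hL u]; last by rewrite -{1}hL; exact: mem_perp.
by apply/vspaceP => u; apply/idP/idP; [move/mem_perp/hL|move/hL/mem_perp].
Qed.

Lemma dim_lagr L : lagr s L -> (\dim L + \dim L = \dim {:E})%N.
Proof. by move/perp_lagr => {1}<-; exact: dim_perp. Qed.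

Lemma isotropic_lagr L : {in L &, forall u v, s u v = 0} ->
  (\dim L + \dim L = \dim {:E})%N -> lagr s L.
Proof.
move=> L0 dL; apply/perp_lagr/esym/eqP; rewrite eqEdim; apply/andP; split.
  by apply/subvP => u uL; apply/mem_perp => v; apply: L0.
by rewrite -(leq_add2r (\dim L)) dim_perp dL.
Qed.

Lemma lagr_sum x L : lagr s x -> lagr s L -> (x :&: L = 0)%VS ->
  (x + L)%VS = fullv.
Proof.
move=> hx hL xL; apply/eqP; rewrite eqEdim subvf dimv_disjoint_sum //.
have := dim_lagr hx; have <- := dim_lagr hL.
by rewrite !addnn => /double_inj xE; rewrite xE addnn leqnn.
Qed.

End Theory.
End Basics.

(** * Charts of the Lagrangian Grassmannian and Wall's signature *)

Section Charts.
Variables (E : vectType C) (s : E -> E -> C).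
Hypotheses (hs : skew_form s) (hnd : nondeg s).
Implicit Types x y z L : {vspace E}.

Section Reference.
Variable L : {vspace E}.
Hypothesis hL : lagr s L.

(* Behind an opaque proof, since unification would otherwise unfold the
   matrices that define the projections. *)
Fact lift_subproof :
  {f : {vspace E} -> E -> E | forall x, f x =1 daddv_pi x L}.
Proof. by exists (fun x => daddv_pi x L). Qed.

Definition lift : {vspace E} -> E -> E := sval lift_subproof.

Lemma liftE x : lift x =1 daddv_pi x L.
Proof. by rewrite /lift; case: lift_subproof. Qed.

Lemma liftP x a u v : lift x (a *: u + v) = a *: lift x u + lift x v.
Proof. by rewrite !liftE linearP. Qed.

Lemma liftD x u v : lift x (u + v) = lift x u + lift x v.
Proof. by rewrite !liftE linearD. Qed.

Lemma liftB x u v : lift x (u - v) = lift x u - lift x v.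
Proof. by rewrite !liftE linearB. Qed.

Lemma liftN x u : lift x (- u) = - lift x u.
Proof. by rewrite !liftE linearN. Qed.

Record chart x : Prop :=
  Chart { chart_lag : lagr s x; chart_trans : (x :&: L = 0)%VS }.

Lemma mem_lift x u : lift x u \in x.
Proof. by rewrite liftE memv_pi. Qed.

Lemma lift_id x u : chart x -> u \in x -> lift x u = u.
Proof. by move=> [_ xL]; rewrite liftE; apply: daddv_pi_id. Qed.

Lemma lift_sub x u : chart x -> u - lift x u \in L.
Proof.
move=> [hx xL].
have := @daddv_pi_add _ _ x L u xL; rewrite (lagr_sum hs hnd hx hL xL) memvf.
by rewrite liftE => /(_ isT) {1}<-; rewrite addrC addKr memv_pi.
Qed.

Lemma lift_ref x u : chart x -> u \in L -> lift x u = 0.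
Proof.
move=> cx uL; apply/eqP; rewrite -memv0 -(chart_trans cx) memv_cap mem_lift.
by rewrite -[lift x u](subKr u) memvB // lift_sub.
Qed.

(** Lagrangians transverse to L are graphs over E/L and form an affine space over the Hermitian
    forms on E/L. This is the difference of the points x and y, pulled back to E so that all these
    forms share one domain. *)
Definition dform x y (u v : E) : C := s (lift x u - lift y u) v.

Lemma lift_subs x y u : chart x -> chart y -> lift x u - lift y u \in L.
Proof.
move=> cx cy; have -> : lift x u - lift y u = (u - lift y u) - (u - lift x u).
  by rewrite opprB [RHS]addrC subrKA.
by rewrite memvB ?lift_sub.
Qed.

Lemma dformE x y u v : chart x -> chart y ->
  dform x y u v = s (lift x u) (lift y v).
Proof.
move=> cx cy; rewrite /dform -[in LHS](subrKC (lift y v) v) (skewDr hs).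
rewrite (lagr0 hL (lift_subs u cx cy) (lift_sub v cy)) addr0 (skewBl hs).
by rewrite (lagr0 (chart_lag cy) (mem_lift y u) (mem_lift y v)) subr0.
Qed.

Lemma dformN x y u v : dform y x u v = - dform x y u v.
Proof. by rewrite /dform -(skewNl hs) opprB. Qed.

Lemma herm_dform x y : chart x -> chart y -> herm_on (dform x y) fullv.
Proof.
move=> cx cy; split=> [a u v w|u v _ _].
  by rewrite /dform !liftP -(skew_linl hs) scalerBr addrACA -opprD.
by rewrite -[dform x y v u]opprK -dformN !dformE // (skewC hs) opprK.
Qed.

(** A radical vector u has equal lifts to x and y. The common lift lies in x and y, and u differs
    from it by an element of L. *)
Lemma dform_rad x y : chart x -> chart y ->
  forall u, u \in (L + (x :&: y))%VS <->
    u \in fullv /\ forall v, v \in fullv -> dform x y u v = 0.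
Proof.
move=> cx cy u; split=> [/memv_addP[a aL [b /memv_capP[bx b_y] ->]]|[_ u0]].
  split=> [|v _]; first exact: memvf.
  rewrite /dform !liftD (lift_ref cx aL) (lift_ref cy aL) !add0r.
  by rewrite (lift_id cx bx) (lift_id cy b_y) subrr (skew0l hs).
have /subr0_eq e : lift x u - lift y u = 0.
  by apply: hnd => v; apply/u0/memvf.
rewrite -(subrK (lift x u) u) memv_add ?lift_sub // memv_cap mem_lift e.
exact: mem_lift.
Qed.

Lemma dform_rank x y : chart x -> chart y ->
  (morse_pos (dform x y) fullv + morse_neg (dform x y) fullv + \dim (x :&: y)
   = \dim L)%N.
Proof.
move=> cx cy; have := morse_rank (herm_dform cx cy) (dform_rad cx cy).
rewrite dimv_disjoint_sum; first by have := dim_lagr hs hnd hL; lia.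
by rewrite capvC -capvA (chart_trans cy) capv0.
Qed.

Lemma dform_add x y z u v :
  dform x y u v + dform y z u v + dform z x u v = 0.
Proof.
by rewrite /dform -!(skewDl hs) !subrKA subrr (skew0l hs).
Qed.

End Reference.

(* Wall's form of a triple of Lagrangians: on wallsp it is Hermitian, because
   u.1 + u.2 lies in z. *)
Definition wall (u v : E * E) : C := - s u.1 v.2.

Definition wallsp x y z : {vspace E * E} :=
  (prodv x y :&: linfun (fun u : E * E => u.1 + u.2) @^-1: z)%VS.

Definition tsgn x y z : int := msgn wall (wallsp x y z).

Lemma mem_wallsp x y z (u : E * E) :
  reflect [/\ u.1 \in x, u.2 \in y & u.1 + u.2 \in z] (u \in wallsp x y z).
Proof.
rewrite memv_cap memv_prodv -memv_preim linfun_linE => [|a v w].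
  by apply: (iffP andP) => [[/andP[]]|[-> -> ->]].
by rewrite /= scalerDr addrACA.
Qed.

(** When the third Lagrangian is the reference itself, u |-> (lift x u, - lift y u) maps E onto
    Wall's space, and pulls Wall's form back to [dform]. *)
Lemma tsgn_chart L x y : lagr s L -> chart L x -> chart L y ->
  tsgn x y L = msgn (dform L x y) fullv.
Proof.
move=> hL cx cy; pose f u := (lift L x u, - lift L y u).
have fE : linfun f =1 f.
  apply: linfun_linE => a u v.
  by apply/eqP; rewrite xpair_eqE /= !liftP opprD scalerN !eqxx.
rewrite /tsgn; have -> : wallsp x y L = (linfun f @: fullv)%VS.
  apply/vspaceP => -[a b]; apply/mem_wallsp/memv_imgP => /= [[ax b_y ab]|[u _]].
    exists a; rewrite ?memvf // fE /f (lift_id cx) //; congr pair.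
    apply/eqP; rewrite -addr_eq0 -{1}(lift_id cy b_y) -liftD addrC.
    by rewrite (lift_ref hL cy).
  rewrite fE => -[-> ->]; rewrite memvN !mem_lift; split=> //.
  exact: lift_subs.
apply/esym/msgn_pull => [|u _]; first by rewrite /wall (skew0l hs) oppr0.
by rewrite fE /f /wall /= (skewNr hs) opprK dformE.
Qed.

(** On E x E x E take the direct sum D of the three difference forms. Their sum is zero, so the
    diagonal is isotropic and D has the same signature as its restriction to the orthogonal of the
    diagonal. That orthogonal maps onto Wall's space, and D is the pullback of Wall's form. *)
Lemma tsgn_dform L x y z : lagr s L ->
  chart L x -> chart L y -> chart L z ->
  tsgn x y z = msgn (dform L x y) fullv + msgn (dform L y z) fullv
               + msgn (dform L z x) fullv.
Proof.
move=> hL cx cy cz; move: (liftB L x) (liftB L y) (liftB L z) => lxB lyB lzB.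
move: (liftP L x) (liftP L y) => lxP lyP.
set lx := lift L x in lxB lxP *; set ly := lift L y in lyB lyP *.
set lz := lift L z in lzB *.
have hxy := herm_dform hL cx cy; have hyz := herm_dform hL cy cz.
have hzx := herm_dform hL cz cx.
pose D12 := sum_form (dform L x y) (dform L y z).
have h12 : herm_on D12 fullv := herm_sum_form hxy hyz.
pose D := sum_form D12 (dform L z x).
have hD : herm_on D fullv := herm_sum_form h12 hzx.
rewrite -(msgn_sum_form hxy hyz) -(msgn_sum_form h12 hzx) -/D12 -/D.
pose diag (u : E) : E * E * E := (u, u, u).
have diagE : linfun diag =1 diag by apply: linfun_linE.
pose I := limg (linfun diag).
have I0 : {in I &, forall u v, D u v = 0}.
  move=> _ _ /memv_imgP[u _ ->] /memv_imgP[v _ ->]; rewrite !diagE.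
  exact: dform_add.
rewrite (msgn_isotropic hD (subvf I) I0).
have JP u : u \in orthW D fullv I <->
    lx (u.1.1 - u.2) + ly (u.1.2 - u.1.1) + lz (u.2 - u.1.2) = 0.
  have e v : D u (diag v)
      = s (lx (u.1.1 - u.2) + ly (u.1.2 - u.1.1) + lz (u.2 - u.1.2)) v.
    rewrite /D /D12 /sum_form /dform /= -!(skewDl hs) lxB lyB lzB.
    rewrite -/lx -/ly -/lz; congr (s _ v).
    move: (lx _) (lx _) (ly _) (ly _) (lz _) (lz _) => a1 a2 b1 b2 c1 c2.
    by rewrite [LHS](AC (2*2*2) ((1*6)*(3*2)*(5*4))).
  split=> [/(mem_orthW _ hD (subvf I))[_ u0]|u0].
    by apply: hnd => v; rewrite -e -diagE u0 // memv_img ?memvf.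
  apply/(mem_orthW _ hD (subvf I)); split=> [|_ /memv_imgP[v _ ->]].
    exact: memvf.
  by rewrite diagE e u0 (skew0l hs).
pose f (u : E * E * E) := (lx (u.1.1 - u.2), ly (u.1.2 - u.1.1)).
have fE : linfun f =1 f.
  have BP a (b b' c c' : E) :
      a *: b + c - (a *: b' + c') = a *: (b - b') + (c - c').
    by rewrite scalerBr opprD addrACA.
  by apply: linfun_linE => a u v; rewrite /f /= !BP lxP lyP.
rewrite /tsgn; have -> : wallsp x y z = (linfun f @: orthW D fullv I)%VS.
  apply/vspaceP => -[a b]; apply/mem_wallsp/memv_imgP => /= [[ax b_y ab]|].
    (* Preimages are determined up to the diagonal; the choice of 0 as last entry makes the two
       differences in f equal to a and b. *)
    exists (a, a + b, 0).
      apply/JP; rewrite /= /lx /ly /lz subr0 sub0r liftN (addrAC a b) subrr add0r.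
      by rewrite !lift_id // subrr.
    by rewrite fE /f /= subr0 (addrAC a b) subrr add0r /lx /ly !lift_id.
  move=> [u /JP u0]; rewrite fE => -[-> ->]; rewrite !mem_lift; split=> //.
  by rewrite -[X in X \in _]opprK (addr0_eq u0) memvN mem_lift.
apply/esym/msgn_pull => [|u /JP u0]; first by rewrite /wall (skew0l hs) oppr0.
rewrite fE /f /wall /=; set p := u.1.1 - u.2; set r := u.1.2 - u.1.1.
set s0 := u.2 - u.1.2 in u0; pose v := u - diag u.2.
have Dv w : D v (diag w) = 0.
  have : v \in orthW D fullv I.
    by apply/JP; rewrite /v /= subrr subr0 sub0r !opprB subrKA.
  by move=> /(mem_orthW _ hD (subvf I))[_]; rewrite -diagE; apply;
    rewrite memv_img ?memvf.
(* D does not change when a diagonal vector, isotropic and orthogonal to v, is added, so the last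
   entry of u may be taken to be 0. *)
have -> : D u u = D v v.
  have DE v' t : (forall w, D v' (diag w) = 0) ->
      D (v' + diag t) (v' + diag t) = D v' v'.
    move=> v'0; rewrite (hermDl hD) !(hermDr hD) ?memvf // v'0.
    have -> : D (diag t) v' = 0 by apply: (herm_on_eq0C hD); rewrite ?memvf.
    have := I0 _ _ (memv_img (linfun diag) (memvf t)) (memv_img _ (memvf t)).
    by rewrite diagE => ->; rewrite !addr0.
  by rewrite -(DE _ u.2 Dv) subrK.
have rE : r = - (p + s0).
  by rewrite /p /s0 subrKA opprB.
have -> : D v v = dform L x y p p + dform L y z s0 s0.
  rewrite /D /D12 /sum_form /v /= subrr -/p -[u.1.2 - u.2]opprB -/s0.
  rewrite /dform (skew0r hs) addr0 !liftN -/ly -/lz -opprD.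
  by rewrite (skewNr hs) (skewNl hs) opprK.
(* Together with [rE], the equation [u0] identifies the two differences. The two remaining [dform]
   values therefore merge into the value of [dform s L x y] at p and p + s0 = - r, which is Wall's
   form. *)
have e : lx p - ly p = ly s0 - lz s0.
  apply/eqP; rewrite -subr_eq0 -[X in _ == X]u0 -/p -/r rE /ly liftN liftD.
  by rewrite !opprD opprK !addrA.
have -> : dform L y z s0 s0 = dform L x y p s0.
  by rewrite /dform -/lx -/ly -/lz e.
by rewrite -(dformE hL) // rE /dform (skewNr hs) (skewDr hs) opprK.
Qed.

Lemma msgn_dformN L x y :
  msgn (dform L y x) fullv = - msgn (dform L x y) fullv.
Proof. by rewrite -msgnN; apply: eq_msgn => u _; exact: dformN. Qed.

(** A hypothesis on s, since a symplectic space can lack Lagrangians; it is established for doubled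
    spaces in [rich_dbl]. *)
Definition rich : Prop := forall xs : seq {vspace E},
  (forall x, x \in xs -> lagr s x) ->
  exists2 L, lagr s L & forall x, x \in xs -> (x :&: L = 0)%VS.

Section Rich.
Hypothesis hrich : rich.

Lemma rich_chart (xs : seq {vspace E}) :
  (forall x, x \in xs -> lagr s x) ->
  exists2 L, lagr s L & forall x, x \in xs -> chart L x.
Proof.
move=> hxs; have [L hL Lxs] := hrich hxs; exists L => // x xxs.
by split; [exact: hxs|exact: Lxs].
Qed.

Lemma rich4 x y z w : lagr s x -> lagr s y -> lagr s z -> lagr s w ->
  exists L, lagr s L /\ [/\ chart L x, chart L y, chart L z & chart L w].
Proof.
move=> hx hy hz hw; have [|L hL Lxs] := @rich_chart [:: x; y; z; w].
  by move=> t; rewrite !inE => /or4P[] /eqP->.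
by exists L; split=> //; split; apply: Lxs; rewrite !inE eqxx ?orbT.
Qed.

Variables x y z : {vspace E}.
Hypotheses (hx : lagr s x) (hy : lagr s y) (hz : lagr s z).

Lemma tsgnC : tsgn y x z = - tsgn x y z.
Proof.
have [L [hL [cx cy cz _]]] := rich4 hx hy hz hz.
rewrite !(tsgn_dform hL) // (msgn_dformN L x y) (msgn_dformN L z x).
by rewrite (msgn_dformN L y z) !opprD addrAC.
Qed.

Lemma tsgn_cyc : tsgn y z x = tsgn x y z.
Proof.
have [L [hL [cx cy cz _]]] := rich4 hx hy hz hz.
rewrite !(tsgn_dform hL) //.
by move: (msgn _ _) (msgn _ _) (msgn _ _) => a b c; lia.
Qed.

Lemma tsgn_cocycle w : lagr s w ->
  tsgn x y z = tsgn x y w + tsgn y z w + tsgn z x w.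
Proof.
move=> hw; have [L [hL [cx cy cz cw]]] := rich4 hx hy hz hw.
rewrite !(tsgn_dform hL) // (msgn_dformN L x w) (msgn_dformN L y w).
rewrite (msgn_dformN L z w).
move: (msgn _ _) (msgn _ _) (msgn _ _) (msgn _ _) (msgn _ _) (msgn _ _).
by move=> a b c d e f; lia.
Qed.

End Rich.

Lemma tsgnxx x y : rich -> lagr s x -> lagr s y -> tsgn x x y = 0.
Proof. by move=> hr hx hy; have := tsgnC hr hx hx hy; lia. Qed.

End Charts.

Lemma tsgn_map (E E' : vectType C) (s : E -> E -> C) (s' : E' -> E' -> C)
    (f : 'Hom(E, E')) (x y z : {vspace E}) :
  skew_form s -> lker f = 0%VS -> (forall u v, s' (f u) (f v) = s u v) ->
  tsgn s' (f @: x) (f @: y) (f @: z) = tsgn s x y z.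
Proof.
move=> hs kf fs; have fI : injective f by apply/lker0P/eqP.
pose g (u : E * E) := (f u.1, f u.2).
have gE : linfun g =1 g.
  by apply: linfun_linE => a u v; rewrite /g /= !linearP.
rewrite /tsgn; have -> : wallsp (f @: x) (f @: y) (f @: z)
    = (linfun g @: wallsp x y z)%VS.
  apply/vspaceP => -[a b]; apply/mem_wallsp/memv_imgP => /=.
    move=> [/memv_imgP[u ux ->] /memv_imgP[v vy ->]].
    rewrite -linearD => /memv_imgP[w wz] /fI uvw.
    by exists (u, v); rewrite ?gE //; apply/mem_wallsp; split=> //=; rewrite uvw.
  move=> [u /mem_wallsp[ux uy uz]]; rewrite gE => -[-> ->].
  by rewrite -linearD !memv_img.
apply/esym/msgn_pull => [|u _]; last by rewrite gE /wall fs.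
by have := fs 0 0; rewrite !linear0 (skew0l hs) /wall => ->; rewrite oppr0.
Qed.

Lemma tsgnN (E : vectType C) (s : E -> E -> C) (x y z : {vspace E}) :
  tsgn (fun u v => - s u v) x y z = - tsgn s x y z.
Proof. by rewrite /tsgn -msgnN. Qed.

End SkewForms.

(** * Convergence of Hermitian forms and of Lagrangian subspaces *)

Section Convergence.
Variable R : realType.
Local Notation C := R[i].
Local Notation K := (C : numFieldType).
Local Notation conj := (@Num.conj C).
Variables (T : Type) (F : set_system T).
Context {FF : Filter F}.

(* Convergence in R[i], stated with epsilons so that unification does not
   unfold the topological structures. *)
Record cvgC (f : T -> C) (l : C) : Prop := CvgC {
  cvgC_near : forall e : C, 0 < e -> \forall x \near F, `|l - f x| < e }.

Lemma cvgCP f l : cvgC f l <-> ((f x : K) @[x --> F] --> (l : K))%classic.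
Proof.
split=> [[fl]|fl]; first exact/cvgrPdist_lt.
by split; move/cvgrPdist_lt: fl.
Qed.

Lemma cvgC_cst l : cvgC (fun=> l) l.
Proof. by apply/cvgCP; exact: cvg_cst. Qed.

Lemma cvgCD f g l m : cvgC f l -> cvgC g m -> cvgC (fun x => f x + g x) (l + m).
Proof. by move=> /cvgCP fl /cvgCP gm; apply/cvgCP; exact: cvgD fl gm. Qed.

Lemma cvgCN f l : cvgC f l -> cvgC (fun x => - f x) (- l).
Proof. by move=> /cvgCP fl; apply/cvgCP; exact: cvgN fl. Qed.

Lemma cvgCB f g l m : cvgC f l -> cvgC g m -> cvgC (fun x => f x - g x) (l - m).
Proof. by move=> fl /cvgCN; exact: cvgCD. Qed.

Lemma cvgCM f g l m : cvgC f l -> cvgC g m -> cvgC (fun x => f x * g x) (l * m).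
Proof. by move=> /cvgCP fl /cvgCP gm; apply/cvgCP; exact: cvgM fl gm. Qed.

Lemma cvgCV f l : l != 0 -> cvgC f l -> cvgC (fun x => (f x)^-1) l^-1.
Proof. by move=> l0 /cvgCP fl; apply/cvgCP; exact: cvgV l0 fl. Qed.

Lemma cvgC_eq f g l : (\forall x \near F, f x = g x) -> cvgC f l -> cvgC g l.
Proof.
move=> fg [fl]; split=> e /fl; apply: filterS2 fg => x fgx.
by rewrite fgx.
Qed.

Lemma cvgC_ext f g l : (forall x, g x = f x) -> cvgC f l -> cvgC g l.
Proof. by move=> gf; apply: cvgC_eq; apply: filterE. Qed.

Lemma cvgC_sum I (r : seq I) (f : I -> T -> C) (l : I -> C) :
  (forall i, cvgC (f i) (l i)) ->
  cvgC (fun x => \sum_(i <- r) f i x) (\sum_(i <- r) l i).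
Proof.
move=> fl; elim: r => [|i r IH].
  rewrite big_nil; apply: cvgC_ext (cvgC_cst 0) => x; exact: big_nil.
by rewrite big_cons; apply: cvgC_ext (cvgCD (fl i) IH) => x; exact: big_cons.
Qed.

Lemma cvgC_prod I (r : seq I) (f : I -> T -> C) (l : I -> C) :
  (forall i, cvgC (f i) (l i)) ->
  cvgC (fun x => \prod_(i <- r) f i x) (\prod_(i <- r) l i).
Proof.
move=> fl; elim: r => [|i r IH].
  rewrite big_nil; apply: cvgC_ext (cvgC_cst 1) => x; exact: big_nil.
by rewrite big_cons; apply: cvgC_ext (cvgCM (fl i) IH) => x; exact: big_cons.
Qed.

Lemma cvgC_neq0 f l : l != 0 -> cvgC f l -> \forall x \near F, f x != 0.
Proof.
move=> l0 [/(_ `|l|)]; rewrite normr_gt0 => /(_ l0).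
by apply: filterS => x; apply: contraTneq => ->; rewrite subr0 ltxx.
Qed.

(** The order of R[i] compares only numbers with the same imaginary part, so nearness to a positive
    number gives positivity only for real values. *)
Lemma cvgC_gt0 f l : (\forall x \near F, f x \is Num.real) -> 0 < l ->
  cvgC f l -> \forall x \near F, 0 < f x.
Proof.
move=> fr l0 [/(_ _ l0)]; apply: filterS2 fr => x fr lfx.
have lr : l - f x \is Num.real by rewrite rpredB // gtr0_real.
have := le_lt_trans (real_ler_norm lr) lfx.
by rewrite gtrBl.
Qed.

Lemma cvgC_det n (A : T -> 'M[C]_n) (A0 : 'M[C]_n) :
  (forall i j, cvgC (fun x => A x i j) (A0 i j)) ->
  cvgC (fun x => \det (A x)) (\det A0).
Proof.
move=> AA0; rewrite /determinant; apply: cvgC_sum => s.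
by apply: cvgCM; [exact: cvgC_cst|apply: cvgC_prod => i; exact: AA0].
Qed.

(** Adjugate over determinant: both are polynomial in the entries, and the determinant stays away
    from 0. *)
Lemma cvgC_invmx n (A : T -> 'M[C]_n) (A0 : 'M[C]_n) :
  A0 \in unitmx -> (forall i j, cvgC (fun x => A x i j) (A0 i j)) ->
  (\forall x \near F, A x \in unitmx) /\
  forall i j, cvgC (fun x => invmx (A x) i j) (invmx A0 i j).
Proof.
move=> u0 AA0; have d0 : \det A0 != 0 by rewrite -unitfE -unitmxE.
have dA := cvgC_det AA0.
have uA : \forall x \near F, A x \in unitmx.
  by apply: filterS (cvgC_neq0 d0 dA) => x; rewrite unitmxE unitfE.
split; first exact: uA.
move=> i j.
have aA : cvgC (fun x => (\adj (A x)) i j) ((\adj A0) i j).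
  rewrite mxE; apply: (@cvgC_ext (fun x => cofactor (A x) j i)).
    by move=> x; rewrite mxE.
  apply: cvgCM; first exact: cvgC_cst.
  apply: cvgC_det => k l; rewrite !mxE.
  by apply: cvgC_ext (AA0 _ _) => x; rewrite !mxE.
have -> : invmx A0 i j = (\det A0)^-1 * (\adj A0) i j by rewrite /invmx u0 mxE.
apply: cvgC_eq (cvgCM (cvgCV d0 dA) aA).
by apply: filterS uA => x ux; rewrite /invmx ux [RHS]mxE.
Qed.

(** * Semicontinuity of the Morse indices *)

Section Semicontinuity.
Variable U : vectType C.
Implicit Types (q : T -> U -> U -> C) (p : U -> U -> C) (S W : {vspace U}).

(* Induction on the dimension, through the Schur complement of a vector. *)
Lemma pos_on_near q (q0 : U -> U -> C) S : (\forall x \near F, herm_on (q x) S) ->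
  herm_on q0 S -> {in S &, forall u v, cvgC (fun x => q x u v) (q0 u v)} ->
  pos_on q0 S -> \forall x \near F, pos_on (q x) S.
Proof.
have [n] := ubnP (\dim S); elim: n S q q0 => // n IH S q q0 dS hq h0 qq0 p0.
have [S0|] := eqVneq S 0%VS.
  near=> x => u; rewrite S0 memv0 => /eqP->; by rewrite eqxx.
rewrite -vpick0; set u := vpick S => u0; have uS : u \in S by exact: memv_pick.
set S' := (S :\: <[u]>)%VS; have S'S : (S' <= S)%VS by exact: diffvSl.
have SE : (<[u]> + S')%VS = S.
  by have := addv_diff_cap S <[u]>%VS; rewrite addvC (capv_idPr _) // -memvE.
have dS' : (\dim S' < n)%N.
  have := dimv_cap_compl S <[u]>%VS; rewrite (capv_idPr _) -?memvE //.
  rewrite dim_vline u0 -/S' => dE; move: dS; rewrite -dE.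
  by rewrite ltnS add1n.
have u0p : 0 < q0 u u by exact: p0.
have realq : \forall x \near F, q x u u \is Num.real.
  by apply: filterS hq => x hx; exact: (herm_real hx).
have upos := cvgC_gt0 realq u0p (qq0 _ _ uS uS).
(* Completing the square in the coefficient of u leaves this form on the complement S' of u; [schE]
   is the resulting identity. *)
pose sch p v w := p v w - p v u * p u w / p u u.
have schh p : herm_on p S -> herm_on (sch p) S'.
  move=> hp; split=> [a v w z|v w /(subvP S'S) vS /(subvP S'S) wS].
    by rewrite /sch !(hermDl hp) !(hermZl hp); ring.
  rewrite /sch rmorphB !rmorphM fmorphV /= -!(herm_conj hp) //.
  by rewrite (mulrC (p w u)).
have schE p a w : herm_on p S -> w \in S' -> p u u != 0 ->
    p (a *: u + w) (a *: u + w)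
    = p u u * `|a + p w u / p u u| ^+ 2 + sch p w w.
  move=> hp /(subvP S'S) wS nz.
  rewrite (herm_linl hp) !(hermDr hp) ?memvZ // !(hermZr hp) // normCK.
  rewrite rmorphD rmorphM fmorphV /= -!(herm_conj hp) // /sch.
  rewrite mulrDr !mulrDl.
  by field.
have : \forall x \near F, pos_on (sch (q x)) S'.
  apply: (IH _ _ (sch q0)) => //.
  - by apply: filterS hq => x; exact: schh.
  - exact: schh.
  - move=> v w /(subvP S'S) vS /(subvP S'S) wS.
    apply: cvgCB; first exact: qq0.
    apply: cvgCM; first by apply: cvgCM; exact: qq0.
    by apply: cvgCV; [rewrite gt_eqF|exact: qq0].
  (* This coefficient of u makes the square vanish, so the Schur complement at w is a value of [q0]
     at a nonzero vector of S. *)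
  - move=> w wS' w0; have := schE q0 (- (q0 w u / q0 u u)) w h0 wS'.
    rewrite gt_eqF // => /(_ isT); rewrite addNr normr0 expr0n mulr0 add0r => <-.
    apply: p0; first by apply: memvD; [exact: memvZ|exact: (subvP S'S)].
    apply: contraNneq w0 => /eqP; rewrite addr_eq0 scaleNr eqr_opp => /eqP wE.
    have : w \in (S' :&: <[u]>)%VS by rewrite memv_cap wS' -wE memvZ ?memv_line.
    by rewrite capv_diff memv0.
move=> IHS'; near=> x => v; rewrite -SE => /memv_addP[_ /vlineP[a ->] [w wS' ->]] nz.
have hx : herm_on (q x) S by near: x.
have ux : 0 < q x u u by near: x.
have px : pos_on (sch (q x)) S' by near: x.
rewrite schE ?gt_eqF //.
have [w0|w0] := eqVneq w 0; last first.
  by rewrite ltr_wpDl ?px // mulr_ge0 ?exprn_ge0 // ltW.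
rewrite w0 /sch !(herm0l hx) !mul0r subrr !addr0 mulr_gt0 // exprn_gt0 // normr_gt0.
by apply: contraNneq nz => ->; rewrite w0 scale0r addr0.
Unshelve. all: by end_near. Qed.

(** A maximal positive subspace of the limit form stays positive for nearby forms; the index can
    only jump upwards. *)
Lemma morse_pos_near q (q0 : U -> U -> C) W : (\forall x \near F, herm_on (q x) W) ->
  herm_on q0 W -> {in W &, forall u v, cvgC (fun x => q x u v) (q0 u v)} ->
  \forall x \near F, (morse_pos q0 W <= morse_pos (q x) W)%N.
Proof.
move=> hq h0 qq0; have [S [SW <- Sp]] := morse_pos_ex q0 W.
have hqS : \forall x \near F, herm_on (q x) S.
  by apply: filterS hq => x; exact: herm_onS.
have : \forall x \near F, pos_on (q x) S.
  apply: (pos_on_near hqS (herm_onS SW h0)) => // u v /(subvP SW) uW /(subvP SW) vW.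
  exact: qq0.
by apply: filterS => x px; exact: morse_pos_ge.
Qed.

End Semicontinuity.

(** * Convergence of Lagrangians in a chart *)

Section ChartContinuity.
Variables (E : vectType C) (s : E -> E -> C).
Hypotheses (hs : skew_form s) (hnd : nondeg s).
Variable L : {vspace E}.
Hypothesis hL : lagr s L.
Implicit Types x y : T -> {vspace E}.

Lemma lift_unique z u p : chart s L z -> p \in z -> u - p \in L ->
  lift L z u = p.
Proof.
move=> cz pz upL; rewrite -(subrK p u) liftD.
by rewrite (lift_ref hs hnd hL cz upL) (lift_id cz pz) add0r.
Qed.

(** Convergence in the Grassmannian read in the chart of L: the projections along L converge, tested
    weakly against s. *)
Record cvg_lagr x (x0 : {vspace E}) : Prop := CvgLagr {
  cvg_lagr_chart : \forall a \near F, chart s L (x a);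
  cvg_lagr_chart0 : chart s L x0;
  cvg_lagr_lift : forall u v,
    cvgC (fun a => s (lift L (x a) u) v) (s (lift L x0 u) v) }.

Lemma cvg_lagr_cst (x0 : {vspace E}) : chart s L x0 -> cvg_lagr (fun=> x0) x0.
Proof.
by move=> cx; split=> // [|u v]; [exact: filterE|exact: cvgC_cst].
Qed.

(** Both Morse indices are lower semicontinuous, and by transversality their sum is dim L at the
    limit and nearby. Hence neither can jump. *)
Lemma msgn_dform_near x y (x0 y0 : {vspace E}) : cvg_lagr x x0 -> cvg_lagr y y0 ->
  (x0 :&: y0 = 0)%VS -> (\forall a \near F, (x a :&: y a = 0)%VS) ->
  \forall a \near F,
    msgn (dform s L (x a) (y a)) fullv = msgn (dform s L x0 y0) fullv.
Proof.
move=> [cx cx0 lx] [cy cy0 ly] xy0 xy.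
have hd : \forall a \near F, herm_on (dform s L (x a) (y a)) fullv.
  by apply: filterS2 cx cy => a cxa cya; exact: herm_dform.
have hd0 := herm_dform hs hnd hL cx0 cy0.
have dd u v : cvgC (fun a => dform s L (x a) (y a) u v) (dform s L x0 y0 u v).
  rewrite /dform (skewBl hs).
  by apply: cvgC_ext (cvgCB (lx u v) (ly u v)) => a; rewrite (skewBl hs).
have pn := morse_pos_near hd hd0 (fun u v _ _ => dd u v).
have hdN : \forall a \near F,
    herm_on (fun u v => - dform s L (x a) (y a) u v) fullv.
  by apply: filterS hd => a; exact: herm_onN.
have nn := morse_pos_near hdN (herm_onN hd0) (fun u v _ _ => cvgCN (dd u v)).
have r0 := dform_rank hs hnd hL cx0 cy0; rewrite xy0 dimv0 addn0 in r0.
near=> a.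
have cxa : chart s L (x a) by near: a.
have cya : chart s L (y a) by near: a.
have xya : (x a :&: y a = 0)%VS by near: a.
have pna : (morse_pos (dform s L x0 y0) fullv
            <= morse_pos (dform s L (x a) (y a)) fullv)%N by near: a.
have nna : (morse_neg (dform s L x0 y0) fullv
            <= morse_neg (dform s L (x a) (y a)) fullv)%N by near: a.
have := dform_rank hs hnd hL cxa cya; rewrite xya dimv0 addn0 => ra.
move: pna nna r0 ra; rewrite /msgn; move: (morse_pos _ _) (morse_neg _ _).
move: (morse_pos _ _) (morse_neg _ _) (\dim L) => a1 b1 n a2 b2.
by move=> h1 h2 <- h3; lia.
Unshelve. all: by end_near. Qed.

(* The coordinates in the moving frame converge by Cramer's rule. *)
Lemma cvg_lagr_frame d (e : 'I_d -> T -> E) (e0 : 'I_d -> E) x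
    (x0 : {vspace E}) :
  (forall i v, cvgC (fun a => s (e i a) v) (s (e0 i) v)) ->
  (\forall a \near F, lagr s (x a) /\ basis_of (x a) [seq e i a | i : 'I_d]) ->
  chart s L x0 -> basis_of x0 [seq e0 i | i : 'I_d] -> cvg_lagr x x0.
Proof.
move=> ee0 bx cx0 bx0.
have sz (g : 'I_d -> E) : size [seq g i | i : 'I_d] == d.
  by rewrite size_map size_enum_ord.
have nthE (g : 'I_d -> E) (i : 'I_d) : [seq g i | i : 'I_d]`_i = g i.
  by rewrite (nth_map i) ?size_enum_ord // nth_ord_enum.
have dL : \dim L = d.
  have dx : \dim x0 = d := size_basis (X := Tuple (sz e0)) bx0.
  have := dim_lagr hs hnd (chart_lag cx0); have <- := dim_lagr hs hnd hL.
  by rewrite dx !addnn => /double_inj.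
have [f fP] : exists f : d.-tuple E, basis_of L f.
  by move: (vbasis L) (vbasisP L); rewrite dL => f fP; exists f.
have memL u : u \in L <-> forall j : 'I_d, s u f`_j = 0.
  split=> [uL j|u0].
    by rewrite (lagr0 hL uL) // (basis_mem fP) // mem_nth ?size_tuple.
  apply/hL => v vL; apply: (skew_eq0C hs).
  rewrite (coord_basis fP vL) (skew_suml hs) big1 // => i _.
  by rewrite (skewZl hs) (skew_eq0C hs (u0 i)) mulr0.
(* The pairing matrix of a frame with a basis f of L. It is invertible exactly when the framed
   Lagrangian is transverse to L, and its inverse gives the coordinates of the lift. *)
pose G (g : 'I_d -> E) := \matrix_(i < d, j < d) s (g i) f`_j.
pose P (g : 'I_d -> E) (c : 'rV[C]_d) := \sum_i c 0 i *: g i.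
have PG g c (j : 'I_d) : s (P g c) f`_j = (c *m G g) 0 j.
  rewrite /P (skew_suml hs) mxE; apply: eq_bigr => i _.
  by rewrite (skewZl hs) mxE.
have Pmem z g c : basis_of z [seq g i | i : 'I_d] -> P g c \in z.
  move=> bz; apply: memv_suml => i _; rewrite memvZ // (basis_mem bz) //.
  by rewrite map_f ?mem_enum.
have Pinj z g c : basis_of z [seq g i | i : 'I_d] -> P g c = 0 -> c = 0.
  move=> /basis_free bz Pc; apply/rowP => i; rewrite mxE.
  have /freeP fz : free (Tuple (sz g)) := bz; apply: (fz (fun i => c 0 i)).
  by rewrite -[RHS]Pc; apply: eq_bigr => j _; rewrite nthE.
have unitG z g : lagr s z -> basis_of z [seq g i | i : 'I_d] ->
    (G g \in unitmx) <-> (z :&: L = 0)%VS.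
  move=> hz bz; split=> [uG|zL].
    apply/eqP; rewrite -subv0; apply/subvP => v /memv_capP[vz vL].
    rewrite memv0 (coord_basis (X := Tuple (sz g)) bz vz).
    pose c := \row_i coord (Tuple (sz g)) i v.
    have vE : v = P g c.
      rewrite {1}(coord_basis (X := Tuple (sz g)) bz vz); apply: eq_bigr => i _.
      by rewrite mxE nthE.
    have c0 : c = 0.
      apply: (can_inj (mulmxK uG)); rewrite mul0mx; apply/rowP => j.
      by rewrite -PG -vE [RHS]mxE; move/memL: vL; apply.
    apply/eqP; rewrite big1 // => i _; have /rowP/(_ i) := c0.
    by rewrite !mxE => ->; rewrite scale0r.
  rewrite -row_free_unit; apply: inj_row_free => c cG.
  apply: (Pinj z g) => //; apply/eqP; rewrite -memv0 -zL memv_cap Pmem //.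
  by apply/memL => j; rewrite PG cG mxE.
have G0 : G e0 \in unitmx by apply/(unitG x0) => //; case: cx0.
pose Ga a := G (e ^~ a).
have GaG i j : cvgC (fun a => Ga a i j) (G e0 i j).
  by rewrite mxE; apply: cvgC_ext (ee0 i f`_j) => a; rewrite mxE.
have [uGa iGa] := cvgC_invmx G0 GaG.
pose r u : 'rV[C]_d := \row_j s u f`_j.
have liftG z g u : chart s L z -> basis_of z [seq g i | i : 'I_d] ->
    G g \in unitmx -> lift L z u = P g (r u *m invmx (G g)).
  move=> cz bz uG; apply: lift_unique => //; first exact: Pmem.
  by apply/memL => j; rewrite (skewBl hs) PG mulmxKV // mxE subrr.
have cxa : \forall a \near F, chart s L (x a).
  apply: filterS2 bx uGa => a [ha ba] uG.
  by split=> //; apply/(unitG _ _ ha ba).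
split=> // u v.
apply: (@cvgC_eq (fun a => s (P (e ^~ a) (r u *m invmx (Ga a))) v)).
  apply: filterS3 bx cxa uGa => a [_ ba] ca ua.
  by rewrite (liftG _ _ _ ca ba ua).
rewrite (liftG _ e0) // /P (skew_suml hs).
apply: cvgC_ext => [a|]; first exact: (skew_suml hs).
apply: cvgC_sum => i; rewrite (skewZl hs).
apply: cvgC_ext => [a|]; first exact: (skewZl hs).
apply: cvgCM (ee0 i v); rewrite mxE.
apply: cvgC_ext => [a|]; first by rewrite mxE.
by apply: cvgC_sum => j; apply: cvgCM (iGa j i); exact: cvgC_cst.
Unshelve. all: by end_near. Qed.

End ChartContinuity.
End Convergence.

(** * Existence and uniqueness of the Maslov index *)

(** Real induction: at the supremum s of the points where P holds, some such point lies just left of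
    s, and the local hypothesis carries P past s unless b has been reached. *)
Lemma real_ind (R : realType) (P : R -> Prop) (a b : R) : a <= b -> P a ->
  (forall s, a <= s <= b -> exists2 d, 0 < d &
     forall u v, a <= u -> s - d < u -> u <= s -> s <= v -> v < s + d -> v <= b ->
       P u -> P v) ->
  P b.
Proof.
move=> ab Pa loc; pose S := [set x : R | (a <= x <= b) /\ P x]%classic.
have Sa : S a by split; rewrite ?lexx.
have ubS : ubound S b by move=> x [/andP[]].
have hS : has_sup S by split; [exists a|exists b].
have s_ab : a <= sup S <= b.
  by rewrite ub_le_sup ?ge_sup //; [exists a|exists b].
have [d d0 step] := loc _ s_ab.
have [u [/andP[au ub] Pu] du] := sup_adherent d0 hS.
have us : u <= sup S by apply: ub_le_sup; [exists b|split; rewrite ?au].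
have sd : sup S < sup S + d / 2 by rewrite ltrDl divr_gt0.
have sd2 : sup S + d / 2 < sup S + d.
  by rewrite ltrD2l ltr_pdivrMr // ltr_pMr // ltr1n.
case: (lerP b (sup S + d / 2)) => bd.
  apply: (step u b) => //; first by case/andP: s_ab.
  exact: le_lt_trans bd sd2.
have Pv : P (sup S + d / 2) by apply: (step u) => //; exact: ltW.
have : sup S + d / 2 <= sup S.
  apply: ub_le_sup; first by exists b.
  split=> //; rewrite (ltW bd) andbT.
  by apply: le_trans (ltW sd); case/andP: s_ab.
by rewrite leNgt sd.
Qed.

(** * One-sided neighbourhoods and locally constant functions *)

Section NearSides.
Variable R : realType.
Implicit Types (P : R -> Prop) (s u v : R).

Lemma near_itv u v s :
  \forall x \near within `[u, v]%classic (nbhs s), u <= x <= v.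
Proof. by rewrite near_withinE; apply: filterE => x /=; rewrite in_itv. Qed.

Lemma near_within_itv P s u v : (\forall x \near within `[u, v]%classic (nbhs s), P x) ->
  exists2 d, 0 < d & forall x, u <= x <= v -> s - d < x -> x < s + d -> P x.
Proof.
move=> /nbhs_ballP[d /= d0 bP]; exists d => // x uxv sx xs.
apply: bP => /=; last by rewrite in_itv.
by rewrite /ball /= ltr_norml; apply/andP; split; lra.
Qed.

Lemma near_right P s v : s < v -> (\forall x \near s^'+%classic, P x) ->
  exists2 d, 0 < d & forall x, s < x -> x < s + d -> P x.
Proof.
move=> sv /nbhs_ballP[d /= d0 bP]; exists d => // x sx xs.
apply: bP => //=; rewrite /ball /= distrC gtr0_norm ?subr_gt0 //.
by rewrite ltrBlDl.
Qed.

Lemma near_left P s v : v < s -> (\forall x \near s^'-%classic, P x) ->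
  exists2 d, 0 < d & forall x, s - d < x -> x < s -> P x.
Proof.
move=> sv /nbhs_ballP[d /= d0 bP]; exists d => // x sx xs.
apply: bP => //=; rewrite /ball /= gtr0_norm ?subr_gt0 //.
by rewrite ltrBlDl -ltrBlDr.
Qed.

Lemma within_right P s u v : u <= s -> s < v ->
  (\forall x \near within `[u, v]%classic (nbhs s), P x) ->
  \forall x \near s^'+%classic, P x.
Proof.
move=> us sv /near_within_itv[d d0 dP]; near=> x; apply: dP.
- by rewrite (le_trans us) ?ltW.
- by rewrite (lt_trans _ (_ : s < x)) // ltrBlDr ltrDl.
- by near: x; apply: nbhs_right_lt; rewrite ltrDl.
Unshelve. all: by end_near. Qed.

Lemma within_left P s u v : u < s -> s <= v ->
  (\forall x \near within `[u, v]%classic (nbhs s), P x) ->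
  \forall x \near s^'-%classic, P x.
Proof.
move=> us sv /near_within_itv[d d0 dP]; near=> x; apply: dP.
- by rewrite (le_trans _ sv) ?andbT ?ltW.
- by near: x; apply: nbhs_left_gt; rewrite ltrBlDr ltrDl.
- by rewrite (lt_trans (_ : x < s)) // ltrDl.
Unshelve. all: by end_near. Qed.

(** The hypotheses are one-sided because at a division point of a Maslov subdivision the two sides
    are governed by different pieces. *)
Lemma locally_constant (f : R -> int) a b : a <= b ->
  (forall s, a <= s < b -> \forall x \near s^'+%classic, f x = f s) ->
  (forall s, a < s <= b -> \forall x \near s^'-%classic, f x = f s) ->
  f a = f b.
Proof.
move=> ab fR fL; apply/esym.
apply: (real_ind (P := fun x => f x = f a) ab) => // s /andP[a_s sb].
have [d1 d10 h1] : exists2 d, 0 < d &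
    forall x, s < x -> x < s + d -> x <= b -> f x = f s.
  case: (ltrP s b) => [sb'|bs]; last first.
    by exists 1 => // x sx _ xb; have := lt_le_trans sx xb; rewrite ltNge bs.
  have [|d d0 h] := near_right sb' (fR s _); first by rewrite a_s.
  by exists d => // x sx xs _; exact: h.
have [d2 d20 h2] : exists2 d, 0 < d &
    forall x, s - d < x -> x < s -> a <= x -> f x = f s.
  case: (ltrP a s) => [as'|sa]; last first.
    by exists 1 => // x _ xs ax; have := le_lt_trans ax xs; rewrite ltNge sa.
  have [|d d0 h] := near_left as' (fL s _); first by rewrite as'.
  by exists d => // x sx xs _; exact: h.
exists (Num.min d1 d2); first by rewrite lt_min d10.
move=> u v au du us sv dv vb fu.
have fv : f v = f s.
  move: sv; rewrite le_eqVlt => /orP[/eqP->//|sv]; apply: h1 => //.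
  by apply: lt_le_trans dv _; rewrite lerD2l ge_min lexx.
rewrite fv -fu; move: us; rewrite le_eqVlt => /orP[/eqP->//|us].
apply/esym/h2 => //; apply: le_lt_trans du.
by rewrite lerD2l lerN2 ge_min lexx orbT.
Qed.

End NearSides.

Section Continuity.
Variable R : realType.
Local Notation C := R[i].
Variable E : vectType C.

(** [cont_on] speaks of coordinates, and a linear functional is a fixed finite combination of
    them. *)
Lemma cont_on_cvg (a b s0 : R) (f : R -> E) (phi : E -> C) :
  (forall c u v, phi (c *: u + v) = c * phi u + phi v) ->
  cont_on a b f -> a <= s0 <= b ->
  cvgC (within `[a, b]%classic (nbhs s0)) (fun s => phi (f s)) (phi (f s0)).
Proof.
move=> phiP cf s0ab.
have phi0 : phi 0 = 0.
  by have := phiP 1 0 0; rewrite scaler0 addr0 mul1r => /eqP;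
    rewrite -subr_eq0 opprD addNKr oppr_eq0 => /eqP.
have phiD u v : phi (u + v) = phi u + phi v.
  by have := phiP 1 u v; rewrite scale1r mul1r.
have phiZ c u : phi (c *: u) = c * phi u.
  by have := phiP c u 0; rewrite !addr0 phi0 addr0.
have phiE u : phi u
    = \sum_(i < \dim {:E}) coord (vbasis {:E}) i u * phi (vbasis {:E})`_i.
  rewrite {1}(coord_vbasis (memvf u)) (big_morph phi phiD phi0).
  by apply: eq_bigr => i _; rewrite phiZ.
rewrite [phi (f s0)]phiE; apply: (cvgC_ext (fun s => phiE (f s))).
apply: cvgC_sum => i; apply: cvgCM; last exact: cvgC_cst.
apply/cvgCP; have /subspace_continuousP := cf i; apply.
by rewrite /= in_itv.
Qed.

Lemma cont_on_intro (a b : R) (f : R -> E) :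
  (forall s0 i, a <= s0 <= b -> cvgC (within `[a, b]%classic (nbhs s0))
     (fun s => coord (vbasis {:E}) i (f s)) (coord (vbasis {:E}) i (f s0))) ->
  cont_on a b f.
Proof.
move=> h i; apply/subspace_continuousP => s0; rewrite /= in_itv /= => s0ab.
by apply/cvgCP; exact: h.
Qed.

Lemma cont_on_cst (a b : R) (u : E) : cont_on a b (fun=> u).
Proof. by apply: cont_on_intro => s0 i _; exact: cvgC_cst. Qed.

Lemma cont_on_sub (a b u v : R) (f : R -> E) : a <= u -> v <= b ->
  cont_on a b f -> cont_on u v f.
Proof.
move=> au vb cf i; apply: continuous_subspaceW (cf i) => s /=.
by rewrite !in_itv /= => /andP[us sv]; rewrite (le_trans au) ?(le_trans sv).
Qed.

Lemma cont_vspace_sub (a b u v : R) (L : R -> {vspace E}) : a <= u -> v <= b ->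
  cont_vspace a b L -> cont_vspace u v L.
Proof.
move=> au vb [d [e [ce be]]]; exists d, e; split=> [i|s /andP[us sv]].
  exact: cont_on_sub (ce i).
by apply: be; rewrite (le_trans au) ?(le_trans sv).
Qed.

Lemma cont_vspace_cst (a b : R) (L : {vspace E}) : cont_vspace a b (fun=> L).
Proof.
exists (\dim L), (fun i _ => (vbasis L)`_i); split=> [i|s _].
  exact: cont_on_cst.
have -> : [seq (vbasis L)`_i | i : 'I_(\dim L)] = vbasis L.
  apply: (@eq_from_nth _ 0); first by rewrite size_map size_enum_ord size_tuple.
  move=> i; rewrite size_map size_enum_ord => id.
  by rewrite (nth_map (Ordinal id)) ?size_enum_ord //= nth_enum_ord.
exact: vbasisP.
Qed.

End Continuity.

Lemma cont_on_lin (R : realType) (E E' : vectType R[i]) (a b : R) (f : R -> E)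
    (g : 'Hom(E, E')) : cont_on a b f -> cont_on a b (fun s => g (f s)).
Proof.
move=> cf; apply: cont_on_intro => s0 i s0ab.
apply: (cont_on_cvg (phi := fun u => coord (vbasis {:E'}) i (g u))) => // c u v.
by rewrite !linearP.
Qed.

Lemma cont_on_shift (R : realType) (E : vectType R[i]) (a b c : R) (f : R -> E) :
  cont_on a b f -> cont_on (a + c) (b + c) (fun s => f (s - c)).
Proof.
move=> cf; apply: cont_on_intro => s0 i /andP[as0 s0b].
have s0ab : a <= s0 - c <= b by rewrite lerBrDr as0 lerBlDr.
have [fl] := cont_on_cvg (phi := coord (vbasis {:E}) i)
  (fun k u v => linearP _ k u v) cf s0ab.
split=> e /fl /near_within_itv[d d0 dP].
apply/nbhs_ballP; exists d => //= x; rewrite /ball /= distrC ltr_norml => /andP[dx xd].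
rewrite in_itv /= => /andP[ax xb]; apply: dP.
- by rewrite lerBrDr ax lerBlDr.
- by lra.
- by lra.
Qed.

Section Maslov.
Variable R : realType.
Local Notation C := R[i].
Variables (E : vectType C) (sigma : skewhermitian R E).

Lemma skew_form_of : skew_form (fun u v => sigma u v).
Proof.
split=> [a u v w|u v]; first exact: linearPl.
by rewrite hermC expr1 mulN1r.
Qed.

Lemma lagr_of (L : {vspace E}) :
  lagrangian sigma L <-> lagr (fun u v => sigma u v) L.
Proof.
split=> [hL u|hL].
  by rewrite -{1}hL; split=> [/mem_orthovP|h] //; apply/mem_orthovP.
by apply/vspaceP => u; apply/mem_orthovP/idP => /hL.
Qed.

Lemma nondeg_of : nondegenerate sigma -> nondeg (fun u v => sigma u v).
Proof.
move=> /eqP hnd u u0; apply/eqP; rewrite -memv0 -hnd.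
by apply/mem_orthovP => v _.
Qed.

Hypothesis hnd0 : nondegenerate sigma.
Let s := fun u v => sigma u v.
Let hs : skew_form s := skew_form_of.
Let hnd : nondeg s := nondeg_of hnd0.

Definition is_piece (L alpha beta : {vspace E}) (A : 'End(E)) : Prop :=
  [/\ lagrangian sigma L, (L :&: alpha)%VS = 0%VS, (L :&: beta)%VS = 0%VS,
      (A @: beta <= L)%VS & alpha = ((\1 + A)%VF @: beta)%VS].

(** For u in beta the lift to alpha is u + A u, so the difference form takes the value sigma (A u) u
    = - conj (sigma u (A u)). The exchange of arguments reverses the sign, hence m^+ becomes m^-. *)
Lemma morse_piece L alpha beta A : lagr s alpha -> lagr s beta ->
  is_piece L alpha beta A ->
  morse_pos (fun x y => sigma x (A y)) beta
  = morse_neg (dform s L alpha beta) fullv.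
Proof.
move=> ha hb [/lagr_of hL La Lb AL aE].
have ca : chart s L alpha by split=> //; rewrite capvC.
have cb : chart s L beta by split=> //; rewrite capvC.
have hd := herm_dform hs hnd hL ca cb.
have lE u : linfun (lift L beta) u = lift L beta u.
  by rewrite linfun_linE // => c v w; exact: liftP.
transitivity (morse_neg (dform s L alpha beta) beta).
  apply: eq_morse_pos => u ub.
  have Au : A u \in L by rewrite (subvP AL) // memv_img.
  have au : u + A u \in alpha.
    by rewrite aE -[u in u + _]id_lfunE -add_lfunE memv_img.
  have luE : lift L alpha u = u + A u.
    by apply: (lift_unique hs hnd hL ca au); rewrite opprD addNKr memvN.
  rewrite -(CrealP (herm_real hd (memvf u))) /dform luE (lift_id cb ub).
  by rewrite addrAC subrr add0r -(skewC hs).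
have bE : (linfun (lift L beta) @: fullv)%VS = beta.
  apply/vspaceP => u; apply/memv_imgP/idP => [[v _ ->]|ub].
    by rewrite lE mem_lift.
  by exists u; rewrite ?memvf // lE (lift_id cb ub).
apply/esym; rewrite /morse_neg -{3}bE; apply: morse_pull => [|u _].
  by rewrite (herm0l hd) oppr0.
rewrite lE !(dformE hs hnd hL _ _ ca cb) (lift_id cb (mem_lift L beta u)).
congr (- s _ _); rewrite -[in LHS](subrK (lift L beta u) u) liftD.
by rewrite (lift_ref hs hnd hL ca) ?add0r // (lift_sub hs hnd hL u cb).
Qed.

(** With p, n the two indices of the difference form and k the dimension of the intersection, p + n
    + k = dim beta and the signature is p - n. Eliminating p leaves 2 n + k. *)
Lemma morse_piece_tsgn L alpha beta A : lagr s alpha -> lagr s beta ->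
  is_piece L alpha beta A ->
  2 * (morse_pos (fun x y => sigma x (A y)) beta)%:Z
    + (\dim (alpha :&: beta))%:Z = (\dim beta)%:Z - tsgn s alpha beta L.
Proof.
move=> ha hb hp; rewrite (morse_piece ha hb hp).
case: hp => [/lagr_of hL La Lb _ _].
have ca : chart s L alpha by split=> //; rewrite capvC.
have cb : chart s L beta by split=> //; rewrite capvC.
rewrite (tsgn_chart hs hnd hL ca cb) /msgn.
have := dform_rank hs hnd hL ca cb.
have : \dim L = \dim beta.
  have := dim_lagr hs hnd hL; have <- := dim_lagr hs hnd hb.
  by rewrite !addnn => /double_inj.
move=> ->; move: (morse_pos _ _) (morse_neg _ _) (\dim (alpha :&: beta)) (\dim beta).
by move=> p n k d; lia.
Qed.

Lemma cvg_lagr_path (u v x0 : R) (L : R -> {vspace E}) Lam : u <= x0 <= v ->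
  cont_vspace u v L -> (forall x, u <= x <= v -> lagr s (L x)) ->
  lagr s Lam -> chart s Lam (L x0) ->
  cvg_lagr (within `[u, v]%classic (nbhs x0)) s Lam L (L x0).
Proof.
move=> x0uv [d [e [ce be]]] hL hLam cx0.
apply: (cvg_lagr_frame hs hnd hLam (e := e) (e0 := fun i => e i x0)) => //.
- move=> i w; apply: (cont_on_cvg (phi := fun z => s z w)) (ce i) x0uv => c y z.
  exact: linearPl.
- apply: filterS (near_itv u v x0) => x xuv.
  by split; [exact: hL|exact: be].
- exact: be.
Qed.

(** * A locally constant quantity along a path of Lagrangians *)

Section Energy.
Variables (a b : R) (alpha : R -> {vspace E}).
Hypothesis (calpha : cont_vspace a b alpha).
Hypothesis (halpha : forall x, a <= x <= b -> lagr s (alpha x)).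

(** Adding the last two terms to twice the accumulated m^+ cancels its jumps: what remains on a
    piece involves only transverse pairs. *)
Definition energy (Lam beta : {vspace E}) (Phi : R -> int) (x : R) : int :=
  2 * Phi x + (\dim (alpha x :&: beta))%:Z
  + msgn (dform s Lam (alpha x) beta) fullv.

(** L0 is the reference of the piece at x0, which the chart Lam must also avoid. It is kept
    existential so that a comparison of two subdivisions can choose one Lam for both. *)
Definition energy_cst (F : set_system R) beta Phi x0 : Prop :=
  exists2 L0, lagr s L0 & forall Lam, lagr s Lam -> chart s Lam (alpha x0) ->
    chart s Lam beta -> chart s Lam L0 ->
    \forall x \near F, energy Lam beta Phi x = energy Lam beta Phi x0.

(** Substituting [morse_piece_tsgn] and splitting the triple signature in the chart Lam turns the
    energy into a constant minus the signatures of the pairs (beta, L) and (L, alpha). Both pairs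
    are transverse, so these signatures are locally constant. The constant c is what earlier pieces
    contributed. *)
Lemma energy_piece (u v x0 : R) (L : R -> {vspace E}) (A : R -> 'End(E)) beta
    (Phi : R -> int) (c : int) :
  a <= u -> v <= b -> u <= x0 <= v -> lagr s beta -> cont_vspace u v L ->
  (forall x, u <= x <= v -> is_piece (L x) (alpha x) beta (A x)) ->
  (forall x, u <= x <= v ->
    Phi x = (morse_pos (fun y z => sigma y (A x z)) beta)%:Z + c) ->
  energy_cst (within `[u, v]%classic (nbhs x0)) beta Phi x0.
Proof.
move=> au vb x0uv hb cL hp PhiE.
have inab x : u <= x <= v -> a <= x <= b.
  by move=> /andP[ux xv]; rewrite (le_trans au) // (le_trans xv).
have hLx x : u <= x <= v -> lagr s (L x) by move=> /hp[/lagr_of].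
exists (L x0); first exact: hLx.
move=> Lam hLam ca cb cL0.
have caluv := cont_vspace_sub au vb calpha.
have ha x : u <= x <= v -> lagr s (alpha x) by move=> /inab; exact: halpha.
have va := cvg_lagr_path x0uv caluv ha hLam ca.
have vL := cvg_lagr_path x0uv cL hLx hLam cL0.
have vb' : cvg_lagr (within `[u, v]%classic (nbhs x0)) s Lam (fun=> beta) beta.
  exact: cvg_lagr_cst.
have uvn := near_itv u v x0.
have [_ La0 Lb0 _ _] := hp _ x0uv.
have bL := msgn_dform_near hs hnd hLam vb' vL.
rewrite capvC Lb0 in bL.
have La := msgn_dform_near hs hnd hLam vL va La0.
have {}bL : \forall x \near within `[u, v]%classic (nbhs x0),
    msgn (dform s Lam beta (L x)) fullv = msgn (dform s Lam beta (L x0)) fullv.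
  apply: bL => //; apply: filterS uvn => x /hp[_ _ Lb _ _].
  by rewrite capvC.
have {}La : \forall x \near within `[u, v]%classic (nbhs x0),
    msgn (dform s Lam (L x) (alpha x)) fullv
    = msgn (dform s Lam (L x0) (alpha x0)) fullv.
  by apply: La; apply: filterS uvn => x /hp[].
have eE x : u <= x <= v -> chart s Lam (alpha x) -> chart s Lam (L x) ->
    energy Lam beta Phi x = (\dim beta)%:Z + 2 * c
      - msgn (dform s Lam beta (L x)) fullv
      - msgn (dform s Lam (L x) (alpha x)) fullv.
  move=> xuv cax cLx; rewrite /energy PhiE // mulrDr.
  have := morse_piece_tsgn (ha _ xuv) hb (hp _ xuv).
  rewrite (tsgn_dform hs hnd hLam cax cb cLx).
  move: (morse_pos _ _) (\dim _) (\dim _) (msgn _ _) (msgn _ _) (msgn _ _).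
  by move=> p d1 d2 m1 m2 m3 h; lia.
have cax := cvg_lagr_chart va; have cLx := cvg_lagr_chart vL.
near=> x; rewrite !eE //; try by near: x.
congr (_ - _ - _); by near: x.
Unshelve. all: by end_near. Qed.

(** The index jumps of the pieces are glued into one function Phi whose total variation from a to b
    is m. The induction is on the number of pieces, with the moving endpoint [t n] in place of b. *)
Lemma maslov_energy beta m : lagr s beta -> a <= b ->
  is_maslov sigma a b alpha (fun=> beta) m ->
  exists Phi : R -> int, [/\
    forall x, a <= x < b -> energy_cst x^'+%classic beta Phi x,
    forall x, a < x <= b -> energy_cst x^'-%classic beta Phi x &
    Phi b - Phi a = m].
Proof.
move=> hb ab [N [t [L [A /= [t0 tN tlt hp mE]]]]].
have tle i j : (i <= j)%N -> (j <= N)%N -> t i <= t j.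
  elim: j => [|j IH]; first by rewrite leqn0 => /eqP->.
  rewrite leq_eqVlt => /orP[/eqP->//|]; rewrite ltnS => ij jN.
  by rewrite (le_trans (IH ij (ltnW jN))) ?ltW ?tlt.
have ta n : (n <= N)%N -> a <= t n by move=> nN; rewrite -t0 tle.
have tb n : (n <= N)%N -> t n <= b by move=> nN; rewrite -tN tle.
pose G n x := (morse_pos (fun y z => sigma y (A n x z)) beta)%:Z.
suff : exists Phi : R -> int, [/\
    forall x, a <= x < t N -> energy_cst x^'+%classic beta Phi x,
    forall x, a < x <= t N -> energy_cst x^'-%classic beta Phi x &
    Phi (t N) - Phi a = \sum_(k < N) (G k (t k.+1) - G k (t k))].
  by rewrite tN mE.
elim: {-2}N (leqnn N) => [|n IH] nN.
  exists (fun=> 0); split; rewrite ?big_ord0 // t0 => x.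
    by case/andP=> ax /(le_lt_trans ax); rewrite ltxx.
  by case/andP=> ax /(lt_le_trans ax); rewrite ltxx.
have [Phi [PR PL PE]] := IH (ltnW nN).
have tn := tlt _ nN.
(* The additive constant makes the new piece agree with the old function at the division point
   [t n]. *)
pose Phi' x := if x <= t n then Phi x else G n x + (Phi (t n) - G n (t n)).
have Phi'E x : t n <= x <= t n.+1 -> Phi' x = G n x + (Phi (t n) - G n (t n)).
  case/andP=> nx _; rewrite /Phi'; case: ifP => // xn.
  by rewrite (le_anti (introT andP (conj nx xn))) addrC subrK.
have [cL pc] := hp _ nN.
have pc' x : t n <= x <= t n.+1 -> is_piece (L n x) (alpha x) beta (A n x).
  by move=> /pc[].
have new x : t n <= x <= t n.+1 ->
    energy_cst (within `[t n, t n.+1]%classic (nbhs x)) beta Phi' x.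
  by move=> xn; apply: (energy_piece _ _ xn hb cL pc' Phi'E);
    [exact: ta (ltnW nN)|exact: tb].
have old (F : set_system R) x : Filter F -> x <= t n ->
    (\forall y \near F, y <= t n) -> energy_cst F beta Phi x ->
    energy_cst F beta Phi' x.
  move=> FF xn Fn [L0 hL0 h]; exists L0 => // Lam hLam ca cb cL0.
  apply: filterS2 Fn (h _ hLam ca cb cL0) => y yn.
  by rewrite /energy /Phi' yn xn.
exists Phi'; split.
- move=> x /andP[ax xn1]; have [xn|nx] := ltrP x (t n).
    apply: old; rewrite ?(ltW xn) //; last by apply: PR; rewrite ax.
    by apply: filterS (nbhs_right_lt xn) => y; exact: ltW.
  have [L0 hL0 h] := new x (introT andP (conj nx (ltW xn1))).
  exists L0 => // Lam hLam ca cb cL0; apply: (within_right nx xn1).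
  exact: h.
- move=> x /andP[ax xn1]; have [xn|nx] := lerP x (t n).
    apply: old => //; last by apply: PL; rewrite ax.
    apply: filterS (nbhs_left_lt x) => y yx; exact: le_trans (ltW yx) xn.
  have [L0 hL0 h] := new x (introT andP (conj (ltW nx) xn1)).
  exists L0 => // Lam hLam ca cb cL0; apply: (within_left nx xn1).
  exact: h.
rewrite big_ord_recr /= -PE Phi'E ?(ltW tn) ?lexx // /Phi' ta ?(ltnW nN) //.
by move: (G _ _) (G _ _) (Phi _) (Phi _) => p q r w; lia.
Qed.

Hypothesis hrich : rich s.

(* The tsgn terms of a third Lagrangian replace a homotopy argument: all
   energies refer to one chart, in which tsgn is a sum of dform signatures. *)
Lemma hoermander beta1 beta2 m1 m2 : lagr s beta1 -> lagr s beta2 -> a <= b ->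
  is_maslov sigma a b alpha (fun=> beta1) m1 ->
  is_maslov sigma a b alpha (fun=> beta2) m2 ->
  let h x := tsgn s (alpha x) beta1 beta2 + (\dim (alpha x :&: beta1))%:Z
             - (\dim (alpha x :&: beta2))%:Z in
  2 * (m1 - m2) = h a - h b.
Proof.
move=> h1 h2 ab /(maslov_energy h1 ab)[Phi1 [R1 L1 <-]].
move=> /(maslov_energy h2 ab)[Phi2 [R2 L2 <-]] h.
pose f x := 2 * (Phi1 x - Phi2 x) + h x.
suff : f a = f b.
  rewrite /f; move: (Phi1 _) (Phi1 _) (Phi2 _) (Phi2 _) (h _) (h _).
  by move=> p q r w x y; lia.
have key (F : set_system R) x0 : Filter F -> a <= x0 <= b ->
    (forall Lam, lagr s Lam -> chart s Lam (alpha x0) ->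
      \forall x \near F, chart s Lam (alpha x)) ->
    energy_cst F beta1 Phi1 x0 -> energy_cst F beta2 Phi2 x0 ->
    \forall x \near F, f x = f x0.
  move=> FF x0ab ca [L1' hL1 e1] [L2' hL2 e2].
  have [|Lam hLam cLam] := rich_chart hrich
    (xs := [:: alpha x0; beta1; beta2; L1'; L2']).
    by move=> y; rewrite !inE => /or4P[||| /orP[]] /eqP-> //; exact: halpha.
  have c0 : chart s Lam (alpha x0) by apply: cLam; rewrite !inE eqxx.
  have c1 : chart s Lam beta1 by apply: cLam; rewrite !inE eqxx orbT.
  have c2 : chart s Lam beta2 by apply: cLam; rewrite !inE eqxx !orbT.
  have c3 : chart s Lam L1' by apply: cLam; rewrite !inE eqxx !orbT.
  have c4 : chart s Lam L2' by apply: cLam; rewrite !inE eqxx !orbT.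
  (* Splitting [tsgn] in the chart Lam produces exactly the two signature terms of the energies and
     a term that does not depend on x. *)
  have fE x : chart s Lam (alpha x) -> f x = energy Lam beta1 Phi1 x
      - energy Lam beta2 Phi2 x + msgn (dform s Lam beta1 beta2) fullv.
    move=> cx; rewrite /f /h /energy (tsgn_dform hs hnd hLam cx c1 c2).
    rewrite (msgn_dformN hs Lam (alpha x) beta2).
    move: (Phi1 _) (Phi2 _) (msgn _ _) (msgn _ _) (msgn _ _) (\dim _) (\dim _).
    by move=> p q u v w d e; lia.
  apply: filterS3 (ca _ hLam c0) (e1 _ hLam c0 c1 c3) (e2 _ hLam c0 c2 c4).
  by move=> x cx ex1 ex2; rewrite !fE // ex1 ex2.
have near_chart x0 Lam : a <= x0 <= b -> lagr s Lam ->
    chart s Lam (alpha x0) ->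
    \forall x \near within `[a, b]%classic (nbhs x0), chart s Lam (alpha x).
  move=> x0ab hLam cx0.
  exact: cvg_lagr_chart (cvg_lagr_path x0ab calpha halpha hLam cx0).
apply: locally_constant ab _ _ => x /andP[ax xb].
  have xab : a <= x <= b by rewrite ax ltW.
  apply: key => //; last 2 first.
  - by apply: R1; rewrite ax.
  - by apply: R2; rewrite ax.
  by move=> Lam hLam cx; apply: (within_right ax xb); exact: near_chart.
have xab : a <= x <= b by rewrite xb ltW.
apply: key => //; last 2 first.
- by apply: L1; rewrite ax.
- by apply: L2; rewrite ax.
by move=> Lam hLam cx; apply: (within_left ax xb); exact: near_chart.
Qed.

End Energy.

(** The case of equal references: the dimensions cancel and a triple with a repeated entry has
    signature 0. This is the independence of the subdivision and of the auxiliary Lagrangians. *)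
Lemma is_maslov_unique a b alpha beta m1 m2 : rich s -> a <= b ->
  cont_vspace a b alpha -> (forall x, a <= x <= b -> lagr s (alpha x)) ->
  lagr s beta -> is_maslov sigma a b alpha (fun=> beta) m1 ->
  is_maslov sigma a b alpha (fun=> beta) m2 -> m1 = m2.
Proof.
move=> hr ab ca ha hb p1 p2; have := hoermander ca ha hr hb hb ab p1 p2.
have t0 x : a <= x <= b -> tsgn s (alpha x) beta beta = 0.
  by move=> /ha hx; rewrite -(tsgn_cyc hs hnd hr hx hb hb) (tsgnxx hs hnd).
by rewrite /= !t0 ?lexx ?ab // !add0r !subrr => h; lia.
Qed.

Lemma is_maslov_refl a alpha beta : is_maslov sigma a a alpha beta 0.
Proof.
exists 0%N, (fun=> a), (fun _ _ => 0%VS), (fun _ _ => 0).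
by split; rewrite ?big_ord0.
Qed.

Lemma is_maslov_cat a b c alpha beta m1 m2 :
  is_maslov sigma a c alpha beta m1 -> is_maslov sigma c b alpha beta m2 ->
  is_maslov sigma a b alpha beta (m1 + m2).
Proof.
move=> [N1 [t1 [L1 [A1 /= [t10 t1N t1lt h1 ->]]]]].
move=> [N2 [t2 [L2 [A2 /= [t20 t2N t2lt h2 ->]]]]].
pose sel T (f g : nat -> T) k := if (k < N1)%N then f k else g (k - N1)%N.
have selS k : (k < N1)%N -> sel _ t1 t2 k.+1 = t1 k.+1.
  rewrite /sel leq_eqVlt => /orP[/eqP kN|->//].
  by rewrite kN ltnn subnn t20 -t1N.
have sell T (f g : nat -> T) k : (k < N1)%N -> sel _ f g k = f k.
  by rewrite /sel => ->.
have selr T (f g : nat -> T) k : sel _ f g (N1 + k)%N = g k.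
  by rewrite /sel ltnNge leq_addr addKn.
have cases k : (k < N1 + N2)%N ->
    (k < N1)%N \/ exists2 j, (j < N2)%N & k = (N1 + j)%N.
  move=> kN; case: (ltnP k N1) => [|Nk]; first by left.
  by right; exists (k - N1)%N; rewrite ?subnKC // ltn_subLR.
exists (N1 + N2)%N, (sel _ t1 t2), (sel _ L1 L2), (sel _ A1 A2); split.
- case: (posnP N1) => [N10|N10]; last by rewrite sell.
  by rewrite /sel N10 ltn0 subn0 t20 -t1N N10.
- by rewrite selr.
- move=> k /cases[kN|[j jN ->]]; first by rewrite selS // sell // t1lt.
  by rewrite -addnS !selr t2lt.
- move=> k /cases[kN|[j jN ->]]; first by rewrite selS // !sell //; exact: h1.
  by rewrite -addnS !selr; exact: h2.
rewrite big_split_ord /=; congr (_ + _); apply: eq_bigr => k _ /=.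
  by rewrite selS ?sell.
by rewrite -addnS !selr.
Qed.

(** One piece with the constant reference Lam suffices: [lift Lam (alpha x)] minus the identity
    takes values in Lam and has alpha as its graph over beta. *)
Lemma is_maslov_piece (u v : R) alpha beta (Lam : {vspace E}) : u < v ->
  lagr s Lam ->
  (forall x, u <= x <= v -> chart s Lam (alpha x) /\ chart s Lam (beta x)) ->
  exists m, is_maslov sigma u v alpha beta m.
Proof.
move=> uv hLam hc; pose A x := linfun (fun w => lift Lam (alpha x) w - w).
have AE x w : A x w = lift Lam (alpha x) w - w.
  rewrite /A linfun_linE // => c y z.
  by rewrite liftP opprD scalerBr addrACA.
eexists; exists 1%N, (fun k => if k is 0%N then u else v), (fun _ _ => Lam),
  (fun _ => A).
split=> //; first by case.
case=> // _; split=> [|x xuv]; first exact: cont_vspace_cst.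
have [ca cb] := hc _ xuv; have [_ aL] := ca; have [_ bL] := cb.
split; [exact/lagr_of|by rewrite capvC|by rewrite capvC| |].
  apply/subvP => _ /memv_imgP[w _ ->]; rewrite AE -opprB memvN.
  exact: (lift_sub hs hnd hLam).
apply/vspaceP => w; apply/idP/memv_imgP => [wa|[z zb ->]].
  exists (lift Lam (beta x) w); first exact: mem_lift.
  rewrite add_lfunE id_lfunE AE addrC subrK; apply/esym.
  apply: (lift_unique hs hnd hLam ca wa); rewrite -opprB memvN.
  exact: (lift_sub hs hnd hLam).
by rewrite add_lfunE id_lfunE AE addrC subrK mem_lift.
Qed.

(** Real induction on the right endpoint. A Lagrangian transverse to beta and to alpha at x remains
    transverse to alpha nearby, which gives a piece across x to append. *)
Lemma is_maslov_ex a b alpha beta : rich s -> a <= b ->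
  cont_vspace a b alpha -> (forall x, a <= x <= b -> lagr s (alpha x)) ->
  lagr s beta -> exists m, is_maslov sigma a b alpha (fun=> beta) m.
Proof.
move=> hr ab ca ha hb.
apply: (real_ind (P := fun x => exists m, is_maslov sigma a x alpha (fun=> beta) m)
  ab) => [|x xab]; first by exists 0; exact: is_maslov_refl.
have [|Lam hLam cLam] := rich_chart hr (xs := [:: alpha x; beta]).
  by move=> y; rewrite !inE => /orP[] /eqP-> //; exact: ha.
have cx : chart s Lam (alpha x) by apply: cLam; rewrite !inE eqxx.
have cb : chart s Lam beta by apply: cLam; rewrite !inE eqxx orbT.
have /near_within_itv[d d0 dP] := cvg_lagr_chart (cvg_lagr_path xab ca ha hLam cx).
exists d => // u v au du ux xv vd vb [m hm].
have := le_trans ux xv; rewrite le_eqVlt => /orP[/eqP<-|uv]; first by exists m.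
have [|m' hm'] := @is_maslov_piece u v alpha (fun=> beta) Lam uv hLam.
  move=> y /andP[uy yv]; split=> //; apply: dP.
  - by rewrite (le_trans au uy) (le_trans yv vb).
  - exact: lt_le_trans du uy.
  - exact: le_lt_trans yv vd.
by exists (m + m'); exact: is_maslov_cat hm hm'.
Qed.

Lemma is_maslov_transport (a b c : R) (f : 'End(E)) alpha beta alpha' beta' m :
  lker f = 0%VS -> (forall u v, sigma (f u) (f v) = sigma u v) ->
  (forall x, a <= x <= b -> alpha' (x + c) = (f @: alpha x)%VS) ->
  (forall x, a <= x <= b -> beta' (x + c) = (f @: beta x)%VS) ->
  is_maslov sigma a b alpha beta m ->
  is_maslov sigma (a + c) (b + c) alpha' beta' m.
Proof.
move=> kf fs aE bE [N [t [L [A /= [t0 tN tlt hp ->]]]]].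
have kf' : lker f == 0%VS by rewrite kf.
have tle i j : (i <= j)%N -> (j <= N)%N -> t i <= t j.
  elim: j => [|j IH]; first by rewrite leqn0 => /eqP->.
  rewrite leq_eqVlt => /orP[/eqP->//|]; rewrite ltnS => ij jN.
  by rewrite (le_trans (IH ij (ltnW jN))) ?ltW ?tlt.
have tab k x : (k < N)%N -> t k <= x <= t k.+1 -> a <= x <= b.
  move=> kN /andP[kx xk]; rewrite -t0 -tN (le_trans _ kx) ?(le_trans xk) //.
    exact: tle.
  by apply: tle => //; exact: ltnW.
pose A' k x := (f \o A k (x - c) \o f^-1)%VF.
have A'E k x w : A' k x (f w) = f (A k (x - c) w).
  by rewrite /A' !comp_lfunE lker0_lfunK.
have imgf U V : (U :&: V = 0)%VS -> ((f @: U) :&: (f @: V) = 0)%VS.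
  by move=> UV; rewrite -lker0_img_cap // UV limg0.
exists N, (fun k => t k + c), (fun k x => f @: L k (x - c))%VS, A'; split.
- by rewrite t0.
- by rewrite tN.
- by move=> k kN; rewrite ltrD2r tlt.
- move=> k kN; have [[d [e [ce be]]] pc] := hp _ kN; split.
    exists d, (fun i x => f (e i (x - c))); split=> [i|x /andP[kx xk]].
      exact: (cont_on_lin (g := f) (cont_on_shift (c := c) (ce i))).
    have := be (x - c); rewrite lerBrDr kx lerBlDr xk => /(_ isT) bx.
    have kfU : (L k (x - c)%R :&: lker f = 0)%VS by rewrite kf capv0.
    by have := limg_basis_of kfU bx; rewrite -map_comp.
  move=> x /andP[kx xk].
  have xk' : t k <= x - c <= t k.+1 by rewrite lerBrDr kx lerBlDr.
  have [/lagr_of hL La Lb AL al] := pc _ xk'.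
  rewrite -[x in alpha' x](subrK c) -[x in beta' x](subrK c).
  rewrite aE ?(tab k) // bE ?(tab k) //; split; try exact: imgf.
  - apply/lagr_of/(isotropic_lagr hs hnd).
      move=> _ _ /memv_imgP[y yL ->] /memv_imgP[z zL ->].
      by rewrite /s fs; exact: (lagr0 hL).
    rewrite limg_dim_eq ?kf ?capv0 //; exact: (dim_lagr hs hnd hL).
  - apply/subvP => _ /memv_imgP[_ /memv_imgP[y yb ->] ->].
    by rewrite A'E memv_img // (subvP AL) // memv_img.
  rewrite al -limg_comp; apply/vspaceP => w.
  apply/memv_imgP/memv_imgP => [[y yb ->]|[_ /memv_imgP[y yb ->] ->]].
    exists (f y); first exact: memv_img.
    by rewrite comp_lfunE !add_lfunE !id_lfunE A'E linearD.
  by exists y => //; rewrite comp_lfunE !add_lfunE !id_lfunE A'E linearD.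
apply: eq_bigr => k _; have kN := ltn_ord k.
have e x : a <= x <= b ->
    morse_pos (fun y z => sigma y (A' k (x + c) z)) (beta' (x + c))
    = morse_pos (fun y z => sigma y (A k x z)) (beta x).
  move=> xab; rewrite bE //; apply/esym/morse_pull => [|u ub].
    by rewrite linear0l.
  by rewrite A'E addrK fs.
by rewrite !e //; apply: (tab k) => //; rewrite lexx ltW ?tlt.
Qed.

End Maslov.

(** * Graphs in the doubled symplectic space *)

Section Double.
Variable R : realType.
Local Notation C := R[i].
Local Notation conj := (@Num.conj C).
Variables (V : vectType C) (w : V -> V -> C).
Hypotheses (hw : skew_form w) (hwn : nondeg w).

(** Convertible with [double_form], but over a bare function, so that the theory of [skew_form]
    applies to it. *)
Definition dbl (u v : V * V) : C := - w u.1 v.1 + w u.2 v.2.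

Lemma skew_dbl : skew_form dbl.
Proof.
split=> [a u v x|u v]; rewrite /dbl.
  by rewrite /= !(skew_linl hw) mulrDr mulrN opprD addrACA.
rewrite (skewC hw u.1) (skewC hw u.2) rmorphD rmorphN opprD opprK.
by rewrite [X in X = _]addrC [X in _ = X]addrC.
Qed.

Lemma nondeg_dbl : nondeg dbl.
Proof.
move=> [x y] h; congr pair; apply: hwn => v.
  by have := h (v, 0); rewrite /dbl /= (skew0r hw) addr0 => /eqP;
    rewrite oppr_eq0 => /eqP.
by have := h (0, v); rewrite /dbl /= (skew0r hw) oppr0 add0r.
Qed.

Lemma dim_dbl : \dim {: (V * V)%type} = (\dim {:V} + \dim {:V})%N.
Proof.
rewrite -dim_prodv; congr (\dim _); apply/esym/vspaceP => u.
by rewrite memv_prodv !memvf.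
Qed.

Definition ip (x y : V) : C :=
  \sum_(i < \dim {:V}) coord (vbasis {:V}) i x * conj (coord (vbasis {:V}) i y).

Lemma ip_linl a x y z : ip (a *: x + y) z = a * ip x z + ip y z.
Proof.
rewrite /ip mulr_sumr -big_split; apply: eq_bigr => i _ /=.
by rewrite linearP mulrDl mulrA.
Qed.

Lemma ipC x y : ip y x = conj (ip x y).
Proof.
rewrite /ip rmorph_sum; apply: eq_bigr => i _.
by rewrite rmorphM /= conjCK mulrC.
Qed.

Lemma herm_ip : herm_on ip fullv.
Proof. by split=> [a x y z|x y _ _]; [exact: ip_linl|exact: ipC]. Qed.

Lemma ip_eq0 x : ip x x = 0 -> x = 0.
Proof.
move=> /eqP; rewrite psumr_eq0 => [/allP h|i _]; last exact: mul_conjC_ge0.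
rewrite (coord_vbasis (memvf x)) big1 // => i _.
have := h i; rewrite mem_index_enum => /(_ isT).
by rewrite mul_conjC_eq0 => /eqP->; rewrite scale0r.
Qed.

(** Nondegeneracy makes z |-> (w z b_i)_i bijective, and J y solves the system prescribing these
    values. J is linear because w and [ip] are both conjugate-linear in the second slot. *)
Lemma riesz : exists2 J : V -> V,
  (forall a x y, J (a *: x + y) = a *: J x + J y) &
  forall x y, w x (J y) = ip x y.
Proof.
pose b (i : 'I_(\dim {:V})) := (vbasis {:V})`_i.
pose th (z : V) : 'rV[C]_(\dim {:V}) := \row_i w z (b i).
have thl : linear th.
  by move=> a u v; apply/rowP => i; rewrite !mxE (skew_linl hw).
have thE := linfun_linE thl.
have wE x z : w x z = \sum_i coord (vbasis {:V}) i x * w (b i) z.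
  rewrite {1}(coord_vbasis (memvf x)) (skew_suml hw); apply: eq_bigr => i _.
  by rewrite (skewZl hw).
have k0 : lker (linfun th) = 0%VS.
  apply/eqP; rewrite -subv0; apply/subvP => z.
  rewrite memv_ker thE memv0 => /eqP/rowP z0; apply/eqP/hwn => v.
  apply: (skew_eq0C hw); rewrite wE big1 // => i _.
  by have := z0 i; rewrite !mxE => /(skew_eq0C hw) ->; rewrite mulr0.
have full : limg (linfun th) = fullv.
  apply/eqP; rewrite eqEdim subvf limg_dim_eq ?k0 ?capv0 //.
  by rewrite [X in (X <= _)%N]dimvf /dim /= mul1n leqnn.
(* The sign, and the missing conjugation, are absorbed by the passage from w (J y) b_i to w b_i (J
   y). *)
pose r (y : V) : 'rV[C]_(\dim {:V}) := \row_i (- coord (vbasis {:V}) i y).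
exists (fun y => ((linfun th)^-1)%VF (r y)) => [a x y|x y].
  rewrite -linearP; congr (_ _); apply/rowP => i; rewrite !mxE linearP.
  by rewrite opprD mulrN.
have thJ : th (((linfun th)^-1)%VF (r y)) = r y.
  by rewrite -thE limg_lfunVK // full memvf.
rewrite wE; apply: eq_bigr => i _; congr (_ * _).
rewrite (skewC hw); have /rowP/(_ i) := thJ; rewrite !mxE => ->.
by rewrite rmorphN opprK.
Qed.

(* The Lagrangians {(x + n J x, x - n J x)}, with n a natural number: a given
   Lagrangian meets only finitely many of them, since for n <> m the
   intersections with it are orthogonal for the inner product. *)
Lemma rich_dbl : rich dbl.
Proof.
have [J Jl JE] := riesz.
pose p (n : nat) (x : V) := (x + n%:R *: J x, x + (- n%:R) *: J x).
have jl (c a : C) x y : a *: x + y + c *: J (a *: x + y)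
    = a *: (x + c *: J x) + (y + c *: J y).
  rewrite Jl [c *: (_ + _)]scalerDr [a *: (_ + _)]scalerDr addrACA.
  by rewrite !scalerA (mulrC c).
have pl n : linear (p n).
  by move=> a x y; apply/eqP; rewrite xpair_eqE /= !jl !eqxx.
have pE n := linfun_linE (pl n).
have Jw x y : w (J x) y = - ip x y.
  by rewrite (skewC hw) JE -ipC.
(* The factor n - m does double duty: for n = m it makes the subspace isotropic, for n <> m it makes
   the traces of a Lagrangian orthogonal. *)
have pD n m x y : dbl (p n x) (p m y) = 2 * (n%:R - m%:R) * ip x y.
  rewrite /dbl /p /= !(skewDl hw) !(skewDr hw).
  rewrite !(skewZl hw) !(skewZr hw) !JE !Jw !rmorphN /=.
  by rewrite !conjC_nat; ring.
pose Lam n := limg (linfun (p n)).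
have two0 : (2 : C) != 0 by rewrite pnatr_eq0.
have psum n x : (p n x).1 + (p n x).2 = 2 *: x.
  by rewrite /p /= addrACA -scalerDl subrr scale0r addr0 scaler_nat.
have pinj n : injective (p n).
  by move=> x y pxy; apply: (scalerI two0); rewrite -!(psum n) pxy.
have pk n U : (U :&: lker (linfun (p n)))%VS = 0%VS.
  have /eqP-> : lker (linfun (p n)) == 0%VS.
    by apply/lker0P => x y; rewrite !pE; exact: pinj.
  exact: capv0.
have LamL n : lagr dbl (Lam n).
  apply: (isotropic_lagr skew_dbl nondeg_dbl).
    move=> _ _ /memv_imgP[x _ ->] /memv_imgP[y _ ->].
    by rewrite !pE pD subrr mulr0 mul0r.
  by rewrite limg_dim_eq ?pk // dim_dbl.
pose B L n := (linfun (p n) @^-1: L)%VS.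
have Bp L n x : (x \in B L n) = (p n x \in L) by rewrite -memv_preim pE.
have Borth L n m x y : lagr dbl L -> n != m -> x \in B L n -> y \in B L m ->
    ip x y = 0.
  rewrite !Bp => hL nm xB yB; have /eqP := lagr0 hL xB yB.
  rewrite pD !mulf_eq0 (negPf two0) subr_eq0 eqr_nat (negPf nm).
  by move/eqP.
have Bsum L N : lagr dbl L -> (\sum_(n < N) \dim (B L n) <= \dim {:V})%N.
  move=> hL; have <- : \dim (\sum_(n < N) B L n)%VS = (\sum_(n < N) \dim (B L n))%N.
    elim: N => [|N IH]; first by rewrite !big_ord0 dimv0.
    rewrite !big_ord_recr /= dimv_disjoint_sum ?IH //.
    apply/eqP; rewrite -subv0; apply/subvP => x /memv_capP[/memv_sumP[f fB xE] xB].
    rewrite memv0; apply/eqP/ip_eq0; rewrite {1}xE (herm_suml herm_ip) big1 // => n _.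
    have nN : (n : nat) != N by rewrite neq_ltn ltn_ord.
    exact: (Borth L n N _ _ hL nN (fB n isT) xB).
  by apply: dimvS; exact: subvf.
move=> xs hxs; pose d := \dim {:V}.
(* Pigeonhole: each Lagrangian of the list spends at most d dimensions over all candidates, so among
   [size xs * d + 1] candidates one meets none of them. *)
have [n nP] : exists n : 'I_(size xs * d).+1, \sum_(L <- xs) \dim (B L n) = 0%N.
  apply: contrapT => /forallNP nB.
  have : (\sum_(n < (size xs * d).+1) 1
          <= \sum_(n < (size xs * d).+1) \sum_(L <- xs) \dim (B L n))%N.
    by apply: leq_sum => n _; rewrite lt0n; apply/eqP/nB.
  rewrite sum1_card card_ord exchange_big /= ltnNge => /negP; apply.
  rewrite -sum1_size big_distrl /= big_seq [X in (_ <= X)%N]big_seq.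
  by apply: leq_sum => L Lxs; rewrite mul1n; apply/Bsum/hxs.
exists (Lam n) => // L Lxs; apply/eqP; rewrite -subv0; apply/subvP => u.
move=> /memv_capP[uL /memv_imgP[x _ uE]].
have : x \in B L n by rewrite -memv_preim -uE.
have /eqP-> : B L n == 0%VS.
  rewrite -dimv_eq0 -leqn0 -nP (big_rem L) //=; exact: leq_addr.
by rewrite memv0 => /eqP x0; rewrite uE x0 linear0 mem0v.
Qed.

End Double.

Section Graphs.
Variable R : realType.
Local Notation C := R[i].
Variables (V : vectType C) (omega : skewhermitian R V).
Hypothesis hnd : nondegenerate omega.
Let w := fun u v => omega u v.
Let hw : skew_form w := skew_form_of omega.
Let hwn : nondeg w := nondeg_of hnd.
Local Notation D := (dbl w).
Local Notation Dh := (double_form omega : skewhermitian R (V * V)%type).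
Implicit Types (S T A B : 'End(V)).

Lemma nondeg_double : nondegenerate Dh.
Proof.
apply/eqP/vspaceP => u; rewrite memv0; apply/idP/eqP => [|->]; last exact: mem0v.
move=> /mem_orthovP u0; apply: (nondeg_dbl hw hwn) => v.
by apply: u0; rewrite memvf.
Qed.

Lemma Sp_inj S : Sp omega S -> injective S.
Proof. by move=> [kS _]; apply/lker0P; rewrite kS. Qed.

Lemma Sp_ker0 S : Sp omega S -> lker S == 0%VS.
Proof. by move=> [->]. Qed.

Lemma Sp1 : Sp omega \1%VF.
Proof.
split=> [|x y]; last by rewrite !id_lfunE.
by apply/eqP/lker0P => x y; rewrite !id_lfunE.
Qed.

Lemma SpM S T : Sp omega S -> Sp omega T -> Sp omega (S \o T)%VF.
Proof.
move=> hS hT; split=> [|x y].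
  apply/eqP/lker0P => x y; rewrite !comp_lfunE => /(Sp_inj hS).
  exact: (Sp_inj hT).
by rewrite !comp_lfunE hS.2 hT.2.
Qed.

Lemma SpV S : Sp omega S -> Sp omega S^-1%VF.
Proof.
move=> hS; have SK := lker0_lfunVK (Sp_ker0 hS); split=> [|x y].
  by apply/eqP/lker0P; exact: can_inj SK.
by rewrite -hS.2 !SK.
Qed.

Lemma SpX S k : Sp omega S -> Sp omega (lfun_exp S k).
Proof.
by move=> hS; elim: k => [|k IH]; [exact: Sp1|exact: SpM].
Qed.

Lemma dim_graph S : \dim (graph S) = \dim {:V}.
Proof.
have gl : linear (fun v : V => (v, S v)).
  by move=> a x y; apply/eqP; rewrite xpair_eqE /= linearP !eqxx.
rewrite limg_dim_eq //; apply/eqP; rewrite -subv0; apply/subvP => x.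
rewrite memv_cap memv_ker (linfun_linE gl) memv0 => /andP[_ /eqP[-> _]].
by [].
Qed.

Lemma lagr_graph S : Sp omega S -> lagr D (graph S).
Proof.
move=> [_ hS]; apply: (isotropic_lagr (skew_dbl hw) (nondeg_dbl hw hwn)).
  move=> [x y] [z t]; rewrite !memv_graph /= => /eqP-> /eqP->.
  by rewrite /dbl /w /= hS addNr.
by rewrite dim_graph dim_dbl.
Qed.

Lemma cont_graph (a b : R) (g : R -> 'End(V)) : cont_on a b g ->
  cont_vspace a b (fun t => graph (g t)).
Proof.
move=> cg; exists (\dim {:V}), (fun i t => ((vbasis {:V})`_i, g t (vbasis {:V})`_i)).
split=> [i|t _].
  apply: cont_on_intro => s0 j s0ab.
  pose phi (f : 'End(V)) := coord (vbasis {: (V * V)%type}) j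
    ((vbasis {:V})`_i, f (vbasis {:V})`_i).
  have phi0 (f : 'End(V)) : phi f
      = coord (vbasis {: (V * V)%type}) j ((vbasis {:V})`_i, 0)
        + coord (vbasis {: (V * V)%type}) j (0, f (vbasis {:V})`_i).
    rewrite -linearD /phi; congr (coord _ _ _).
    by apply/eqP; rewrite xpair_eqE /= addr0 add0r !eqxx.
  rewrite -/(phi (g s0)) phi0; apply: (cvgC_ext (fun t => phi0 (g t))).
  apply: cvgCD; first exact: cvgC_cst.
  apply: (cont_on_cvg (phi := fun f : 'End(V) =>
    coord (vbasis {: (V * V)%type}) j (0, f (vbasis {:V})`_i))) => // c f h.
  rewrite -linearP; congr (coord _ _ _); apply/eqP.
  by rewrite xpair_eqE /= scaler0 addr0 add_lfunE scale_lfunE !eqxx.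
have gl : linear (fun v : V => (v, g t v)).
  by move=> a' x y; apply/eqP; rewrite xpair_eqE /= linearP !eqxx.
have kf : ({:V} :&: lker (linfun (fun v : V => (v, g t v))) = 0)%VS.
  apply/eqP; rewrite -subv0; apply/subvP => x.
  rewrite memv_cap memv_ker (linfun_linE gl) memv0 => /andP[_ /eqP[-> _]].
  by [].
have := limg_basis_of kf (vbasisP {:V}); rewrite -/(graph (g t)).
congr (basis_of _ _); apply: (@eq_from_nth _ 0).
  by rewrite size_map size_tuple size_map size_enum_ord.
move=> i; rewrite size_map size_tuple => id.
rewrite (nth_map 0) ?size_tuple // (linfun_linE gl).
by rewrite (nth_map (Ordinal id)) ?size_enum_ord //= nth_enum_ord.
Qed.

Definition tg S1 S2 S3 : int := tsgn D (graph S1) (graph S2) (graph S3).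
Definition dg S1 S2 : nat := \dim (graph S1 :&: graph S2).

Definition prod_map A B : 'End((V * V)%type) :=
  linfun (fun u : V * V => (A u.1, B u.2)).

Lemma prod_mapE A B u : prod_map A B u = (A u.1, B u.2).
Proof.
rewrite /prod_map linfun_linE // => c x y.
by apply/eqP; rewrite xpair_eqE /= !linearP !eqxx.
Qed.

Lemma prod_map_ker A B : Sp omega A -> Sp omega B ->
  lker (prod_map A B) = 0%VS.
Proof.
move=> hA hB; apply/eqP/lker0P => -[x y] [z t]; rewrite !prod_mapE /=.
by move=> [/(Sp_inj hA)-> /(Sp_inj hB)->].
Qed.

Lemma prod_map_dbl A B : Sp omega A -> Sp omega B ->
  forall u v, D (prod_map A B u) (prod_map A B v) = D u v.
Proof. by move=> [_ hA] [_ hB] u v; rewrite !prod_mapE /dbl /w /= hA hB. Qed.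

(** The composite with A is placed in the source, so that no inverse of A has to be written. *)
Lemma prod_map_graph A B S : Sp omega A ->
  (prod_map A B @: graph (S \o A))%VS = graph (B \o S).
Proof.
move=> hA; apply/vspaceP => -[x y]; rewrite memv_graph /=.
apply/memv_imgP/eqP => [[[z t]]|->].
  by rewrite memv_graph /= prod_mapE => /eqP-> [-> ->]; rewrite !comp_lfunE.
have AK := lker0_lfunVK (Sp_ker0 hA).
exists ((A^-1)%VF x, S x); first by rewrite memv_graph /= comp_lfunE AK.
by rewrite prod_mapE /= AK comp_lfunE.
Qed.

Lemma tg_map A B S1 S2 S3 : Sp omega A -> Sp omega B ->
  tg (B \o S1) (B \o S2) (B \o S3) = tg (S1 \o A) (S2 \o A) (S3 \o A).
Proof.
move=> hA hB; rewrite /tg -!(prod_map_graph B _ hA).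
apply: tsgn_map; [exact: skew_dbl|exact: prod_map_ker|exact: prod_map_dbl].
Qed.

Lemma dg_map A B S1 S2 : Sp omega A -> Sp omega B ->
  dg (B \o S1) (B \o S2) = dg (S1 \o A) (S2 \o A).
Proof.
move=> hA hB; rewrite /dg -!(prod_map_graph B _ hA) -lker0_img_cap.
  by rewrite limg_dim_eq // prod_map_ker // capv0.
by rewrite prod_map_ker.
Qed.

Definition swap_map : 'End((V * V)%type) := linfun (fun u : V * V => (u.2, u.1)).

Lemma swap_mapE u : swap_map u = (u.2, u.1).
Proof. by rewrite /swap_map linfun_linE. Qed.

Lemma swap_graph S : Sp omega S -> (swap_map @: graph S)%VS = graph S^-1%VF.
Proof.
move=> hS; have SK := lker0_lfunK (Sp_ker0 hS).
have SVK := lker0_lfunVK (Sp_ker0 hS).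
apply/vspaceP => -[x y]; rewrite memv_graph /=.
apply/memv_imgP/eqP => [[[z t]]|->].
  by rewrite memv_graph /= swap_mapE => /eqP-> [-> ->]; rewrite SK.
by exists ((S^-1)%VF x, x); rewrite ?swap_mapE // memv_graph /= SVK.
Qed.

Lemma swap_ker : lker swap_map = 0%VS.
Proof.
by apply/eqP/lker0P => -[x y] [z t]; rewrite !swap_mapE /= => -[-> ->].
Qed.

(** Swapping the two factors of V x V maps the graph of S to that of its inverse and negates the
    doubled form. *)
Lemma tgV S1 S2 S3 : Sp omega S1 -> Sp omega S2 -> Sp omega S3 ->
  tg S1^-1%VF S2^-1%VF S3^-1%VF = - tg S1 S2 S3.
Proof.
move=> h1 h2 h3; move: (swap_graph h1) (swap_graph h2) (swap_graph h3).
move: (S1^-1)%VF (S2^-1)%VF (S3^-1)%VF => T1 T2 T3 e1 e2 e3.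
rewrite /tg -e1 -e2 -e3 -tsgnN.
apply: tsgn_map; last 2 first.
- exact: swap_ker.
- by move=> u v; rewrite !swap_mapE /dbl /= opprD opprK addrC.
have := skew_dbl hw; move=> [sl sC]; split=> [a u v x|u v].
  by rewrite sl opprD mulrN.
by rewrite sC rmorphN.
Qed.

Lemma dgV S1 S2 : Sp omega S1 -> Sp omega S2 ->
  dg S1^-1%VF S2^-1%VF = dg S1 S2.
Proof.
move=> h1 h2; move: (swap_graph h1) (swap_graph h2).
move: (S1^-1)%VF (S2^-1)%VF => T1 T2 e1 e2.
rewrite /dg -e1 -e2 -lker0_img_cap ?swap_ker //.
by rewrite limg_dim_eq // swap_ker capv0.
Qed.

End Graphs.

(** * Connectedness of the symplectic group *)

Lemma cvgC_real (R : realType) (a b s0 : R) :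
  cvgC (within `[a, b]%classic (nbhs s0)) (fun t => t%:C%C) s0%:C%C.
Proof.
split=> e e0; have /complex_realP[d dE] := gtr0_real e0.
have d0 : 0 < d by rewrite -ltcR -dE.
rewrite near_withinE; apply: filterS (nbhsx_ballx s0 d d0) => t.
rewrite /ball /= => st _; rewrite -rmorphB dE normc_def /= expr0n addr0.
by rewrite sqrtr_sqr ltcR.
Qed.

Section Connected.
Variable R : realType.
Local Notation C := R[i].
Local Notation conj := (@Num.conj C).
Variables (V : vectType C) (omega : skewhermitian R V).
Hypothesis hnd : nondegenerate omega.
Let w := fun u v => omega u v.
Let hw : skew_form w := skew_form_of omega.
Let hwn : nondeg w := nondeg_of hnd.
Implicit Types (S T : 'End(V)).

Lemma cont_on_comp (a b : R) (f g : R -> 'End(V)) : cont_on a b f -> cont_on a b g ->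
  cont_on a b (fun t => (f t \o g t)%VF).
Proof.
move=> cf cg; apply: cont_on_intro => s0 i s0ab.
pose n := \dim {: 'End(V)}; pose e (k : 'I_n) := (vbasis {: 'End(V)})`_k.
pose c (k : 'I_n) (h : 'End(V)) := coord (vbasis {: 'End(V)}) k h.
have cE h : h = \sum_(k < n) c k h *: e k := coord_vbasis (memvf h).
pose phi k (h : 'End(V)) := coord (vbasis {: 'End(V)}) i (e k \o h)%VF.
have phiE (h h' : 'End(V)) : coord (vbasis {: 'End(V)}) i (h \o h')%VF
    = \sum_(k < n) c k h * phi k h'.
  rewrite {1}(cE h) (big_morph (fun x => (x \o h')%VF)
    (fun x y => comp_lfunDl x y h') (comp_lfun0l _ h')) linear_sum /=.
  by apply: eq_bigr => k _; rewrite -comp_lfunZl linearZ.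
rewrite phiE; apply: (cvgC_ext (fun t => phiE (f t) (g t))).
apply: cvgC_sum => k; apply: cvgCM.
  by apply: (cont_on_cvg (phi := c k)) cf s0ab => x u v; rewrite /c linearP.
apply: (cont_on_cvg (phi := phi k)) cg s0ab => x u v.
by rewrite /phi comp_lfunDr -comp_lfunZr linearP.
Qed.

Definition joined S : Prop := exists g : R -> 'End(V),
  [/\ cont_on 0 1 g, forall t, 0 <= t <= 1 -> Sp omega (g t),
      g 0 = \1%VF & g 1 = S].

Lemma joined_Sp S : joined S -> Sp omega S.
Proof. by move=> [g [_ h _ <-]]; apply: h; rewrite ler01 lexx. Qed.

Lemma joined1 : joined \1%VF.
Proof.
exists (fun=> \1%VF); split=> // [|t _]; first exact: cont_on_cst.
exact: Sp1.
Qed.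

Lemma joinedM S T : joined S -> joined T -> joined (S \o T)%VF.
Proof.
move=> [f [cf fS f0 f1]] [g [cg gS g0 g1]].
exists (fun t => (f t \o g t)%VF); split.
- exact: cont_on_comp.
- by move=> t t01; apply: SpM; [exact: fS|exact: gS].
- by rewrite f0 g0 comp_lfun1l.
- by rewrite f1 g1.
Qed.

Definition shear u : 'End(V) := linfun (fun x => w x u *: u).
Definition transv u (c : C) : 'End(V) := (\1 + c *: shear u)%VF.

Lemma transvE u c x : transv u c x = x + (c * w x u) *: u.
Proof.
rewrite /transv add_lfunE id_lfunE scale_lfunE /shear linfun_linE ?scalerA //.
by move=> a y z; rewrite (skew_linl hw) scalerDl scalerA.
Qed.

(** The change of w x y is w x u * conj (w y u) times this expression. For mu = c^-1 the condition
    reads mu - conj mu = - w u u: it fixes the imaginary part and leaves the real part free. *)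
Lemma Sp_transv u c : conj c - c + c * conj c * w u u = 0 ->
  Sp omega (transv u c).
Proof.
move=> hc.
have inv x y : w (transv u c x) (transv u c y) = w x y.
  rewrite !transvE !(skewDl hw) !(skewDr hw) !(skewZl hw) !(skewZr hw).
  rewrite rmorphM /= [w u y](skewC hw).
  transitivity (w x y + w x u * conj (w y u) * (conj c - c + c * conj c * w u u)).
    by ring.
  by rewrite hc mulr0 addr0.
split; last exact: inv.
apply/eqP; rewrite -subv0; apply/subvP => x; rewrite memv_ker memv0 => /eqP x0.
by apply/eqP/hwn => y; rewrite -inv x0 (skew0l hw).
Qed.

(* The admissible coefficients of a transvection along u form a circle (or a
   line) through 0, parametrized here by the real part of their inverse. *)
Lemma joined_transv u (mu : C) : mu != 0 -> mu - conj mu = - w u u ->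
  joined (transv u mu^-1).
Proof.
move=> mu0 muE; set k := w u u in muE.
have kC : conj k = - k by rewrite {2}/k (skewC hw) opprK.
pose r : C := (mu + conj mu) / 2.
have rC : conj r = r by rewrite /r rmorphM rmorphD /= conjCK addrC fmorphV /= conjC_nat.
have rR : r \is Num.real by apply/CrealP.
have two0 : (2 : C) != 0 by rewrite pnatr_eq0.
have mur : mu = r - k / 2.
  have -> : k = - (mu - conj mu) by rewrite muE opprK.
  by rewrite /r; field.
clearbody r.
(* The path has coefficient t / m t, whose inverse has real part r + ep (1 - t) / t, running from
   infinity to r at constant imaginary part. Giving [ep] the sign of r keeps m t nonzero also when w
   u u = 0. *)
pose ep : C := if 0 <= r then 1 else - 1.
have epC : conj ep = ep by rewrite /ep; case: ifP; rewrite ?rmorphN rmorph1.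
pose m (t : R) : C := r * t%:C%C + ep * (1 - t%:C%C) - k * t%:C%C / 2.
have tC (t : R) : conj t%:C%C = t%:C%C by apply/CrealP/complex_realP; exists t.
have mC t : conj (m t) = r * t%:C%C + ep * (1 - t%:C%C) + k * t%:C%C / 2.
  rewrite /m !(rmorphB, rmorphD, rmorphM) /= fmorphV rmorph1 /=.
  by rewrite conjC_nat rC epC kC !tC !mulNr opprK.
have m0 t : 0 <= t <= 1 -> m t != 0.
  case/andP=> t0 t1; apply/eqP => mt.
  have mt' : conj (m t) = 0 by rewrite mt rmorph0.
  have rt : r * t%:C%C + ep * (1 - t%:C%C) = 0.
    have : m t + conj (m t) = 2 * (r * t%:C%C + ep * (1 - t%:C%C)).
      by rewrite mC /m; field.
    by rewrite mt' mt addr0 => /esym/eqP; rewrite mulf_eq0 (negPf two0) => /eqP.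
  have kt : k * t%:C%C = 0.
    have : conj (m t) - m t = k * t%:C%C by rewrite mC /m; field.
    by rewrite mt' mt subrr => <-.
  have ep0 : ep != 0 by rewrite /ep; case: ifP; rewrite ?oppr_eq0 oner_eq0.
  have [tz|tz] := eqVneq t 0.
    by move/eqP: rt; rewrite tz /= mulr0 subr0 mulr1 add0r (negPf ep0).
  have tp : 0 < t%:C%C :> C by rewrite ltcR lt_neqAle eq_sym tz.
  have t1' : 0 <= 1 - t%:C%C :> C by rewrite subr_ge0 lecR.
  move/eqP: kt; rewrite mulf_eq0 (gt_eqF tp) orbF => /eqP k0.
  have r0 : r != 0 by move: mu0; rewrite mur k0 mul0r subr0.
  move: rt; rewrite /ep; case: ifP => [rp|/negbT rn].
    move=> /eqP; rewrite paddr_eq0 ?mulr_ge0 ?ler01 ?(ltW tp) //.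
    by rewrite mulf_eq0 (negPf r0) (gt_eqF tp).
  have rp : 0 <= - r.
    by rewrite oppr_ge0 ltW // real_ltNge // real0.
  rewrite mulN1r => /eqP; rewrite -oppr_eq0 opprD opprK -mulNr.
  rewrite paddr_eq0 ?mulr_ge0 ?(ltW tp) // mulf_eq0 oppr_eq0 (negPf r0).
  by rewrite (gt_eqF tp).
pose lam t := t%:C%C / m t.
exists (fun t => transv u (lam t)); split.
- apply: cont_on_intro => s0 i s01.
  pose c := coord (vbasis {: 'End(V)}) i.
  have cE t : c (transv u (lam t)) = c \1%VF + lam t * c (shear u).
    by rewrite /c /transv linearD linearZ.
  rewrite -/c cE; apply: (cvgC_ext cE).
  have ct := cvgC_real 0 1 s0.
  apply: cvgCD; first exact: cvgC_cst.
  apply: cvgCM; last exact: cvgC_cst.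
  apply: cvgCM => //; apply: cvgCV; first exact: m0.
  apply: cvgCB.
    apply: cvgCD; first by apply: cvgCM => //; exact: cvgC_cst.
    apply: cvgCM; first exact: cvgC_cst.
    by apply: cvgCB => //; exact: cvgC_cst.
  apply: cvgCM; last exact: cvgC_cst.
  by apply: cvgCM => //; exact: cvgC_cst.
- move=> t t01; apply: Sp_transv; rewrite -/k /lam rmorphM fmorphV /= tC.
  have mt0 := m0 _ t01; have mt0' : conj (m t) != 0 by rewrite conjC_eq0.
  have kt : k * t%:C%C = conj (m t) - m t by rewrite mC /m; field.
  transitivity (t%:C%C / (m t * conj (m t)) * (m t - conj (m t) + k * t%:C%C)).
    by field; rewrite mt0 mt0'.
  by rewrite kt; ring.
- by rewrite /lam /= mul0r /transv scale0r addr0.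
congr (transv u _); rewrite /lam /m /= !mul1r !mulr1 subrr mulr0 addr0.
by rewrite -mur.
Qed.

(** The transvection along u = v' - v with coefficient (w v u)^-1 adds exactly u to v. Equality of w
    v v and w v' v' makes the coefficient admissible, and w v v' <> w v v says that it exists. *)
Lemma transv_move v v' : w v v = w v' v' -> w v v' != w v v ->
  exists2 T, joined T & T v = v' /\
    forall x, w x v = 0 -> w x v' = 0 -> T x = x.
Proof.
move=> vv vv'; pose u := v' - v; pose mu := w v u.
have muE : mu = w v v' - w v v by rewrite /mu /u (skewBr hw).
have mu0 : mu != 0 by rewrite muE subr_eq0.
have hmu : mu - conj mu = - w u u.
  rewrite muE rmorphB /= /u !(skewBl hw) !(skewBr hw) -vv.
  have sC : conj (w v v) = - w v v by rewrite {2}(skewC hw v v) opprK.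
  by rewrite [w v' v](skewC hw) sC; ring.
exists (transv u mu^-1); first exact: joined_transv.
split=> [|x xv xv'].
  by rewrite transvE -/mu mulVf // scale1r /u addrC subrK.
by rewrite transvE /u (skewBr hw) xv xv' subrr mulr0 scale0r addr0.
Qed.

(* Induction on the codimension of a nondegenerate subspace F fixed by S. *)
Lemma Sp_joined S : Sp omega S -> joined S.
Proof.
suff h n : forall S F, (\dim {:V} - \dim F < n)%N -> Sp omega S ->
    (F :&: perp w F = 0)%VS -> (forall x, x \in F -> S x = x) -> joined S.
  move=> hS; apply: (h (\dim {:V}).+1 S 0%VS) => //; first by rewrite ltnS leq_subr.
    by rewrite cap0v.
  by move=> x; rewrite memv0 => /eqP->; rewrite linear0.
elim: n => // n IH {}S F dF hS Fnd SF.
have Fsum : (F + perp w F = fullv)%VS.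
  apply/eqP; rewrite eqEdim subvf dimv_disjoint_sum // addnC.
  by rewrite (dim_perp hw hwn) leqnn.
have [Ff|Fnf] := eqVneq F fullv.
  have -> : S = \1%VF by apply/lfunP => x; rewrite id_lfunE SF // Ff memvf.
  exact: joined1.
(* If every vector of [perp w F] were isotropic, w would vanish there by polarization. As F + perp F
   is everything, nondegeneracy would give perp F = 0 and F full. *)
have [v vF vv] : exists2 v, v \in perp w F & w v v != 0.
  apply: contrapT => hv.
  have v0 v : v \in perp w F -> w v v = 0.
    by move=> vF; apply/eqP/negPn/negP => nz; apply: hv; exists v.
  have hE := herm_onS (subvf (perp w F)) (skew_ext_herm hw).
  have z : {in perp w F &, forall x y, 'i * w x y = 0}.
    by apply: (herm_polar hE) => x /v0 ->; rewrite mulr0.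
  have p0 : perp w F = 0%VS.
    apply/eqP; rewrite -subv0; apply/subvP => x xF; rewrite memv0.
    apply/eqP/hwn => y; have : y \in (F + perp w F)%VS by rewrite Fsum memvf.
    move=> /memv_addP[f fF [g gF ->]]; rewrite (skewDr hw).
    have /(mem_perp hw) -> // := xF; rewrite add0r.
    by have /eqP := z x g xF gF; rewrite mulf_eq0 (negPf (neq0Ci _)) => /eqP.
  by move: Fnf; rewrite -Fsum p0 addv0 eqxx.
have vF0 x : x \in F -> w x v = 0.
  by move=> xF; apply: (skew_eq0C hw); move/(mem_perp hw): vF; apply.
(* A transvection T takes v to S' v and fixes F, because v and S' v are both orthogonal to F; so
   T^-1 S' fixes the larger nondegenerate subspace F + <v>. *)
have step S' : Sp omega S' -> (forall x, x \in F -> S' x = x) ->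
    w v (S' v) != w v v -> joined S'.
  move=> hS' S'F nv; have [|T jT [Tv TF]] := @transv_move v (S' v) _ nv.
    by rewrite /w hS'.2.
  have hT := joined_Sp jT; have TK := lker0_lfunK (Sp_ker0 hT).
  have -> : S' = (T \o (T^-1 \o S'))%VF.
    by rewrite lker0_compVKf // (Sp_ker0 hT).
  apply: joinedM => //.
  apply: (IH _ (F + <[v]>)%VS); last first.
  - move=> _ /memv_addP[x xF [_ /vlineP[a ->] ->]].
    rewrite comp_lfunE !linearD !linearZ /= S'F //.
    rewrite -[in X in _ + a *: X]Tv TK; congr (_ + _).
    rewrite -[in LHS](TF x) ?TK //; first exact: vF0.
    by rewrite /w -[in omega x _](S'F x xF) hS'.2; exact: vF0.
  - apply/eqP; rewrite -subv0; apply/subvP => y /memv_capP[].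
    move=> /memv_addP[x xF [_ /vlineP[a ->] ->]] /(mem_perp hw) yp.
    have x0 : x = 0.
      apply/eqP; rewrite -memv0 -Fnd memv_cap xF; apply/(mem_perp hw) => z zF.
      have := yp z (subvP (addvSl _ _) _ zF).
      by rewrite (skewDl hw) (skewZl hw) (skew_eq0C hw (vF0 _ zF)) mulr0 addr0.
    have := yp v (subvP (addvSr _ _) _ (memv_line v)).
    rewrite x0 add0r (skewZl hw) => /eqP; rewrite mulf_eq0 (negPf vv) orbF.
    by move=> /eqP->; rewrite scale0r mem0v.
  - exact: SpM (SpV hT) hS'.
  rewrite dimv_disjoint_sum ?dim_vline.
    have v0 : v != 0 by apply: contraNneq vv => ->; rewrite (skew0l hw).
    have : (\dim F < \dim {:V})%N.
      by rewrite ltn_neqAle dimvS ?subvf // andbT (dimv_leqif_eq (subvf F)).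
    by rewrite v0; move: dF; lia.
  apply/eqP; rewrite -subv0; apply/subvP => y /memv_capP[yF /vlineP[a yE]].
  have := vF0 _ yF; rewrite yE (skewZl hw) => /eqP.
  by rewrite mulf_eq0 (negPf vv) orbF => /eqP->; rewrite scale0r mem0v.
(* In the excluded case S is composed with the reflection U sending v to - v, itself a transvection
   because w v v is nonzero. Then w v (S (U v)) = - w v v, to which [step] applies, and U is an
   involution. *)
have [Sv|] := eqVneq (w v (S v)) (w v v); last exact: step.
have vmv : w v v = w (- v) (- v) by rewrite (skewNl hw) (skewNr hw) opprK.
have vnv : w v (- v) != w v v.
  by rewrite (skewNr hw) eq_sym -subr_eq0 opprK -mulr2n mulrn_eq0.
have [U jU [Uv UF]] := transv_move vmv vnv.
have hU := joined_Sp jU.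
have UF' x : w x v = 0 -> U x = x.
  by move=> xv; apply: UF; rewrite ?(skewNr hw) xv ?oppr0.
have UU : (U \o U)%VF = \1%VF.
  apply/lfunP => x; rewrite comp_lfunE id_lfunE.
  have [y [a [yv ->]]] : exists y a, w y v = 0 /\ x = y + a *: v.
    exists (x - (w x v / w v v) *: v), (w x v / w v v); rewrite subrK.
    by rewrite (skewBl hw) (skewZl hw) divfK // subrr.
  by rewrite !linearD !linearZ /= !(UF' _ yv) Uv linearN /= Uv opprK.
have -> : S = ((S \o U) \o U)%VF by rewrite -comp_lfunA UU comp_lfun1r.
apply: joinedM => //; apply: step; first exact: SpM.
  by move=> x xF; rewrite comp_lfunE UF' ?SF //; exact: vF0.
rewrite comp_lfunE Uv linearN (skewNr hw) /= Sv -(skewNr hw); exact: vnv.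
Qed.

End Connected.

(** * Signatures of triples of graphs *)

Section Powers.
Variables (K : fieldType) (V : vectType K).
Implicit Types f g : 'End(V).

Lemma lfun_expS f k : lfun_exp f k.+1 = (f \o lfun_exp f k)%VF.
Proof. by []. Qed.

Lemma lfun_expSr f k : lfun_exp f k.+1 = (lfun_exp f k \o f)%VF.
Proof.
elim: k => [|k IH]; first by rewrite /lfun_exp /= comp_lfun1l comp_lfun1r.
by rewrite lfun_expS {1}IH comp_lfunA.
Qed.

Lemma lfun_exp1 f : lfun_exp f 1 = f.
Proof. exact: comp_lfun1r. Qed.

Lemma lfun_exp_id k : lfun_exp (\1%VF : 'End(V)) k = \1%VF.
Proof. by elim: k => // k IH; rewrite lfun_expS IH comp_lfun1l. Qed.

Lemma lfun_expD f j k : lfun_exp f (j + k) = (lfun_exp f j \o lfun_exp f k)%VF.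
Proof.
elim: j => [|j IH]; first by rewrite comp_lfun1l.
by rewrite addSn !lfun_expS IH comp_lfunA.
Qed.

Lemma lker0_inv_unique f g : lker f == 0%VS -> (f \o g)%VF = \1%VF ->
  (f^-1)%VF = g.
Proof. by move=> kf fg; rewrite -(lker0_compKf kf g) fg comp_lfun1r. Qed.

Lemma inv_lfun_id : (\1^-1)%VF = \1%VF :> 'End(V).
Proof.
apply: lker0_inv_unique; last exact: comp_lfun1l.
by apply/lker0P => x y; rewrite !id_lfunE.
Qed.

Lemma lker0_exp f k : lker f == 0%VS -> lker (lfun_exp f k) == 0%VS.
Proof.
move=> /lker0P kf; apply/lker0P; elim: k => [|k IH] x y.
  by rewrite !id_lfunE.
by rewrite lfun_expS !comp_lfunE => /kf/IH.
Qed.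

Lemma lfun_expV f k : lker f == 0%VS ->
  lfun_exp (f^-1)%VF k = ((lfun_exp f k)^-1)%VF.
Proof.
move=> kf; apply/esym/lker0_inv_unique; first exact: lker0_exp.
elim: k => [|k IH]; first exact: comp_lfun1l.
rewrite lfun_expS [in X in (_ \o X)%VF]lfun_expSr -comp_lfunA.
by rewrite (comp_lfunA _ _ (f^-1)%VF) IH comp_lfun1l lker0_compfV.
Qed.

End Powers.

Section GraphSignature.
Variable R : realType.
Local Notation C := R[i].
Variables (V : vectType C) (omega : skewhermitian R V).
Hypothesis hnd : nondegenerate omega.
Let w := fun u v => omega u v.
Let hw : skew_form w := skew_form_of omega.
Let hwn : nondeg w := nondeg_of hnd.
Implicit Types (S T A B M N P : 'End(V)).
Local Notation tg := (tg omega).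
Local Notation Sp := (Sp omega).
Let hD := skew_dbl hw.
Let hDn := nondeg_dbl hw hwn.
Let hr := rich_dbl hw hwn.

Lemma tgC S1 S2 S3 : Sp S1 -> Sp S2 -> Sp S3 -> tg S2 S1 S3 = - tg S1 S2 S3.
Proof.
move=> /(lagr_graph hnd) h1 /(lagr_graph hnd) h2 /(lagr_graph hnd) h3.
exact: (tsgnC hD hDn hr h1 h2 h3).
Qed.

Lemma tg_cyc S1 S2 S3 : Sp S1 -> Sp S2 -> Sp S3 -> tg S2 S3 S1 = tg S1 S2 S3.
Proof.
move=> /(lagr_graph hnd) h1 /(lagr_graph hnd) h2 /(lagr_graph hnd) h3.
exact: (tsgn_cyc hD hDn hr h1 h2 h3).
Qed.

Lemma tg_cocycle S1 S2 S3 : Sp S1 -> Sp S2 -> Sp S3 ->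
  tg S1 S2 S3 = tg S1 S2 \1 + tg S2 S3 \1 + tg S3 S1 \1.
Proof.
move=> /(lagr_graph hnd) h1 /(lagr_graph hnd) h2 /(lagr_graph hnd) h3.
exact: (tsgn_cocycle hD hDn hr h1 h2 h3 (lagr_graph hnd (Sp1 omega))).
Qed.

Lemma tgxx S1 S2 : Sp S1 -> Sp S2 -> tg S1 S1 S2 = 0.
Proof.
move=> /(lagr_graph hnd) h1 /(lagr_graph hnd) h2.
exact: (tsgnxx hD hDn hr h1 h2).
Qed.

Lemma tg_mapl B S1 S2 S3 : Sp B ->
  tg (B \o S1) (B \o S2) (B \o S3) = tg S1 S2 S3.
Proof. by move=> hB; rewrite (tg_map _ _ _ (Sp1 omega) hB) !comp_lfun1r. Qed.

Lemma tg_mapr A S1 S2 S3 : Sp A ->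
  tg (S1 \o A) (S2 \o A) (S3 \o A) = tg S1 S2 S3.
Proof. by move=> hA; rewrite -(tg_map _ _ _ hA (Sp1 omega)) !comp_lfun1l. Qed.

Lemma dg_mapl B S1 S2 : Sp B -> dg (B \o S1) (B \o S2) = dg S1 S2.
Proof. by move=> hB; rewrite (dg_map _ _ (Sp1 omega) hB) !comp_lfun1r. Qed.

Lemma dg_mapr A S1 S2 : Sp A -> dg (S1 \o A) (S2 \o A) = dg S1 S2.
Proof. by move=> hA; rewrite -(dg_map _ _ hA (Sp1 omega)) !comp_lfun1l. Qed.

Lemma dgC S1 S2 : dg S1 S2 = dg S2 S1.
Proof. by rewrite /dg capvC. Qed.

Definition nu S : nat := dg S \1.
(** The quantity F(S) of the overview. *)
Definition power_sgn k S : int :=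
  \sum_(j < k) tg (lfun_exp S j) (lfun_exp S j.+1) \1.

(* Each term is the value of hoermander for gamma, running from 1 to M, and the
   references P^(k - j) N^(-j) and P, where N = P^-1 M. *)
Definition defect_sum k M P : int :=
  let Q j := (lfun_exp P (k - j) \o (lfun_exp (P^-1 \o M) j)^-1)%VF in
  \sum_(j < k) (tg \1 (Q j) P + (dg \1 (Q j))%:Z - (dg \1 P)%:Z
                - (tg M (Q j) P + (dg M (Q j))%:Z - (dg M P)%:Z)).

(** Multiplication by suitable powers turns each triple into one of powers of N and P. The cocycle
    identity with fourth graph \1 separates it into consecutive differences, which telescope, and
    terms of the two power sums. *)
Lemma defect_sumE k M P : Sp M -> Sp P ->
  let N := (P^-1 \o M)%VF in
  defect_sum k M P = - power_sgn k N - power_sgn k P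
    - (nu (lfun_exp N k))%:Z + k%:Z * (nu N)%:Z
    + (nu (lfun_exp P k))%:Z - k%:Z * (nu P)%:Z.
Proof.
move=> hM hP N; have hN : Sp N by exact: SpM (SpV hP) hM.
have MN : M = (P \o N)%VF by rewrite /N lker0_compVKf // (Sp_ker0 hP).
rewrite /defect_sum -/N; clearbody N; rewrite {M hM}MN.
have hNj j := SpX j hN; have hPj j := SpX j hP.
(* The telescoping quantities, which pair N^j with P^(k - j). *)
pose a j := tg (lfun_exp N j) (lfun_exp P (k - j)) \1.
pose b j : int := (dg (lfun_exp N j) (lfun_exp P (k - j)))%:Z.
transitivity (\sum_(j < k) ((a j - a j.+1) + (b j - b j.+1)
   - (tg (lfun_exp P (k - j.+1)) (lfun_exp P (k - j)) \1
      + tg (lfun_exp N j) (lfun_exp N j.+1) \1 + ((nu P)%:Z - (nu N)%:Z)))).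
  apply: eq_bigr => j _; set Q := (_ \o _)%VF.
  have hQ : Sp Q by exact: SpM (hPj _) (SpV (hNj _)).
  have QN : (Q \o lfun_exp N j)%VF = lfun_exp P (k - j).
    by rewrite /Q lker0_compfVK // (Sp_ker0 (hNj _)).
  have kj : (k - j = (k - j.+1).+1)%N by rewrite subnSK.
  set i := (k - j.+1)%N in kj.
  pose Q' := (lfun_exp P i \o (lfun_exp N j)^-1)%VF.
  have QQ' : Q = (P \o Q')%VF by rewrite /Q kj lfun_expS comp_lfunA.
  have Q'N : (Q' \o lfun_exp N j)%VF = lfun_exp P i.
    by rewrite /Q' lker0_compfVK // (Sp_ker0 (hNj _)).
  have hQ' : Sp Q' by exact: SpM (hPj _) (SpV (hNj _)).
  have QV : (Q^-1 = lfun_exp N j \o (lfun_exp P i.+1)^-1)%VF.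
    apply: (lker0_inv_unique (Sp_ker0 hQ)).
    by rewrite comp_lfunA QN kj lker0_compfV // (Sp_ker0 (hPj _)).
  (* P is removed on the left and N^j is applied on the right. *)
  have e1 : tg (P \o N) Q P
      = tg (lfun_exp N j.+1) (lfun_exp P i) (lfun_exp N j).
    rewrite -{2}(comp_lfun1r P) QQ' tg_mapl // -(tg_mapr _ _ _ (hNj j)).
    by rewrite Q'N comp_lfun1l.
  (* Here inverses are taken first, at the cost of a sign, and P^(k - j) is applied on the right, so
     that only nonnegative powers remain. *)
  have e2 : tg \1 Q P
      = - tg (lfun_exp P i.+1) (lfun_exp N j) (lfun_exp P i).
    rewrite -[RHS](opprK) -[LHS](opprK); congr (- _).
    rewrite -(tgV (Sp1 _) hQ hP) -(tg_mapr _ _ _ (hPj i.+1)).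
    rewrite inv_lfun_id comp_lfun1l opprK; congr (tg _ _ _).
      by rewrite QV lker0_compfVK // (Sp_ker0 (hPj _)).
    by rewrite lfun_expS lker0_compKf // (Sp_ker0 hP).
  have e3 : dg (P \o N) Q = dg (lfun_exp N j.+1) (lfun_exp P i).
    by rewrite QQ' dg_mapl // -(dg_mapr _ _ (hNj j)) Q'N.
  have e4 : dg \1 Q = dg (lfun_exp N j) (lfun_exp P (k - j)).
    by rewrite -(dg_mapr _ _ (hNj j)) QN comp_lfun1l.
  have e5 : dg (P \o N) P = nu N by rewrite -{2}(comp_lfun1r P) dg_mapl.
  rewrite e1 e2 e3 e4 e5 (dgC \1 P) /a /b -/i kj.
  rewrite (tg_cocycle (hNj j.+1) (hPj i) (hNj j)).
  rewrite (tg_cocycle (hPj i.+1) (hNj j) (hPj i)).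
  rewrite (tgC (hNj j) (hPj i) (Sp1 _)) (tgC (hNj j) (hPj i.+1) (Sp1 _)).
  rewrite -/(nu P).
  move: (tg _ _ _) (tg _ _ _) (tg _ _ _) (tg _ _ _) (tg _ _ _).
  move: (dg _ _) (dg _ _) (nu _) (nu _) =>
    d1 d2 n1 n2 x1 x2 x3 x4 x5; lia.
have tel (f : nat -> int) : \sum_(j < k) (f j - f j.+1) = f 0%N - f k.
  rewrite -(big_mkord xpredT (fun j => f j - f j.+1)).
  by rewrite -[LHS]opprK -sumrN (eq_bigr _ (fun j _ => opprB _ _))
    telescope_sumr // opprB.
set rhs := (X in _ = X).
rewrite sumrB [X in X - _]big_split [X in _ - X]big_split /=.
rewrite [X in _ - (X + _)]big_split /= sumr_const card_ord.
rewrite (tel a) (tel b) /a /b subn0 subnn /rhs.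
(* The powers of P occur in decreasing order, so the index is reversed. *)
have -> : \sum_(j < k) tg (lfun_exp P (k - j.+1)) (lfun_exp P (k - j)) \1
    = power_sgn k P.
  rewrite /power_sgn [RHS](reindex_inj rev_ord_inj).
  by apply: eq_bigr => j _; rewrite -(subnSK (ltn_ord j)).
rewrite -[X in _ - (_ + X + _)]/(power_sgn k N) -/(nu (lfun_exp N k)).
have h1 := Sp1 omega.
(* At both ends of the telescope a zeroth power coincides with the third entry \1, and the signature
   vanishes. *)
have -> : tg (lfun_exp N 0) (lfun_exp P k) \1 = 0.
  by rewrite (tg_cyc h1 h1 (hPj k)) tgxx.
have -> : tg (lfun_exp N k) (lfun_exp P 0) \1 = 0.
  by rewrite -(tg_cyc (hNj k) h1 h1) tgxx.
rewrite (dgC (lfun_exp N 0)) -[dg (lfun_exp P k) _]/(nu (lfun_exp P k)).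
move: (power_sgn _ _) (power_sgn _ _) (nu _) (nu _) (nu _) (nu _).
by move=> F1 F2 n1 n2 n3 n4; rewrite -mulr_natl natz; lia.
Qed.

Lemma power_sgnV k S : Sp S -> power_sgn k S^-1%VF = - power_sgn k S.
Proof.
move=> hS; rewrite /power_sgn -sumrN; apply: eq_bigr => j _.
rewrite !(lfun_expV _ (Sp_ker0 hS)) -[in LHS](inv_lfun_id V).
rewrite tgV //; [exact: SpX|exact: SpX|exact: Sp1].
Qed.

Lemma power_sgn_id k : power_sgn k \1%VF = 0.
Proof.
rewrite /power_sgn big1 // => j _; rewrite !lfun_exp_id.
by rewrite tgxx //; exact: Sp1.
Qed.

Lemma nuV S : Sp S -> nu S^-1%VF = nu S.
Proof.
move=> hS; rewrite /nu -{1}(inv_lfun_id V).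
by rewrite (dgV hS (Sp1 _)).
Qed.

Lemma nu_id : nu \1%VF = \dim {:V}.
Proof. by rewrite /nu /dg capvv dim_graph. Qed.

Lemma mem_fix S v : (v \in lker (S - \1)%VF) = (S v == v).
Proof. by rewrite memv_ker add_lfunE opp_lfunE id_lfunE subr_eq0. Qed.

Lemma nuE S : nu S = \dim (lker (S - \1)%VF).
Proof.
have gl : linear (fun v : V => (v, v)) by move=> a x y.
rewrite /nu /dg.
have -> : (graph S :&: graph \1)%VS
    = (linfun (fun v : V => (v, v)) @: lker (S - \1)%VF)%VS.
  apply/vspaceP => -[x y]; rewrite memv_cap !memv_graph /= id_lfunE.
  apply/andP/memv_imgP => [[/eqP yS /eqP yx]|[v]].
    by exists x; rewrite ?mem_fix -?yS ?yx // (linfun_linE gl).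
  by rewrite mem_fix (linfun_linE gl) => /eqP Sv [-> ->]; rewrite Sv.
rewrite limg_dim_eq //; apply/eqP; rewrite -subv0; apply/subvP => x.
by move/memv_capP => [_]; rewrite memv_ker (linfun_linE gl) memv0 => /eqP[->].
Qed.

End GraphSignature.

(** * Iteration paths *)

Section Gluing.
Variables (R : realType) (E : vectType R[i]).

Lemma cont_on_ext (a b : R) (f g : R -> E) :
  (forall x, a <= x <= b -> g x = f x) -> cont_on a b f -> cont_on a b g.
Proof.
move=> gf cf; apply: cont_on_intro => s0 i s0ab; rewrite gf //.
apply: cvgC_eq (cont_on_cvg (phi := coord (vbasis {:E}) i)
  (fun k u v => linearP _ k u v) cf s0ab).
by apply: filterS (near_itv a b s0) => x xab; rewrite gf.
Qed.

Lemma cont_on_cat (a b c : R) (f : R -> E) :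
  cont_on a c f -> cont_on c b f -> cont_on a b f.
Proof.
move=> c1 c2; apply: cont_on_intro => s0 i s0ab; split=> e e0.
have piece u v : cont_on u v f -> exists2 d, 0 < d & forall x, u <= x <= v ->
    s0 - d < x -> x < s0 + d -> 
    `|coord (vbasis {:E}) i (f s0) - coord (vbasis {:E}) i (f x)| < e.
  move=> cf; have [s0uv|] := boolP (u <= s0 <= v).
    have [fl] := cont_on_cvg (phi := coord (vbasis {:E}) i)
      (fun k u v => linearP _ k u v) cf s0uv.
    exact: near_within_itv (fl e e0).
  rewrite negb_and -!ltNge => /orP[s0u|vs0].
    exists (u - s0) => [|x /andP[ux _] _]; first by rewrite subr_gt0.
    by rewrite addrC subrK ltNge ux.
  exists (s0 - v) => [|x /andP[_ xv]]; first by rewrite subr_gt0.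
  by rewrite subKr ltNge xv.
have [d1 d10 h1] := piece _ _ c1; have [d2 d20 h2] := piece _ _ c2.
apply/nbhs_ballP; exists (Num.min d1 d2); first by rewrite /= lt_min d10.
move=> x; rewrite /ball /= lt_min !ltr_norml => /andP[/andP[x1 x2] /andP[x3 x4]].
rewrite in_itv /= => /andP[ax xb]; have [xc|cx] := lerP x c.
  by apply: h1; [rewrite ax|lra|lra].
by apply: h2; [rewrite (ltW cx)|lra|lra].
Qed.

End Gluing.

Section Iterates.
Variable R : realType.
Local Notation C := R[i].
Variables (V : vectType C) (omega : skewhermitian R V).
Hypothesis hnd : nondegenerate omega.
Let w := fun u v => omega u v.
Let hw : skew_form w := skew_form_of omega.
Let hwn : nondeg w := nondeg_of hnd.
Let hr := rich_dbl hw hwn.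
Local Notation Dh := (double_form omega : skewhermitian R (V * V)%type).
Let hD : nondegenerate Dh := nondeg_double hnd.
Local Notation Sp := (Sp omega).

Section Path.
Variables (tau : R) (gamma : R -> 'End(V)) (P : 'End(V)).
Hypotheses (tau0 : 0 < tau) (hgamma : symp_path omega tau gamma).
Hypotheses (gamma0 : gamma 0 = \1%VF) (hP : Sp P).
Let N := (P^-1 \o gamma tau)%VF.
Let it := iter_path tau gamma P.

Let hM : Sp (gamma tau).
Proof. by case: hgamma => _; apply; rewrite lexx ltW. Qed.

Let hN : Sp N. Proof. exact: SpM (SpV hP) hM. Qed.

Lemma iter_path_piece (j : nat) (t : R) : 0 <= t <= tau ->
  it (t + j%:R * tau) = (lfun_exp P j \o gamma t \o lfun_exp N j)%VF.
Proof.
move=> /andP[t0]; rewrite le_eqVlt /it /iter_path => /orP[/eqP->|tt].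
  (* At the right end the floor is already j.+1; the formula of the next piece gives the same map
     since P N = gamma tau. *)
  have -> : Num.truncn ((tau + j%:R * tau) / tau) = j.+1.
    rewrite -[X in X + _]mul1r -mulrDl mulfK ?gt_eqF // -[1 + _]/(1%:R + _).
    by rewrite -natrD natrK.
  have -> : tau + j%:R * tau - j.+1%:R * tau = 0.
    by rewrite -natr1 mulrDl mul1r (addrC tau) subrr.
  rewrite gamma0 comp_lfun1r -/N lfun_expSr lfun_expS -!comp_lfunA.
  by rewrite lker0_compVKf // (Sp_ker0 hP).
have -> : Num.truncn ((t + j%:R * tau) / tau) = j; last by rewrite addrK.
apply: truncn_def; rewrite mulrDl mulfK ?gt_eqF // lerDr divr_ge0 ?(ltW tau0) //=.
by rewrite -natr1 addrC ltrD2l ltr_pdivrMr // mul1r.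
Qed.

Lemma iter_path_split (j : nat) (t : R) : j%:R * tau <= t <= j.+1%:R * tau ->
  it t = (lfun_exp P j \o gamma (t - j%:R * tau) \o lfun_exp N j)%VF.
Proof.
rewrite -natr1 mulrDl mul1r => /andP[jt tj].
rewrite -{1}(subrK (j%:R * tau) t) iter_path_piece //.
by rewrite subr_ge0 jt lerBlDl.
Qed.

Lemma symp_iter_path (k : nat) : symp_path omega (k%:R * tau) it.
Proof.
case: (hgamma) => cg hg; elim: k => [|k [IHc IHs]].
  rewrite mul0r; split=> [|t /le_anti <-].
    apply: (cont_on_ext (f := fun=> it 0)) => [x /le_anti <- //|].
    exact: cont_on_cst.
  have := @iter_path_piece 0 0; rewrite mul0r addr0 => ->.
    by rewrite comp_lfun1l comp_lfun1r gamma0; exact: Sp1.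
  by rewrite lexx ltW.
have kk : k.+1%:R * tau = tau + k%:R * tau by rewrite -natr1 mulrDl mul1r addrC.
split.
  apply: (cont_on_cat IHc).
  apply: (cont_on_ext (iter_path_split (j := k))).
  apply: cont_on_comp; last exact: cont_on_cst.
  apply: cont_on_comp; first exact: cont_on_cst.
  by have := cont_on_shift (c := k%:R * tau) cg; rewrite add0r -kk.
move=> t /andP[t0 tk]; have [tlt|tge] := lerP t (k%:R * tau).
  by apply: IHs; rewrite t0.
rewrite (iter_path_split (j := k)) ?(ltW tge) //.
apply: SpM (SpX k hN); apply: SpM (SpX k hP) _.
by apply: hg; rewrite subr_ge0 (ltW tge) lerBlDr -kk.
Qed.

Let Q k j := (lfun_exp P (k - j) \o (lfun_exp N j)^-1)%VF.

Lemma iter_path_maslov (k j : nat) (m : nat -> int) : (j <= k)%N ->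
  (forall i, (i < k)%N ->
    is_maslov Dh 0 tau (fun t => graph (gamma t)) (fun=> graph (Q k i)) (m i)) ->
  is_maslov Dh 0 (j%:R * tau) (fun t => graph (it t))
    (fun=> graph (lfun_exp P k)) (\sum_(i < j) m i).
Proof.
move=> jk hm; elim: j jk => [|j IH] jk.
  by rewrite big_ord0 mul0r; exact: is_maslov_refl.
have kk : j.+1%:R * tau = tau + j%:R * tau by rewrite -natr1 mulrDl mul1r addrC.
rewrite big_ord_recr /=; apply: is_maslov_cat (IH (ltnW jk)) _.
have hNj := SpX j hN; have hPj := SpX j hP; have hNi := SpV hNj.
rewrite kk -{1}[j%:R * tau]add0r.
apply: (is_maslov_transport hD (f := prod_map (lfun_exp N j)^-1 (lfun_exp P j)))
  (hm j jk).
- exact: (prod_map_ker hNi hPj).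
- exact: (prod_map_dbl hNi hPj).
- move=> x xt; rewrite iter_path_piece // -comp_lfunA.
  rewrite -(prod_map_graph _ _ hNi) lker0_compfK //; exact: Sp_ker0 hNj.
(* [Q k j] is the reference that diag(N^-j, P^j) carries to the graph of P^k, for every j. *)
move=> x xt; rewrite /Q (prod_map_graph _ _ hNi) -lfun_expD subnKC //.
exact: ltnW.
Qed.

Lemma iter_index_sum (k : nat) (m : nat -> int) :
  (forall i, (i < k)%N ->
    is_maslov Dh 0 tau (fun t => graph (gamma t)) (fun=> graph (Q k i)) (m i)) ->
  iter_index omega k tau gamma P = \sum_(i < k) m i.
Proof.
move=> hm; have [cit sit] := symp_iter_path k.
have m1 := iter_path_maslov (leqnn k) hm.
apply: (xget_unique 0 m1) => m' m1'.
apply: (is_maslov_unique hD hr _ (cont_graph cit) _ _ m1' m1).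
- by rewrite mulr_ge0 // ltW.
- by move=> x /sit hx; exact: lagr_graph.
exact: (lagr_graph hnd (SpX k hP)).
Qed.

Lemma iter_index_maslov : exists m1 : int,
  is_maslov Dh 0 tau (fun t => graph (gamma t)) (fun=> graph P) m1 /\
  iter_index omega 1 tau gamma P = m1.
Proof.
case: (hgamma) => cg hg.
have [m1 hm1] := is_maslov_ex hD hr (ltW tau0) (cont_graph cg)
  (fun x hx => lagr_graph hnd (hg x hx)) (lagr_graph hnd hP).
exists m1; split=> //; rewrite (iter_index_sum (m := fun=> m1)) ?big_ord1 //.
move=> i; rewrite ltnS leqn0 => /eqP->.
have -> : Q 1 0 = P by rewrite /Q lfun_exp1 inv_lfun_id comp_lfun1r.
exact: hm1.
Qed.

Lemma iter_defectE (k : nat) :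
  2 * iter_defect omega k tau gamma P = defect_sum omega k (gamma tau) P.
Proof.
case: (hgamma) => cg hg.
have hQ i : Sp (Q k i) by exact: SpM (SpX _ hP) (SpV (SpX _ hN)).
have cgr := cont_graph cg.
have lgr x (hx : 0 <= x <= tau) := lagr_graph hnd (hg x hx).
have [m hm] := choice (fun i =>
  is_maslov_ex hD hr (ltW tau0) cgr lgr (lagr_graph hnd (hQ i))).
have [m1 [hm1 i1]] := iter_index_maslov.
rewrite /iter_defect i1 (iter_index_sum (m := m)) // /defect_sum -/N.
have -> : k%:Z * m1 = \sum_(i < k) m1.
  by rewrite sumr_const card_ord -mulr_natl natz.
rewrite -sumrB mulr_sumr; apply: eq_bigr => i _.
have := hoermander hD cgr lgr hr (lagr_graph hnd (hQ i)) (lagr_graph hnd hP)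
  (ltW tau0) (hm i) hm1.
by cbv beta zeta; rewrite gamma0.
Qed.

End Path.

Lemma fdefectE (k : nat) (M P : 'End(V)) : Sp M -> Sp P ->
  2 * fdefect omega k M P = defect_sum omega k M P.
Proof.
move=> hM hP; rewrite /fdefect.
have [g [cg hg g0 g1]] := Sp_joined hnd hM.
set A := [set _ | _]%classic.
have : A (xget 0 A).
  apply: xgetPex; exists (iter_defect omega k 1 g P); exists 1, g.
  by split=> //; exact: ltr01.
by move=> [tau [gamma [tau0 hgamma gamma0 gM ->]]]; rewrite iter_defectE ?gM.
Qed.

Lemma iter_defect_fdefect (k : nat) (tau : R) (gamma : R -> 'End(V))
    (P : 'End(V)) : 0 < tau -> symp_path omega tau gamma ->
  gamma 0 = \1%VF -> Sp P ->
  iter_defect omega k tau gamma P = fdefect omega k (gamma tau) P.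
Proof.
move=> tau0 hgamma gamma0 hP; apply: (@mulfI _ 2) => //.
rewrite iter_defectE // fdefectE //.
by case: hgamma => _; apply; rewrite lexx ltW.
Qed.

(** In the closed form of the three defects, the dimension terms of \1 are equal in both terms on
    the right and cancel. Replacing P by its inverse changes the sign of the power sum and preserves
    the fixed-space dimensions. *)
Lemma fdefect_reduce (k : nat) (M P : 'End(V)) : Sp M -> Sp P ->
  fdefect omega k M P
  = fdefect omega k (P^-1 \o M)%VF \1%VF - fdefect omega k P^-1%VF \1%VF.
Proof.
move=> hM hP; apply: (@mulfI _ 2) => //; rewrite mulrBr.
have hPV := SpV hP; have hN := SpM hPV hM; have h1 := Sp1 omega.
rewrite !fdefectE // !(defect_sumE hnd) // inv_lfun_id !comp_lfun1l.
rewrite (power_sgnV k hP) (power_sgn_id hnd).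
rewrite lfun_exp_id (lfun_expV _ (Sp_ker0 hP)).
move: (P^-1 \o M)%VF => N; move: (lfun_exp N k) (lfun_exp P k) (SpX k hP) => Nk Pk hPk.
rewrite (nuV hPk) (nuV hP).
move: (power_sgn _ _ _) (power_sgn _ _ _) (nu _) (nu _) (nu _) (nu _) (nu _).
by move=> F1 F2 n1 n2 n3 n4 n5; lia.
Qed.

Lemma fdefect_id (k : nat) (P : 'End(V)) : Sp P ->
  2 * fdefect omega k P \1%VF = (1 - k%:Z) * (\dim {:V})%:Z
    - power_sgn omega k P - (nu (lfun_exp P k))%:Z + k%:Z * (nu P)%:Z.
Proof.
move=> hP; have h1 := Sp1 omega.
rewrite fdefectE // (defect_sumE hnd) // inv_lfun_id !comp_lfun1l.
rewrite (power_sgn_id hnd) lfun_exp_id nu_id.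
move: (power_sgn _ _ _) (nu _) (nu _) (\dim _).
by move=> F1 n1 n2 n3; lia.
Qed.
End Iterates.

(** * Symplectic maps with an invariant Lagrangian subspace *)

Section InvariantLagrangian.
Variable R : realType.
Local Notation C := R[i].
Variables (V : vectType C) (omega : skewhermitian R V).
Hypothesis hnd : nondegenerate omega.
Let w := fun u v => omega u v.
Let hw : skew_form w := skew_form_of omega.
Let hwn : nondeg w := nondeg_of hnd.
Let hD := skew_dbl hw.
Let hDn := nondeg_dbl hw hwn.
Let hr := rich_dbl hw hwn.
Local Notation D := (dbl w).
Local Notation Sp := (Sp omega).
Variable X : {vspace V}.
Hypothesis hX : lagr w X.
Implicit Types S P : 'End(V).

(** The overview's psi(S), written as a triple signature so that the cocycle identity applies;
    [lagr_sgnE] recovers the form on V. *)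
Definition lagr_sgn S : int := tsgn D (graph S) (graph \1) (prodv X X).

Lemma lagr_prodv : lagr D (prodv X X).
Proof.
apply: (isotropic_lagr hD hDn) => [u v|].
  rewrite !memv_prodv => /andP[u1 u2] /andP[v1 v2].
  by rewrite /dbl (lagr0 hX u1 v1) (lagr0 hX u2 v2) oppr0 addr0.
by rewrite dim_dbl !dim_prodv (dim_lagr hw hwn hX).
Qed.

Lemma inv_exp P k x : (forall x, x \in X -> P x \in X) -> x \in X ->
  lfun_exp P k x \in X.
Proof.
move=> PX xX; elim: k => [|k IH]; first by rewrite id_lfunE.
by rewrite lfun_expS comp_lfunE PX.
Qed.

Lemma power_sgn_lagr P k : Sp P -> (forall x, x \in X -> P x \in X) ->
  power_sgn omega k P = lagr_sgn (lfun_exp P k) - k%:Z * lagr_sgn P.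
Proof.
move=> hP PX; have hZ := lagr_prodv; have h1 := lagr_graph hnd (Sp1 omega).
have hPj j := lagr_graph hnd (SpX j hP).
elim: k => [|k IH].
  by rewrite /power_sgn big_ord0 /lagr_sgn (tsgnxx hD hDn hr h1 hZ) mul0r subrr.
rewrite /power_sgn big_ord_recr /= -/(power_sgn omega k P) {}IH.
have -> : tg omega (lfun_exp P k) (P \o lfun_exp P k) \1
    = - lagr_sgn P + lagr_sgn (lfun_exp P k.+1) - lagr_sgn (lfun_exp P k).
  rewrite /tg (tsgn_cocycle hD hDn hr (hPj k) (hPj k.+1) h1 hZ).
  rewrite (tsgnC hD hDn hr (hPj k) h1 hZ) -/(lagr_sgn _) -/(lagr_sgn _).
  congr (_ + _ - _); rewrite -(tsgnC hD hDn hr (lagr_graph hnd hP) h1 hZ).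
  have hk := SpX k hP; have hid := Sp1 omega.
  (* P^k x \1 preserves X x X by invariance of X and carries the graphs of P^k and P^(k+1) to those
     of \1 and P. *)
  pose f := prod_map (lfun_exp P k) (\1%VF : 'End(V)).
  have kf : lker f = 0%VS by exact: (prod_map_ker hk hid).
  have fZ : (f @: prodv X X)%VS = prodv X X.
    apply/eqP; rewrite eqEdim limg_dim_eq ?kf ?capv0 // leqnn andbT.
    apply/subvP => _ /memv_imgP[u + ->]; rewrite !memv_prodv prod_mapE /=.
    by rewrite id_lfunE => /andP[u1 ->]; rewrite inv_exp.
  have := tsgn_map (graph (\1 \o lfun_exp P k)) (graph (P \o lfun_exp P k))
    (prodv X X) hD kf (prod_map_dbl hk hid).
  by rewrite !(prod_map_graph _ _ hk) fZ !comp_lfun1l => <-.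
move: (lagr_sgn _) (lagr_sgn _) (lagr_sgn _) => a b c; lia.
Qed.

Definition inv_form S (u v : V) : C := w ((S - \1)%VF u) v.
Definition inv_space S : {vspace V} := ((S - \1)%VF @^-1: X)%VS.

Lemma subid_lfunE S v : (S - \1)%VF v = S v - v.
Proof. by rewrite add_lfunE opp_lfunE id_lfunE. Qed.

Lemma mem_inv_space S v : (v \in inv_space S) = (S v - v \in X).
Proof. by rewrite -memv_preim subid_lfunE. Qed.

(** A point of Wall's space is ((a, S a), (c, c)) with a + c and S a + c in X, so a lies in
    [inv_space]. Since S a - a is orthogonal to a + c, the value depends on a alone, and projecting
    to a identifies the forms. *)
Lemma lagr_sgnE S : lagr_sgn S = msgn (inv_form S) (inv_space S).
Proof.
pose f : 'Hom(((V * V) * (V * V))%type, V) :=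
  linfun (fun u : (V * V) * (V * V) => u.1.1).
have fE u : f u = u.1.1 by rewrite /f linfun_linE.
have -> : inv_space S = (f @: wallsp (graph S) (graph \1) (prodv X X))%VS.
  apply/vspaceP => v; rewrite mem_inv_space; apply/idP/memv_imgP => [Sv|].
    exists ((v, S v), (- v, - v)); rewrite ?fE //.
    apply/mem_wallsp; rewrite !memv_graph /= id_lfunE !eqxx memv_prodv /=.
    by rewrite subrr mem0v Sv.
  move=> [[[a b] [c d]] /mem_wallsp[]]; rewrite !memv_graph /= id_lfunE.
  move=> /eqP-> /eqP->; rewrite memv_prodv fE /= => /andP[aX SaX] ->.
  by have := memvB SaX aX; rewrite opprD addrACA subrr addr0.
apply: msgn_pull => [|[[a b] [c d]]].
  by rewrite /inv_form linear0 (skew0l hw).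
move=> /mem_wallsp[]; rewrite !memv_graph /= id_lfunE.
move=> /eqP-> /eqP->; rewrite memv_prodv fE /= => /andP[aX SaX].
rewrite /wall /dbl /inv_form subid_lfunE /=.
have SX : S a - a \in X.
  by have := memvB SaX aX; rewrite opprD addrACA subrr addr0.
have := lagr0 hX SX aX; rewrite (skewDr hw) => /eqP; rewrite addr_eq0 => /eqP->.
by rewrite (skewBl hw) opprD opprK opprB.
Qed.

(** Write S u = u + b and S v = v + a with a, b in X. In w (S v) (S u) = w v u the term w a b
    vanishes, leaving w a u + w v b = 0. *)
Lemma herm_inv_form S : Sp S -> herm_on (inv_form S) (inv_space S).
Proof.
move=> [_ hS]; split=> [a u v x|u v].
  by rewrite /inv_form linearP (skew_linl hw).
rewrite !mem_inv_space /inv_form !subid_lfunE => uX vX.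
have : w (S v - v + v) (S u - u + u) = w v u by rewrite !subrK; exact: hS.
move: (S v - v) (S u - u) vX uX => a b aX bX.
rewrite (skewDr hw) !(skewDl hw) (lagr0 hX aX bX) add0r.
rewrite addrA -[RHS]add0r => /addIr/eqP; rewrite addr_eq0 => /eqP vb.
by rewrite (skewC hw v b) rmorphN /= conjCK vb opprK.
Qed.

Lemma perpK (W : {vspace V}) : perp w (perp w W) = W.
Proof.
apply/esym/eqP; rewrite eqEdim; apply/andP; split.
  apply/subvP => u uW; apply/(mem_perp hw) => v /(mem_perp hw) vW.
  exact/(skew_eq0C hw)/vW.
have := dim_perp hw hwn W; have := dim_perp hw hwn (perp w W); lia.
Qed.

Section Invariant.
Variable S : 'End(V).
Hypotheses (hS : Sp S) (SX : forall x, x \in X -> S x \in X).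

(** Invariance gives S X = X, and w (S v - v) (S y) = - w v (S y - y). Thus S v - v is orthogonal to
    X, that is lies in X, exactly when v is orthogonal to (S - 1) X. *)
Lemma inv_space_perp : inv_space S = perp w ((S - \1)%VF @: X).
Proof.
have kS : (X :&: lker S = 0)%VS by rewrite hS.1 capv0.
have SXE : (S @: X)%VS = X.
  apply/eqP; rewrite eqEdim limg_dim_eq // leqnn andbT.
  by apply/subvP => _ /memv_imgP[x xX ->]; exact: SX.
have key v y : w (S v - v) (S y) = - w v (S y - y).
  by rewrite (skewBl hw) (skewBr hw) /w hS.2 opprB.
apply/vspaceP => v; rewrite mem_inv_space; apply/idP/idP => [vX|].
  apply/(mem_perp hw) => _ /memv_imgP[y yX ->]; rewrite subid_lfunE.
  by apply/eqP; rewrite -oppr_eq0 -key (lagr0 hX) ?SX.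
move=> /(mem_perp hw) v0; apply/hX => x; rewrite -{1}SXE => /memv_imgP[y yX ->].
by rewrite key -subid_lfunE v0 ?oppr0 // memv_img.
Qed.

Local Notation e := (\dim (X :&: lker (S - \1)%VF)).

Lemma dim_inv_space : \dim (inv_space S) = (\dim X + e)%N.
Proof.
have := dim_perp hw hwn ((S - \1)%VF @: X)%VS; rewrite -inv_space_perp.
have := limg_ker_dim (S - \1)%VF X; have := dim_lagr hw hwn hX.
move: (\dim _) (\dim X) (\dim _) (\dim _) (\dim _) => a b c d f.
lia.
Qed.

(** The radical is X + ker(S - 1): for v in it, S v - v lies in the double orthogonal of (S - 1) X,
    so v and some x in X have the same image under S - 1. The space has dimension dim X + e and the
    radical dim X + nu S - e. *)
Lemma inv_form_rank :
  (morse_pos (inv_form S) (inv_space S) + morse_neg (inv_form S) (inv_space S)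
   + nu S = 2 * e)%N.
Proof.
have ZP v : v \in (X + lker (S - \1)%VF)%VS <-> v \in inv_space S
    /\ forall u, u \in inv_space S -> inv_form S v u = 0.
  rewrite inv_space_perp; split.
    move=> /memv_addP[x xX [z]]; rewrite memv_ker => /eqP z0 ->.
    have Sxz : (S - \1)%VF (x + z) = (S - \1)%VF x by rewrite linearD /= z0 addr0.
    split=> [|u]; last first.
      move=> /(mem_perp hw) uX; rewrite /inv_form Sxz.
      by apply/(skew_eq0C hw)/uX; rewrite memv_img.
    rewrite -inv_space_perp mem_inv_space -subid_lfunE Sxz subid_lfunE.
    by rewrite memvB ?SX.
  move=> [_ v0]; have : (S - \1)%VF v \in perp w (perp w ((S - \1)%VF @: X)).
    exact/(mem_perp hw).
  rewrite perpK => /memv_imgP[x xX vx]; rewrite -(subrK x v) addrC memv_add //.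
  by rewrite memv_ker linearB /= vx subrr.
have := morse_rank (herm_inv_form hS) ZP.
have := dimv_sum_cap X (lker (S - \1)%VF); rewrite dim_inv_space nuE.
by move: (morse_pos _ _) (morse_neg _ _) => p q; lia.
Qed.

End Invariant.

(** Combining rank and signature, nu S + lagr_sgn S = 2 (e - m^-) for S = P and S = P^k. These are
    the combinations occurring in [fdefect_id], and with dim V = 2n everything can be halved. *)
Lemma fdefect_lagr P k n n1 nk e1 ek : Sp P ->
  (forall x, x \in X -> P x \in X) -> \dim {:V} = (2 * n)%N ->
  morse_neg (inv_form P) (inv_space P) = n1 ->
  morse_neg (inv_form (lfun_exp P k)) (inv_space (lfun_exp P k)) = nk ->
  \dim (X :&: lker (P - \1)%VF) = e1 ->
  \dim (X :&: lker (lfun_exp P k - \1)%VF) = ek ->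
  fdefect omega k P \1%VF
  = (1 - k%:Z) * n%:Z + k%:Z * e1%:Z - ek%:Z + nk%:Z - k%:Z * n1%:Z.
Proof.
move=> hP PX dV n1E nkE e1E ekE; have hPk := SpX k hP.
have PkX x : x \in X -> lfun_exp P k x \in X by exact: inv_exp.
have iE S m d : Sp S -> (forall x, x \in X -> S x \in X) ->
    morse_neg (inv_form S) (inv_space S) = m ->
    \dim (X :&: lker (S - \1)%VF) = d ->
    (nu S)%:Z = - (2 * (m%:Z - d%:Z)) - lagr_sgn S.
  move=> hS SX <- <-; have := inv_form_rank hS SX; rewrite lagr_sgnE /msgn.
  move: (morse_pos _ _) (morse_neg _ _) (nu _) (\dim _) => p q r e.
  by lia.
apply: (@mulfI _ 2) => //; rewrite (fdefect_id hnd k hP).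
rewrite (power_sgn_lagr k hP PX) (iE _ _ _ hP PX n1E e1E).
rewrite (iE _ _ _ hPk PkX nkE ekE) dV PoszM.
move: (lagr_sgn _) (lagr_sgn _) => c d.
by ring.
Qed.

End InvariantLagrangian.

(** * Block triangular maps *)

Section BlockForms.
Variables (R : realType) (V : vectType R[i]) (X Y : {vspace V}).
Local Notation SX := (subvs_of X).
Local Notation SY := (subvs_of Y).
Hypothesis (XY0 : (X :&: Y)%VS = 0%VS).
Implicit Types (P : 'End(V)) (A : 'End(SX)) (D : 'End(SY)).
Implicit Types (B : 'Hom(SY, SX)) (C : 'Hom(SX, SY)).

Lemma block_form_comp P P' A A' B B' C C' D D' :
  block_form P A B C D -> block_form P' A' B' C' D' ->
  block_form (P \o P')%VF ((A \o A') + (B \o C'))%VF ((A \o B') + (B \o D'))%VF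
    ((C \o A') + (D \o C'))%VF ((C \o B') + (D \o D'))%VF.
Proof.
move=> h h' x y; rewrite comp_lfunE h' h !linearD !add_lfunE !comp_lfunE.
by rewrite !linearD /=; congr (_ + _); exact: addrACA.
Qed.

Lemma subvs_eq0 (x : SX) (y : SY) : vsval x + vsval y = 0 -> x = 0 /\ y = 0.
Proof.
move=> /eqP; rewrite addr_eq0 => /eqP xy.
have x0 : vsval x = 0.
  apply/eqP; rewrite -memv0 -XY0 memv_cap subvsP xy memvN; exact: subvsP.
split; apply: val_inj => //=.
by apply: oppr_inj; rewrite -xy x0 oppr0.
Qed.

Lemma subvs_add_inj (x x' : SX) (y y' : SY) :
  vsval x + vsval y = vsval x' + vsval y' -> x = x' /\ y = y'.
Proof.
move=> h; have [] := @subvs_eq0 (x - x') (y - y').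
  by rewrite !linearB /= addrACA -opprD h subrr.
by move=> /subr0_eq -> /subr0_eq ->.
Qed.

Lemma block_form_inj P A A' B B' C C' D D' :
  block_form P A B C D -> block_form P A' B' C' D' ->
  [/\ A = A', B = B', C = C' & D = D'].
Proof.
move=> h h'.
have hx x : A x = A' x /\ C x = C' x.
  have := h x 0; have := h' x 0; rewrite !linear0 !addr0 => ->.
  by move=> /subvs_add_inj[-> ->].
have hy y : B y = B' y /\ D y = D' y.
  have := h 0 y; have := h' 0 y; rewrite !linear0 !add0r => ->.
  by move=> /subvs_add_inj[-> ->].
by split; apply/lfunP => z; [case: (hx z)|case: (hy z)|case: (hx z)|case: (hy z)].
Qed.

Lemma block_form_id : block_form (\1%VF : 'End(V))
  \1%VF (0 : 'Hom(SY, SX)) (0 : 'Hom(SX, SY)) \1%VF.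
Proof. by move=> x y; rewrite !id_lfunE !zero_lfunE addr0 add0r. Qed.

(** Peels off j = 0. The truncated exponent [k.-1 - j] is harmless at k = 0, where the sum is
    empty. *)
Lemma geom_recl (U U' : vectType R[i]) (f : 'End(U)) (g : 'Hom(U', U))
    (h : 'End(U')) k :
  (\sum_(j < k.+1) (lfun_exp f j \o g \o lfun_exp h (k - j)))%VF
  = ((f \o (\sum_(j < k) (lfun_exp f j \o g \o lfun_exp h (k.-1 - j))))
     + (g \o lfun_exp h k))%VF.
Proof.
rewrite big_ord_recl /= comp_lfun1l subn0 addrC; congr (_ + _).
rewrite (big_morph (comp_lfun f) (comp_lfunDr f) (comp_lfun0r _ f)).
apply: eq_bigr => j _.
by rewrite /bump /= add1n add0n subnS predn_sub !comp_lfunA.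
Qed.

(** A word in the blocks contributing to the upper right corner contains B exactly once, and its
    position determines the word. Hence every coefficient is 1 and the total degree is k; for k = 2
    the block is B D + A B. *)
Lemma block_form_upper P A B D k : block_form P A B 0 D ->
  block_form (lfun_exp P k) (lfun_exp A k)
    (\sum_(j < k) (lfun_exp A j \o B \o lfun_exp D (k.-1 - j)))%VF 0
    (lfun_exp D k).
Proof.
move=> hP; elim: k => [|k IH]; first by rewrite big_ord0; exact: block_form_id.
have := block_form_comp hP IH.
by rewrite !comp_lfun0l !comp_lfun0r !addr0 !add0r geom_recl.
Qed.

Lemma block_form_lower P A C D k : block_form P A 0 C D ->
  block_form (lfun_exp P k) (lfun_exp A k) 0
    (\sum_(j < k) (lfun_exp D j \o C \o lfun_exp A (k.-1 - j)))%VF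
    (lfun_exp D k).
Proof.
move=> hP; elim: k => [|k IH]; first by rewrite big_ord0; exact: block_form_id.
have := block_form_comp hP IH.
rewrite !comp_lfun0l !comp_lfun0r !addr0 !add0r geom_recl.
by rewrite [X in block_form _ _ _ X _]addrC.
Qed.

End BlockForms.

Section BlockDefect.
Variable R : realType.
Local Notation Cx := R[i].
Variables (V : vectType Cx) (omega : skewhermitian R V).
Hypothesis hnd : nondegenerate omega.
Let w := fun u v => omega u v.
Let hw : skew_form w := skew_form_of omega.
Local Notation Sp := (Sp omega).
Variables (X Y : {vspace V}).
Local Notation SX := (subvs_of X).
Local Notation SY := (subvs_of Y).
Hypotheses (hX : lagr w X) (hY : lagr w Y).
Hypotheses (XYsum : (X + Y)%VS = fullv) (XY0 : (X :&: Y)%VS = 0%VS).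
Variable Omega : {bilinear SX -> SY -> Cx | *%R & ((@Num.conj Cx) \; *%R)}.
Hypothesis hO : associated_form Omega omega.
Implicit Types (S P : 'End(V)) (A : 'End(SX)) (D : 'End(SY)).
Implicit Types (B : 'Hom(SY, SX)) (C : 'Hom(SX, SY)).

Lemma omegaXY (x : SX) (y : SY) : w (vsval x) (vsval y) = Omega x y.
Proof.
have := hO x 0 0 y; rewrite !linear0 addr0 add0r -/(w _ _) => ->.
by rewrite rmorph0 subr0.
Qed.

Lemma omegaYX (x : SX) (y : SY) : w (vsval y) (vsval x) = - (Omega x y)^*.
Proof. by rewrite (skewC hw) omegaXY. Qed.

Definition join_map : 'Hom((SX * SY)%type, V) :=
  linfun (fun u : SX * SY => vsval u.1 + vsval u.2).

Lemma join_mapE u : join_map u = vsval u.1 + vsval u.2.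
Proof.
rewrite /join_map linfun_linE // => a x y.
by rewrite !linearP /= scalerDr addrACA.
Qed.

Lemma join_map_ker : lker join_map = 0%VS.
Proof.
apply/eqP/lker0P => -[x y] [x' y']; rewrite !join_mapE /=.
by move=> /(subvs_add_inj XY0)[-> ->].
Qed.

Lemma join_map_surj v : exists u, v = join_map u.
Proof.
have : v \in (X + Y)%VS by rewrite XYsum memvf.
move=> /memv_addP[x xX [y yY ->]].
by exists (vsproj X x, vsproj Y y); rewrite join_mapE /= !vsprojK.
Qed.

Lemma block_formX P A B C D x : block_form P A B C D ->
  P (vsval x) = vsval (A x) + vsval (C x).
Proof. by move=> h; have := h x 0; rewrite !linear0 !addr0. Qed.

Lemma block_formY P A B C D y : block_form P A B C D ->
  P (vsval y) = vsval (B y) + vsval (D y).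
Proof. by move=> h; have := h 0 y; rewrite !linear0 !add0r. Qed.

Lemma fix_dim (W : {vspace V}) (F : 'End(subvs_of W)) S :
  (forall x : subvs_of W, S (vsval x) = vsval (F x)) ->
  \dim (W :&: lker (S - \1)%VF) = \dim (lker (F - \1)%VF).
Proof.
move=> SF; have sl : linear (vsval : subvs_of W -> V) by move=> a x y; rewrite linearP.
have -> : (W :&: lker (S - \1)%VF)%VS = (linfun vsval @: lker (F - \1)%VF)%VS.
  apply/vspaceP => v; rewrite memv_cap mem_fix; apply/andP/memv_imgP.
    move=> [vW Sv]; exists (vsproj W v); last by rewrite (linfun_linE sl) vsprojK.
    by rewrite mem_fix; apply/eqP/val_inj; rewrite /= -SF vsprojK //; exact/eqP.
  move=> [x]; rewrite mem_fix => /eqP Fx ->; rewrite (linfun_linE sl).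
  by rewrite subvsP SF Fx.
rewrite limg_dim_eq //; apply/eqP; rewrite -subv0; apply/subvP => x.
move=> /memv_capP[_]; rewrite memv_ker (linfun_linE sl) => /eqP x0.
by rewrite memv0; apply/eqP/val_inj.
Qed.

Lemma upper_inv_space S A B D : block_form S A B 0 D ->
  inv_space X S = (join_map @: prodv fullv (lker (D - \1)%VF))%VS.
Proof.
move=> hS; apply/vspaceP => v; have [[x y] ->] := join_map_surj v.
have -> : (join_map (x, y) \in (join_map @: prodv fullv (lker (D - \1)%VF))%VS)
    = (D y == y).
  apply/memv_imgP/eqP => [[[x' y']]|Dy].
    rewrite memv_prodv /= mem_fix => /andP[_ /eqP Dy] /eqP.
    by move/lker0P: (introT eqP join_map_ker) => /[swap] /eqP h /(_ _ _ h)[_ ->].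
  by exists (x, y) => //; rewrite memv_prodv memvf mem_fix /= Dy eqxx.
rewrite mem_inv_space join_mapE /= hS zero_lfunE add0r opprD addrACA.
have -> : vsval (D y) - vsval y = vsval (D y - y) by rewrite linearB.
have -> : vsval (A x + B y) - vsval x = vsval (A x + B y - x) by rewrite linearB.
rewrite rpredDl ?subvsP //; apply/idP/eqP => [DyX|->]; last first.
  by rewrite subrr linear0 mem0v.
have : vsval (D y - y) \in (X :&: Y)%VS by rewrite memv_cap DyX subvsP.
by rewrite XY0 memv0 => /eqP h; apply: subr0_eq; exact: val_inj.
Qed.

(** S v - v lies in X and pairs only with y, giving Omega (A x + B y - x) y. Since S preserves w and
    D y = y, Omega (A x) y = Omega x y, and only the B term survives. *)
Lemma upper_inv_form S A B D x y : Sp S -> block_form S A B 0 D -> D y = y ->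
  inv_form omega S (join_map (x, y)) (join_map (x, y)) = Omega (B y) y.
Proof.
move=> [_ hS] hb Dy; rewrite /inv_form subid_lfunE join_mapE /= hb zero_lfunE.
rewrite add0r Dy opprD addrACA subrr addr0 -/(w _ _).
have -> : vsval (A x + B y) - vsval x = vsval (A x + B y - x) by rewrite linearB.
rewrite (skewDr hw) (lagr0 hX) ?subvsP // add0r omegaXY.
have : w (S (vsval x)) (S (vsval y)) = w (vsval x) (vsval y) by exact: hS.
rewrite (block_formX _ hb) (block_formY _ hb) zero_lfunE linear0 addr0 Dy.
rewrite (skewDr hw) (lagr0 hX) ?subvsP // add0r !omegaXY => AO.
rewrite addrAC.
by rewrite linearDl linearBl /= AO subrr add0r.
Qed.

Lemma lower_inv_space S A C D : block_form S A 0 C D ->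
  inv_space Y S = (join_map @: prodv (lker (A - \1)%VF) fullv)%VS.
Proof.
move=> hS; apply/vspaceP => v; have [[x y] ->] := join_map_surj v.
have -> : (join_map (x, y) \in (join_map @: prodv (lker (A - \1)%VF) fullv)%VS)
    = (A x == x).
  apply/memv_imgP/eqP => [[[x' y']]|Ax].
    rewrite memv_prodv /= mem_fix => /andP[/eqP Ax _] /eqP.
    by move/lker0P: (introT eqP join_map_ker) => /[swap] /eqP h /(_ _ _ h)[-> _].
  by exists (x, y) => //; rewrite memv_prodv memvf mem_fix /= Ax eqxx.
rewrite mem_inv_space join_mapE /= hS zero_lfunE addr0 opprD addrACA.
have -> : vsval (A x) - vsval x = vsval (A x - x) by rewrite linearB.
have -> : vsval (C x + D y) - vsval y = vsval (C x + D y - y) by rewrite linearB.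
rewrite rpredDr ?subvsP //; apply/idP/eqP => [AxY|->]; last first.
  by rewrite subrr linear0 mem0v.
have : vsval (A x - x) \in (X :&: Y)%VS by rewrite memv_cap AxY subvsP.
by rewrite XY0 memv0 => /eqP h; apply: subr0_eq; exact: val_inj.
Qed.

(** Now S v - v lies in Y and pairs only with x, with the Y-argument first; this produces the minus
    sign that turns m^- into m^+ in [lower_index]. *)
Lemma lower_inv_form S A C D x y : Sp S -> block_form S A 0 C D -> A x = x ->
  inv_form omega S (join_map (x, y)) (join_map (x, y)) = - (Omega x (C x))^*.
Proof.
move=> [_ hS] hb Ax; rewrite /inv_form subid_lfunE join_mapE /= hb zero_lfunE.
rewrite addr0 Ax opprD addrACA subrr add0r -/(w _ _).
have -> : vsval (C x + D y) - vsval y = vsval (C x + D y - y) by rewrite linearB.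
rewrite (skewDr hw) [w _ (vsval y)](lagr0 hY) ?subvsP // addr0 omegaYX.
have : w (S (vsval x)) (S (vsval y)) = w (vsval x) (vsval y) by exact: hS.
rewrite (block_formX _ hb) (block_formY _ hb) zero_lfunE linear0 add0r Ax.
rewrite (skewDl hw) [w (vsval (C x)) _](lagr0 hY) ?subvsP // addr0 !omegaXY => DO.
by rewrite linearBr linearDr /= DO addrK.
Qed.

(** The form depends on y alone, so projecting out x preserves the index. Diagonal values are real,
    which absorbs the conjugation, and D y = y on the kernel. *)
Lemma upper_index S A B D : Sp S -> block_form S A B 0 D ->
  morse_neg (inv_form omega S) (inv_space X S)
  = morse_neg (fun y1 y2 => (Omega (B y2) (D y1))^*) (lker (D - \1)%VF).
Proof.
move=> hS hb; set W := prodv (fullv : {vspace SX}) (lker (D - \1)%VF).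
have hf := herm_inv_form hX hS.
pose q (u v : SX * SY) := - inv_form omega S (join_map u) (join_map v).
transitivity (morse_pos q W).
  rewrite (upper_inv_space hb) /morse_neg; apply/esym/morse_pull => //.
  by rewrite (herm0l hf) oppr0.
have sE : (linfun (fun u : SX * SY => u.2) @: W)%VS = lker (D - \1)%VF.
  apply/vspaceP => y; apply/memv_imgP/idP => [[u]|yD].
    by rewrite memv_prodv linfun_linE // => /andP[_ uD] ->.
  by exists (0, y); rewrite ?linfun_linE // memv_prodv memvf.
rewrite /morse_neg -sE; apply: morse_pull => [|[x y] uW].
  by rewrite !linear0 rmorph0 oppr0.
have /(herm_real hf)/CrealP : join_map (x, y) \in inv_space X S.
  by rewrite (upper_inv_space hb) memv_img.
have Dy : D y = y.
  by move: uW; rewrite memv_prodv mem_fix => /andP[_ /eqP].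
rewrite (linfun_linE (f := fun u : SX * SY => u.2)) //=.
by rewrite /q (upper_inv_form _ hS hb Dy) Dy => ->.
Qed.

Lemma lower_index S A C D : Sp S -> block_form S A 0 C D ->
  morse_neg (inv_form omega S) (inv_space Y S)
  = morse_pos (fun x1 x2 => (Omega (A x1) (C x2))^*) (lker (A - \1)%VF).
Proof.
move=> hS hb; set W := prodv (lker (A - \1)%VF) (fullv : {vspace SY}).
have hf := herm_inv_form hY hS.
pose q (u v : SX * SY) := - inv_form omega S (join_map u) (join_map v).
transitivity (morse_pos q W).
  rewrite (lower_inv_space hb) /morse_neg; apply/esym/morse_pull => //.
  by rewrite (herm0l hf) oppr0.
have sE : (linfun (fun u : SX * SY => u.1) @: W)%VS = lker (A - \1)%VF.
  apply/vspaceP => x; apply/memv_imgP/idP => [[u]|xA].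
    by rewrite memv_prodv linfun_linE // => /andP[uA _] ->.
  by exists (x, 0); rewrite ?linfun_linE // memv_prodv memvf andbT.
rewrite -sE; apply: morse_pull => [|[x y]].
  by rewrite !linear0 rmorph0.
rewrite memv_prodv mem_fix linfun_linE //= => /andP[/eqP Ax _].
by rewrite /q (lower_inv_form _ hS hb Ax) Ax opprK.
Qed.

(** With Y invariant, [fdefect_lagr] yields ker(D - 1) where (ii) has ker(A - 1). Computing the
    dimension of [inv_space Y S] in two ways shows that they have equal dimension. *)
Lemma lower_ker S A C D : Sp S -> block_form S A 0 C D ->
  \dim (lker (A - \1)%VF) = \dim (lker (D - \1)%VF).
Proof.
move=> hS hb; have SY (y : SY) : S (vsval y) = vsval (D y).
  by rewrite (block_formY _ hb) zero_lfunE linear0 add0r.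
have SYY y : y \in Y -> S y \in Y.
  by move=> yY; rewrite -(vsprojK yY) SY subvsP.
have := dim_inv_space hnd hY hS SYY.
rewrite (fix_dim SY) (lower_inv_space hb) limg_dim_eq ?join_map_ker ?capv0 //.
by rewrite dim_prodv dimvf addnC => /addnI.
Qed.

Lemma fdefect_upper P A B D k Bk n : Sp P -> \dim {:V} = (2 * n)%N ->
  block_form P A B 0 D ->
  block_form (lfun_exp P k) (lfun_exp A k) Bk 0 (lfun_exp D k) ->
  fdefect omega k P \1%VF =
    (1 - k%:Z) * n%:Z
    + k%:Z * (\dim (lker (A - \1%VF)))%:Z
    - (\dim (lker (lfun_exp A k - \1%VF)))%:Z
    + (morse_neg (gform Omega k Bk D) (lker (lfun_exp D k - \1%VF)))%:Z
    - k%:Z * (morse_neg (gform Omega 1 B D) (lker (lfun_exp D 1 - \1%VF)))%:Z.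
Proof.
move=> hP dV hb hbk; have hPk := SpX k hP.
have PX (x : SX) : P (vsval x) = vsval (A x).
  by rewrite (block_formX _ hb) zero_lfunE linear0 addr0.
have PkX (x : SX) : lfun_exp P k (vsval x) = vsval (lfun_exp A k x).
  by rewrite (block_formX _ hbk) zero_lfunE linear0 addr0.
have PXX x : x \in X -> P x \in X.
  by move=> xX; rewrite -(vsprojK xX) PX subvsP.
rewrite /gform lfun_exp1.
exact: (fdefect_lagr hnd hX hP PXX dV (upper_index hP hb)
  (upper_index hPk hbk) (fix_dim PX) (fix_dim PkX)).
Qed.

Lemma fdefect_lower P A C D k Ck n : Sp P -> \dim {:V} = (2 * n)%N ->
  block_form P A 0 C D ->
  block_form (lfun_exp P k) (lfun_exp A k) 0 Ck (lfun_exp D k) ->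
  fdefect omega k P \1%VF =
    (1 - k%:Z) * n%:Z
    + k%:Z * (\dim (lker (A - \1%VF)))%:Z
    - (\dim (lker (lfun_exp D k - \1%VF)))%:Z
    + (morse_pos (hform Omega k Ck A) (lker (lfun_exp A k - \1%VF)))%:Z
    - k%:Z * (morse_pos (hform Omega 1 C A) (lker (lfun_exp A 1 - \1%VF)))%:Z.
Proof.
move=> hP dV hb hbk; have hPk := SpX k hP.
have PY (y : SY) : P (vsval y) = vsval (D y).
  by rewrite (block_formY _ hb) zero_lfunE linear0 add0r.
have PkY (y : SY) : lfun_exp P k (vsval y) = vsval (lfun_exp D k y).
  by rewrite (block_formY _ hbk) zero_lfunE linear0 add0r.
have PYY y : y \in Y -> P y \in Y.
  by move=> yY; rewrite -(vsprojK yY) PY subvsP.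
rewrite /hform lfun_exp1 (lower_ker hP hb).
exact: (fdefect_lagr hnd hY hP PYY dV (lower_index hP hb)
  (lower_index hPk hbk) (fix_dim PY) (fix_dim PkY)).
Qed.

End BlockDefect.

Theorem theorem6p8 (R : realType) (V : vectType R[i])
    (omega : skewhermitian R V) (hnd : nondegenerate omega)
    (tau : R) (htau : 0 < tau) (gamma : R -> 'End(V)) (M : 'End(V))
    (hgamma : symp_path omega tau gamma)
    (hgamma0 : gamma 0 = \1%VF) (hgammaM : gamma tau = M)
    (P : 'End(V)) (hP : Sp omega P) :
  (* (a) *)
  (forall k : nat, (0 < k)%N ->
     iter_defect omega k tau gamma P = fdefect omega k M P /\
     (forall (tau' : R) (gamma' : R -> 'End(V)),
        0 < tau' -> symp_path omega tau' gamma' ->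
        gamma' 0 = \1%VF -> gamma' tau' = M ->
        iter_defect omega k tau' gamma' P = fdefect omega k M P) /\
     fdefect omega k M P =
       fdefect omega k (P^-1 \o M)%VF \1%VF - fdefect omega k P^-1%VF \1%VF) /\
  (* (b) *)
  (forall (n : nat) (X Y : {vspace V})
      (Omega : {bilinear (subvs_of X) -> (subvs_of Y) -> R[i]
                | *%R & ((@Num.conj R[i]) \; *%R)})
      (k : nat)
      (A Ak : 'End(subvs_of X)) (B Bk : 'Hom(subvs_of Y, subvs_of X))
      (C Ck : 'Hom(subvs_of X, subvs_of Y)) (D Dk : 'End(subvs_of Y)),
    lagrangian omega X -> lagrangian omega Y ->
    (X + Y)%VS = fullv -> (X :&: Y)%VS = 0%VS ->
    \dim {: V} = (2 * n)%N ->
    nondeg_pairing Omega -> associated_form Omega omega ->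
    (0 < k)%N ->
    block_form P A B C D -> block_form (lfun_exp P k) Ak Bk Ck Dk ->
    (* (i) *)
    (C = 0 ->
       let g1 := gform Omega 1 B D in
       let gk := gform Omega k Bk D in
       ((1 < k)%N ->
          [/\ Ak = lfun_exp A k,
              Bk = \sum_(j < k) (lfun_exp A j \o B \o lfun_exp D (k.-1 - j))%VF,
              Ck = 0 &
              Dk = lfun_exp D k]) /\
       fdefect omega k P \1%VF =
         (1 - k%:Z) * n%:Z
         + k%:Z * (\dim (lker (A - \1%VF)))%:Z
         - (\dim (lker (lfun_exp A k - \1%VF)))%:Z
         + (morse_neg gk (lker (lfun_exp D k - \1%VF)))%:Z
         - k%:Z * (morse_neg g1 (lker (lfun_exp D 1 - \1%VF)))%:Z) /\
    (* (ii) *)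
    (B = 0 ->
       let h1 := hform Omega 1 C A in
       let hk := hform Omega k Ck A in
       ((1 < k)%N ->
          [/\ Ak = lfun_exp A k,
              Bk = 0,
              Ck = \sum_(j < k) (lfun_exp D j \o C \o lfun_exp A (k.-1 - j))%VF &
              Dk = lfun_exp D k]) /\
       fdefect omega k P \1%VF =
         (1 - k%:Z) * n%:Z
         + k%:Z * (\dim (lker (A - \1%VF)))%:Z
         - (\dim (lker (lfun_exp D k - \1%VF)))%:Z
         + (morse_pos hk (lker (lfun_exp A k - \1%VF)))%:Z
         - k%:Z * (morse_pos h1 (lker (lfun_exp A 1 - \1%VF)))%:Z)).

Proof.
have hM : Sp omega M.
  by rewrite -hgammaM; case: hgamma => _; apply; rewrite lexx ltW.
split=> [k k0|n X Y Omega k A Ak B Bk C Ck D Dk hX hY XYsum XY0 dV _ hO k0 hP1 hPk].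
  split; first by rewrite -hgammaM; exact: iter_defect_fdefect.
  split; last exact: fdefect_reduce.
  by move=> t g t0 hg g0 <-; exact: iter_defect_fdefect.
have {}hX := (lagr_of omega X).1 hX; have {}hY := (lagr_of omega Y).1 hY.
split=> [C0 g1 gk|B0 h1 hk].
  rewrite {}C0 in hP1; have hPk' := block_form_upper k hP1.
  (* Blocks are unique because X and Y meet trivially, so the given blocks of P^k are the computed
     ones. *)
  have [AkE BkE CkE DkE] := block_form_inj XY0 hPk hPk'.
  split; first by split.
  rewrite AkE CkE DkE in hPk.
  exact: (fdefect_upper hnd hX XYsum XY0 hO hP dV hP1 hPk).
rewrite {}B0 in hP1; have hPk' := block_form_lower k hP1.
have [AkE BkE CkE DkE] := block_form_inj XY0 hPk hPk'.
split; first by split.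
rewrite AkE BkE DkE in hPk.
exact: (fdefect_lower hnd hY XYsum XY0 hO hP dV hP1 hPk).
Qed.
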